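(* Let $n\ge 0$. (i) Let $K$ be a field complete with respect to a nontrivial nonarchimedean absolute value. Then every finite projective module over $K\langle t_1,\dots,t_n\rangle^{\dagger}$ is free. (ii) Let $\mathcal{O}$ be a complete discrete valuation ring of mixed characteristic $(0,p)$. Then every finite projective module over $\mathcal{O}\langle t_1,\dots,t_n\rangle^{\dagger}$ is free.
   Context: For a multi-index $I=(i_1,\dots,i_n)$ of nonnegative integers write $t^I=t_1^{i_1}\cdots t_n^{i_n}$ and $|I|=i_1+\cdots+i_n$. The ring of overconvergent power series $K\langle t_1,\dots,t_n\rangle^{\dagger}$ is the ring of formal power series $\sum_I c_I t^I$ with $c_I\in K$ for which there exists a real number $\rho>1$ with $|c_I|\rho^{|I|}\to 0$ as $|I|\to\infty$. The ring $\mathcal{O}\langle t_1,\dots,t_n\rangle^{\dagger}$ is the ring of formal power series $\sum_I c_I t^I$ with $c_I\in\mathcal{O}$ satisfying $\liminf_{|I|\to\infty} v_p(c_I)/|I|>0$, where $v_p$ is the valuation on $\mathcal{O}$ with $v_p(p)=1$. *)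

(* Defs.v *)
From HB Require Import structures.
From mathcomp Require Import all_boot all_order all_algebra fraction.
From mathcomp Require Import boolp classical_sets functions reals ereal topology.
From mathcomp Require Import normedtype sequences.
From mathcomp Require Import ring lra zify.
Set Implicit Arguments.
Unset Strict Implicit.
Unset Printing Implicit Defensive.
Import Order.TTheory GRing.Theory Num.Theory.
Import numFieldNormedType.Exports.
Local Open Scope classical_set_scope.
Local Open Scope ring_scope.

Definition midx (n : nat) := {ffun 'I_n -> nat}.

HB.instance Definition _ n := GRing.Nmodule.on (midx n).
HB.instance Definition _ n := Choice.on (midx n).

Section MultiIndices.
Context {n : nat}.
Implicit Types I J : midx n.

Definition mdeg I : nat := (\sum_(i < n) I i)%N.

Definition mle J I : bool := [forall i, (J i <= I i)%N].

Definition msub I J : midx n := [ffun i => (I i - J i)%N].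

(* The exponents J <= I, listed without repetition; the box {0, .., |I|}^n
   contains all of them. *)
Definition mbelow I : seq (midx n) :=
  [seq J <- [seq [ffun i => (J i : nat)] | J : {ffun 'I_n -> 'I_(mdeg I).+1}]
         | mle J I].

Definition mdeg_infty : set_system (midx n) :=
  filter_from setT (fun N : nat => [set I | (N <= mdeg I)%N]).

Lemma maddE I J i : (I + J) i = (I i + J i)%N.
Proof. by rewrite ffunE. Qed.

Lemma mdegD I J : mdeg (I + J) = (mdeg I + mdeg J)%N.
Proof.
by rewrite /mdeg -big_split; apply: eq_bigr => i _; rewrite maddE.
Qed.

Lemma mdeg_ge I i : (I i <= mdeg I)%N.
Proof. by rewrite /mdeg (bigD1 i) //= leq_addr. Qed.

Lemma msubK I J : mle J I -> J + msub I J = I.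
Proof.
by move=> /forallP le; apply/ffunP => i; rewrite maddE ffunE subnKC.
Qed.

Lemma mle_addr I J : mle J (J + I).
Proof. by apply/forallP => i; rewrite maddE leq_addr. Qed.

Lemma maddK I J : msub (J + I) J = I.
Proof. by apply/ffunP => i; rewrite ffunE maddE addKn. Qed.

Lemma mem_mbelow I J : (J \in mbelow I) = mle J I.
Proof.
rewrite mem_filter andb_idr // => /forallP le.
have lt i : (J i < (mdeg I).+1)%N.
  by rewrite ltnS (leq_trans (le i)) // mdeg_ge.
apply/mapP; exists [ffun i => Ordinal (lt i)]; first by rewrite mem_enum.
by apply/ffunP => i; rewrite !ffunE.
Qed.

Lemma mbelow_uniq I : uniq (mbelow I).
Proof.
rewrite filter_uniq // map_inj_uniq ?enum_uniq // => J1 J2 /ffunP eqJ.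
by apply/ffunP => i; apply/val_inj; have := eqJ i; rewrite !ffunE.
Qed.

Lemma mle_trans : transitive mle.
Proof.
move=> J I K /forallP IJ /forallP JK; apply/forallP => i.
exact: leq_trans (IJ i) (JK i).
Qed.

Lemma perm_mbelow_sub I :
  perm_eq [seq msub I J | J <- mbelow I] (mbelow I).
Proof.
have sub_le J : mle (msub I J) I.
  by apply/forallP => i; rewrite ffunE leq_subr.
have subK J : mle J I -> msub I (msub I J) = J.
  by move=> /forallP le; apply/ffunP => i; rewrite !ffunE subKn.
apply: uniq_perm; rewrite ?mbelow_uniq //.
  rewrite map_inj_in_uniq ?mbelow_uniq // => J1 J2.
  by rewrite !mem_mbelow => /subK {2}<- /subK {2}<- ->.
move=> J; rewrite mem_mbelow; apply/mapP/idP => [[J' _ ->] //|le].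
by exists (msub I J); rewrite ?mem_mbelow ?subK.
Qed.

Lemma perm_mbelow_shift I J : mle J I ->
  perm_eq [seq J + L | L <- mbelow (msub I J)] [seq K <- mbelow I | mle J K].
Proof.
move=> leJI; apply: uniq_perm; first 1 last.
- by rewrite filter_uniq ?mbelow_uniq.
- move=> K; rewrite mem_filter mem_mbelow; apply/mapP/idP => [[L]|].
    rewrite mem_mbelow => leL ->; rewrite mle_addr -(msubK leJI) /=.
    apply/forallP => i; rewrite !maddE leq_add2l; exact: (forallP leL).
  case/andP=> JK KI; exists (msub K J); last by rewrite msubK.
  rewrite mem_mbelow; apply/forallP => i; rewrite !ffunE leq_sub2r //.
  exact: (forallP KI).
- rewrite map_inj_uniq ?mbelow_uniq // => L1 L2 eqL.
  by rewrite -(maddK L1 J) eqL maddK.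
Qed.

Lemma msub_add I J L : msub I (J + L) = msub (msub I J) L.
Proof. by apply/ffunP => i; rewrite !ffunE subnDA. Qed.

Global Instance mdeg_infty_filter : Filter mdeg_infty.
Proof.
apply: filter_from_filter; first by exists 0%N.
move=> N1 N2 _ _; exists (maxn N1 N2) => // I /=.
by rewrite geq_max => /andP[].
Qed.

End MultiIndices.

(* Formal power series in n variables, given by their coefficients; the ring
   structure below is the Cauchy product (not the pointwise product). *)
Definition mseries (n : nat) (A : Type) := midx n -> A.

HB.instance Definition _ n (A : choiceType) := Choice.copy (mseries n A)
  (midx n -> A).

Section FormalPowerSeries.
Variables (n : nat) (A : comNzRingType).
Implicit Types f g h : mseries n A.

Definition mseries_zero : mseries n A := fun=> 0.
Definition mseries_one : mseries n A := fun I => (I == 0)%:R.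
Definition mseries_opp f : mseries n A := fun I => - f I.
Definition mseries_add f g : mseries n A := fun I => f I + g I.
Definition mseries_mul f g : mseries n A :=
  fun I => \sum_(J <- mbelow I) f J * g (msub I J).

Fact mseries_addA : associative mseries_add.
Proof. by move=> f g h; apply/funext => I; exact: addrA. Qed.
Fact mseries_addC : commutative mseries_add.
Proof. by move=> f g; apply/funext => I; exact: addrC. Qed.
Fact mseries_add0 : left_id mseries_zero mseries_add.
Proof. by move=> f; apply/funext => I; exact: add0r. Qed.
Fact mseries_addN : left_inverse mseries_zero mseries_opp mseries_add.
Proof. by move=> f; apply/funext => I; exact: addNr. Qed.

HB.instance Definition _ := GRing.isZmodule.Build (mseries n A)
  mseries_addA mseries_addC mseries_add0 mseries_addN.

Fact mseries_mulC : commutative mseries_mul.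
Proof.
move=> f g; apply/funext => I; rewrite /mseries_mul.
rewrite -(perm_big _ (perm_mbelow_sub I)) big_map /=.
rewrite big_seq [RHS]big_seq; apply: eq_bigr => J; rewrite mem_mbelow => le.
rewrite mulrC; congr (g _ * _); apply/ffunP => i.
by rewrite !ffunE subKn //; exact: (forallP le).
Qed.

Fact mseries_mulA : associative mseries_mul.
Proof.
move=> f g h; apply/funext => I; rewrite /mseries_mul.
transitivity (\sum_(J <- mbelow I) \sum_(K <- mbelow I | mle J K)
    f J * g (msub K J) * h (msub I K)); last first.
  under [RHS]eq_bigr do rewrite mulr_suml.
  rewrite (exchange_big_dep xpredT) //= big_seq [RHS]big_seq.
  apply: eq_bigr => K; rewrite mem_mbelow => KI.
  rewrite -big_filter; apply: perm_big; apply: uniq_perm.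
  - by rewrite filter_uniq ?mbelow_uniq.
  - exact: mbelow_uniq.
  - move=> J; rewrite mem_filter !mem_mbelow andb_idr // => JK.
    exact: mle_trans JK KI.
rewrite big_seq [RHS]big_seq; apply: eq_bigr => J; rewrite mem_mbelow => JI.
rewrite -[RHS]big_filter -(perm_big _ (perm_mbelow_shift JI)) big_map /=.
rewrite mulr_sumr; apply: eq_bigr => L _.
by rewrite maddK msub_add mulrA.
Qed.

Fact mseries_mul1 : left_id mseries_one mseries_mul.
Proof.
move=> f; apply/funext => I; rewrite /mseries_mul.
have I0 : 0 \in mbelow I by rewrite mem_mbelow; apply/forallP => i; rewrite ffunE.
rewrite (bigD1_seq 0) ?mbelow_uniq //= big1 => [|J /negPf J0]; last first.
  by rewrite /mseries_one J0 mul0r.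
rewrite /mseries_one eqxx mul1r addr0; congr f.
by apply/ffunP => i; rewrite !ffunE subn0.
Qed.

Fact mseries_mulDl : left_distributive mseries_mul mseries_add.
Proof.
move=> f g h; apply/funext => I.
rewrite /mseries_mul /mseries_add -big_split /=.
by apply: eq_bigr => J _; rewrite mulrDl.
Qed.

Fact mseries_one_neq0 : mseries_one != 0.
Proof.
apply/eqP => /(congr1 (fun f : mseries n A => f 0)).
by rewrite /mseries_one eqxx; apply/eqP; rewrite oner_eq0.
Qed.

HB.instance Definition _ := GRing.Zmodule_isComNzRing.Build (mseries n A)
  mseries_mulA mseries_mulC mseries_mul1 mseries_mulDl mseries_one_neq0.

Lemma mseries_oneE I : (1 : mseries n A) I = (I == 0)%:R.
Proof. by []. Qed.

Lemma mseries_mulE f g I :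
  (f * g) I = \sum_(J <- mbelow I) f J * g (msub I J).
Proof. by []. Qed.

End FormalPowerSeries.

Section NonarchimedeanFields.
Variables (R : realType) (K : fieldType).

Record nonarch_absval := NonarchAbsval {
  absv :> K -> R;
  absv_ge0 : forall x, 0 <= absv x;
  absv_eq0 : forall x, absv x = 0 <-> x = 0;
  absvM : forall x y, absv (x * y) = absv x * absv y;
  absvD : forall x y, absv (x + y) <= Num.max (absv x) (absv y) }.

Definition nontrivial_absval (a : nonarch_absval) : Prop :=
  exists x : K, x != 0 /\ a x != 1.

Definition complete_absval (a : nonarch_absval) : Prop :=
  forall u : nat -> K,
    (forall e : R, 0 < e -> exists N : nat, forall i j : nat,
       (N <= i)%N -> (N <= j)%N -> a (u i - u j) < e) ->
    exists l : K, forall e : R, 0 < e -> exists N : nat, forall i : nat,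
      (N <= i)%N -> a (u i - l) < e.

End NonarchimedeanFields.

Section OverconvergentSeries.
Variables (R : realType) (n : nat) (K : fieldType) (a : nonarch_absval R K).
Implicit Types f g : mseries n K.

Definition overconvergent f : Prop :=
  exists2 rho : R, 1 < rho &
    (fun I => a (f I) * rho ^+ mdeg I) @ mdeg_infty --> (0 : R).

Definition oc_pred : {pred mseries n K} := [pred f | `[< overconvergent f >]].

Lemma absv0 : a 0 = 0. Proof. exact/absv_eq0. Qed.

Lemma absv1 : a 1 = 1.
Proof.
have n0 : a 1 != 0 by apply/eqP => /absv_eq0 /eqP; rewrite oner_eq0.
by apply: (mulfI n0); rewrite -absvM !mulr1.
Qed.

Lemma absvN x : a (- x) = a x.
Proof.
have N1 : a (-1) = 1.
  apply/eqP; rewrite -(@eqrXn2 _ 2) ?absv_ge0 // expr1n expr2 -absvM.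
  by rewrite mulrNN mulr1 absv1.
by rewrite -mulN1r absvM N1 mul1r.
Qed.

Lemma overconvergentP f : overconvergent f <->
  exists rho B : R, 1 < rho /\ forall I, a (f I) * rho ^+ mdeg I <= B.
Proof.
split=> [[rho rho1 /cvgrPdist_lt/(_ 1 ltr01)]|[rho [B [rho1 leB]]]].
  case=> N _ small.
  have rho_ge0 : 0 <= rho by rewrite ltW // (lt_trans ltr01).
  have term_ge0 I : 0 <= a (f I) * rho ^+ mdeg I.
    by rewrite mulr_ge0 ?absv_ge0 ?exprn_ge0.
  pose toI (J : {ffun 'I_n -> 'I_N}) : midx n := [ffun i => (J i : nat)].
  exists rho, (1 + \sum_J a (f (toI J)) * rho ^+ mdeg (toI J)).
  split=> // I; case: (leqP N (mdeg I)) => [ge|lt].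
    have := small I ge; rewrite /= sub0r normrN ger0_norm // => /ltW h.
    apply: le_trans h _; rewrite lerDl sumr_ge0 // => J _; exact: term_ge0.
  have ltI i : (I i < N)%N by rewrite (leq_ltn_trans (mdeg_ge I i)).
  have -> : I = toI [ffun i => Ordinal (ltI i)].
    by apply/ffunP => i; rewrite !ffunE.
  rewrite (bigD1 [ffun i => Ordinal (ltI i)]) //= addrCA lerDl addr_ge0 //.
  by rewrite sumr_ge0 // => J _; exact: term_ge0.
have rho0 : 0 < rho by rewrite (lt_trans ltr01).
pose sig := (1 + rho) / 2.
have sig1 : 1 < sig by rewrite /sig; lra.
have sig_lt : sig < rho by rewrite /sig; lra.
have sig0 : 0 < sig by rewrite (lt_trans ltr01).
exists sig => //.
have q0 : 0 <= sig / rho by rewrite divr_ge0 ?ltW.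
have q1 : `|sig / rho| < 1 by rewrite ger0_norm // ltr_pdivrMr // mul1r.
have cvg_q : (fun I : midx n => B * (sig / rho) ^+ mdeg I) @ mdeg_infty
             --> (0 : R).
  have /cvgrPdist_lt h := @cvg_geometric R B _ q1.
  apply/cvgrPdist_lt => e e0; have [N _ hN] := h e e0.
  by exists N => // I /= leN; exact: hN.
apply: (@squeeze_cvgr _ _ _ _ (fun=> 0) (fun I => B * (sig / rho) ^+ mdeg I)).
- exists 0%N => // I _ /=; rewrite mulr_ge0 ?absv_ge0 ?exprn_ge0 ?(ltW sig0) //=.
  have -> : sig ^+ mdeg I = rho ^+ mdeg I * (sig / rho) ^+ mdeg I.
    by rewrite -exprMn mulrC divfK // gt_eqF.
  by rewrite mulrA ler_wpM2r ?exprn_ge0.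
- exact: cvg_cst.
- exact: cvg_q.
Qed.

Lemma absv_sum (T : eqType) (s : seq T) (F : T -> K) (B : R) : 0 <= B ->
  {in s, forall t, a (F t) <= B} -> a (\sum_(t <- s) F t) <= B.
Proof.
move=> B0 leF; rewrite big_seq; elim/big_ind: _ => [|x y lex ley|t].
- by rewrite absv0.
- by rewrite (le_trans (absvD a x y)) // ge_max lex.
- exact: leF.
Qed.

Fact oc_subring_closed : subring_closed oc_pred.
Proof.
have two f g : overconvergent f -> overconvergent g ->
    exists r B C, [/\ 1 < r, 0 <= B, 0 <= C,
      forall I, a (f I) * r ^+ mdeg I <= B &
      forall I, a (g I) * r ^+ mdeg I <= C].
  move=> /overconvergentP[r [B [r1 leB]]] /overconvergentP[s [C [s1 leC]]].
  have m1 : 1 < Num.min r s by rewrite lt_min r1.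
  have m0 : 0 <= Num.min r s by rewrite (le_trans ler01) ?ltW.
  have lef I : a (f I) * Num.min r s ^+ mdeg I <= B.
    apply: le_trans (leB I); rewrite ler_wpM2l ?absv_ge0 // lerXn2r ?nnegrE //.
    - by rewrite (le_trans ler01) ?ltW.
    - by rewrite ge_min lexx.
  have leg I : a (g I) * Num.min r s ^+ mdeg I <= C.
    apply: le_trans (leC I); rewrite ler_wpM2l ?absv_ge0 // lerXn2r ?nnegrE //.
    - by rewrite (le_trans ler01) ?ltW.
    - by rewrite ge_min lexx orbT.
  exists (Num.min r s), B, C; split=> //.
    by apply: le_trans (lef 0); rewrite mulr_ge0 ?absv_ge0 ?exprn_ge0.
  by apply: le_trans (leg 0); rewrite mulr_ge0 ?absv_ge0 ?exprn_ge0.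
split.
- apply/asboolP/overconvergentP; exists 2, 1; split=> [|I]; first by lra.
  rewrite mseries_oneE; case: eqVneq => [->|_] /=.
    rewrite absv1 mul1r /mdeg big1 ?expr0 // => i _.
    by rewrite ffunE.
  by rewrite absv0 mul0r ler01.
- move=> f g /asboolP of_ /asboolP og.
  have [r [B [C [r1 B0 C0 lef leg]]]] := two f g of_ og.
  have r0 : 0 <= r by rewrite (le_trans ler01) ?ltW.
  apply/asboolP/overconvergentP; exists r, (B + C); split=> // I.
  have : a ((f - g) I) <= Num.max (a (f I)) (a (g I)).
    by rewrite -[a (g I)]absvN; exact: absvD.
  rewrite le_max => /orP[] h.
  + apply: (@le_trans _ _ B); last by rewrite lerDl.
    by apply: le_trans (lef I); rewrite ler_wpM2r ?exprn_ge0.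
  + apply: (@le_trans _ _ C); last by rewrite lerDr.
    by apply: le_trans (leg I); rewrite ler_wpM2r ?exprn_ge0.
- move=> f g /asboolP of_ /asboolP og.
  have [r [B [C [r1 B0 C0 lef leg]]]] := two f g of_ og.
  have r0 : 0 < r by rewrite (lt_trans ltr01).
  apply/asboolP/overconvergentP; exists r, (B * C); split=> // I.
  rewrite -ler_pdivlMr ?exprn_gt0 //; apply: absv_sum => [|J].
    by rewrite divr_ge0 ?mulr_ge0 ?exprn_ge0 ?(ltW r0).
  rewrite mem_mbelow => JI; rewrite ler_pdivlMr ?exprn_gt0 //.
  rewrite -{2}(msubK JI) mdegD exprD absvM mulrACA.
  have pos (h : mseries n K) L : 0 <= a (h L) * r ^+ mdeg L.
    by rewrite mulr_ge0 ?absv_ge0 ?exprn_ge0 ?ltW.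
  exact: ler_pM (pos f _) (pos g _) (lef _) (leg _).
Qed.

HB.instance Definition _ :=
  GRing.isSubringClosed.Build (mseries n K) oc_pred oc_subring_closed.

(* K<t_1, .., t_n>^dagger *)
Record oc_series := OcSeries { oc_val :> mseries n K; _ : oc_val \in oc_pred }.

HB.instance Definition _ := [isSub for oc_val].
HB.instance Definition _ := [Choice of oc_series by <:].
HB.instance Definition _ := [SubChoice_isSubComNzRing of oc_series by <:].

End OverconvergentSeries.

Section DiscreteValuationRings.

Local Notation "x %:F" := (@FracField.tofrac _ x).

(* v(0) should be +oo; the integer dval 0 is unspecified and never used. *)
Record discrete_valuation (F : fieldType) := DiscreteValuation {
  dval :> F -> int;
  dval_surj : forall k : int, exists2 x, x != 0 & dval x = k;
  dvalM : forall x y, x != 0 -> y != 0 -> dval (x * y) = dval x + dval y;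
  dvalD : forall x y, x != 0 -> y != 0 -> x + y != 0 ->
    Num.min (dval x) (dval y) <= dval (x + y) }.

Record dvr := DVR {
  dvr_ring :> idomainType;
  dvr_val : discrete_valuation {fraction dvr_ring};
  dvr_valP : forall x : {fraction dvr_ring}, x != 0 ->
    (exists a : dvr_ring, x = a%:F) <-> 0 <= dvr_val x }.

Implicit Types O : dvr.

Definition dvr_ord O (x : O) : int := dvr_val O (x%:F).

Definition dvr_maxideal O (x : O) : Prop := x = 0 \/ 0 < dvr_ord x.

(* x = y modulo the k-th power of the maximal ideal *)
Definition dvr_close O (k : nat) (x y : O) : Prop :=
  x = y \/ k%:Z <= dvr_ord (x - y).

Definition complete_dvr O : Prop :=
  forall u : nat -> O,
    (forall k : nat, exists N : nat, forall i j : nat,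
       (N <= i)%N -> (N <= j)%N -> dvr_close k (u i) (u j)) ->
    exists l : O, forall k : nat, exists N : nat, forall i : nat,
      (N <= i)%N -> dvr_close k (u i) l.

(* Characteristic 0, and residue field of characteristic p. *)
Definition mixed_characteristic (p : nat) O : Prop :=
  [/\ [pchar O] =i pred0, prime p & dvr_maxideal (p%:R : O)].

Record mixed_dvr (p : nat) := MixedDVR {
  mixed_dvr_dvr :> dvr;
  mixed_dvrP : mixed_characteristic p mixed_dvr_dvr }.

End DiscreteValuationRings.

Section OverconvergentSeriesDVR.
Variables (R : realType) (n p : nat) (O : mixed_dvr p).
Implicit Types c : mseries n O.

(* The valuation on O normalized by v_p(p) = 1. *)
Definition vp (x : O) : \bar R :=
  if x == 0 then +oo%E else ((dvr_ord x)%:~R / (dvr_ord (p%:R : O))%:~R)%:E.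

Definition mliminf (q : midx n -> \bar R) : \bar R :=
  ereal_sup [set ereal_inf [set q I | I in V] | V in mdeg_infty].

Definition overconvergent_dvr c : Prop :=
  (0 < mliminf (fun I => vp (c I) * ((mdeg I)%:R^-1)%:E))%E.

Definition ocd_pred : {pred mseries n O} :=
  [pred c | `[< overconvergent_dvr c >]].

Let w (x : O) : R := (dvr_ord x)%:~R / (dvr_ord (p%:R : O))%:~R.

Local Notation "x %:F" := (@FracField.tofrac _ x).

Let frac_neq0 (x : O) : x != 0 -> x%:F != 0.
Proof. by rewrite tofrac_eq0. Qed.

Lemma dvr_ord_ge0 (x : O) : x != 0 -> 0 <= dvr_ord x.
Proof. by move=> x0; apply/dvr_valP; [exact: frac_neq0|exists x]. Qed.

Lemma dvr_ordM (x y : O) : x != 0 -> y != 0 ->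
  dvr_ord (x * y) = dvr_ord x + dvr_ord y.
Proof.
by move=> x0 y0; rewrite /dvr_ord tofracM dvalM ?frac_neq0.
Qed.

Lemma dvr_ordp_gt0 : 0 < dvr_ord (p%:R : O).
Proof.
have [char0 pr_p [p0|//]] := mixed_dvrP O.
by have := char0 p; rewrite !inE pr_p p0 eqxx.
Qed.

Let wp_gt0 : 0 < (dvr_ord (p%:R : O))%:~R :> R.
Proof. by rewrite ltr0z dvr_ordp_gt0. Qed.

Let w_ge0 x : x != 0 -> 0 <= w x.
Proof.
by move=> x0; rewrite divr_ge0 ?(ltW wp_gt0) // ler0z dvr_ord_ge0.
Qed.

Let wM x y : x != 0 -> y != 0 -> w (x * y) = w x + w y.
Proof. by move=> x0 y0; rewrite /w dvr_ordM // intrD mulrDl. Qed.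

Let atleast (b : R) (x : O) : Prop := x = 0 \/ b <= w x.

Let atleastD b x y : atleast b x -> atleast b y -> atleast b (x + y).
Proof.
have [->|x0] := eqVneq x 0; first by rewrite add0r.
have [->|y0] := eqVneq y 0; first by rewrite addr0.
have [->|xy0] := eqVneq (x + y) 0; first by left.
move=> [/eqP|bx]; first by rewrite (negPf x0).
move=> [/eqP|b_y]; first by rewrite (negPf y0).
right; have : Num.min (dvr_ord x) (dvr_ord y) <= dvr_ord (x + y).
  by rewrite /dvr_ord tofracD dvalD ?frac_neq0 // -tofracD frac_neq0.
rewrite ge_min => /orP[] h.
  by apply: le_trans bx _; rewrite /w ler_pM2r ?invr_gt0 // ler_int.
by apply: le_trans b_y _; rewrite /w ler_pM2r ?invr_gt0 // ler_int.
Qed.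

Let atleastN b x : atleast b x -> atleast b (- x).
Proof.
have N10 : (-1 : O) != 0 by rewrite oppr_eq0 oner_eq0.
have ord1 : dvr_ord (1 : O) = 0.
  by apply: (@addrI _ (dvr_ord (1 : O))); rewrite -dvr_ordM ?oner_eq0 // mulr1 addr0.
have ordN1 : dvr_ord (-1 : O) = 0.
  have : dvr_ord (-1 : O) + dvr_ord (-1 : O) = 0.
    by rewrite -dvr_ordM // mulrNN mulr1 ord1.
  by have := dvr_ord_ge0 N10; lia.
move=> [->|bx]; first by left; rewrite oppr0.
have [->|x0] := eqVneq x 0; first by left; rewrite oppr0.
by right; rewrite -mulN1r wM // {1}/w ordN1 mul0r add0r.
Qed.

Lemma overconvergent_dvrP c : overconvergent_dvr c <->
  exists eps C : R, [/\ 0 < eps, 0 <= C &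
    forall I, atleast (eps * (mdeg I)%:R - C) (c I)].
Proof.
split=> [/ereal_sup_gt[_ [V [N _ NV] <-] inf_gt0]|[eps [C [eps0 C0 leC]]]].
  have [eps eps0 le_inf] : exists2 eps : R, 0 < eps &
      (eps%:E <= ereal_inf [set (vp (c I) * ((mdeg I)%:R^-1)%:E)%E | I in V])%E.
    case: ereal_inf inf_gt0 => [r||] //.
      by rewrite lte_fin => r0; exists r.
    by exists 1; rewrite ?ltr01 ?leey.
  exists eps, (eps * N%:R); split=> //; first by rewrite mulr_ge0 ?(ltW eps0).
  move=> I; have [->|cI0] := eqVneq (c I) 0; [by left|right].
  have [lt|ge] := leqP (mdeg I) N.
    apply: le_trans (w_ge0 cI0).
    by rewrite subr_le0 ler_pM2l // ler_nat.
  have d0 : 0 < (mdeg I)%:R :> R by rewrite ltr0n (leq_ltn_trans _ ge).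
  have : (eps%:E <= vp (c I) * ((mdeg I)%:R^-1)%:E)%E.
    apply: (le_trans le_inf); apply: ereal_inf_lbound; exists I => //.
    by apply: NV => /=; exact: ltnW.
  rewrite /vp (negPf cI0) -EFinM lee_fin -/(w _) ler_pdivlMr // => h.
  by apply: le_trans h; rewrite lerBlDr lerDl mulr_ge0 // ltW.
have e2 : 0 < eps / 2 by rewrite divr_gt0.
pose N := (Num.truncn (C / (eps / 2))).+1.
apply: (@lt_le_trans _ _ (eps / 2)%:E); first by rewrite lte_fin.
apply: le_ereal_sup_tmp; exists (ereal_inf
    [set (vp (c I) * ((mdeg I)%:R^-1)%:E)%E | I in [set I | (N <= mdeg I)%N]]).
  by exists [set I | (N <= mdeg I)%N] => //; exists N.
apply: le_ereal_inf_tmp => _ [I /= leN <-].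
have d0 : 0 < (mdeg I)%:R :> R by rewrite ltr0n (leq_trans _ leN).
rewrite /vp; have [_|cI0] := eqVneq (c I) 0.
  by rewrite gt0_mulye ?leey // lte_fin invr_gt0.
rewrite -EFinM lee_fin -/(w _) ler_pdivlMr //.
case: (leC I) => [/eqP|]; first by rewrite (negPf cI0).
apply: le_trans; rewrite lerBrDr -lerBrDl -mulrBl.
have -> : eps - eps / 2 = eps / 2 by field.
rewrite -ler_pdivrMl // mulrC ltW //.
apply: (@lt_le_trans _ _ N%:R); last by rewrite ler_nat.
by rewrite real_truncnS_gt // num_real.
Qed.

Fact ocd_subring_closed : subring_closed ocd_pred.
Proof.
split.
- apply/asboolP/overconvergent_dvrP; exists 1, 0; split=> // I.
  rewrite mseries_oneE; case: eqVneq => [->|_] /=; last by left.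
  right; rewrite /mdeg big1 => [|i _]; last by rewrite ffunE.
  by rewrite mulr0 subr0 w_ge0 ?oner_eq0.
- move=> f g /asboolP/overconvergent_dvrP[e [C [e0 C0 lef]]].
  move=> /asboolP/overconvergent_dvrP[d [D [d0 D0 leg]]].
  apply/asboolP/overconvergent_dvrP; exists (Num.min e d), (Num.max C D).
  split=> [||I]; rewrite ?lt_min ?le_max ?e0 ?C0 //.
  have le1 x y : x = e /\ y = C \/ x = d /\ y = D ->
      Num.min e d * (mdeg I)%:R - Num.max C D <= x * (mdeg I)%:R - y.
    case=> -[-> ->]; rewrite lerB ?ler_wpM2r //.
    + by rewrite ge_min lexx.
    + by rewrite le_max lexx.
    + by rewrite ge_min lexx orbT.
    + by rewrite le_max lexx orbT.
  apply: atleastD; [|apply: atleastN].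
  + by case: (lef I) => [->|h]; [left|right; apply: le_trans h; apply: le1; left].
  + by case: (leg I) => [->|h]; [left|right; apply: le_trans h; apply: le1; right].
- move=> f g /asboolP/overconvergent_dvrP[e [C [e0 C0 lef]]].
  move=> /asboolP/overconvergent_dvrP[d [D [d0 D0 leg]]].
  apply/asboolP/overconvergent_dvrP; exists (Num.min e d), (C + D).
  split=> [||I]; rewrite ?lt_min ?addr_ge0 ?e0 //.
  rewrite mseries_mulE big_seq.
  elim/big_ind: _ => [|x y|J]; [by left|exact: atleastD|].
  rewrite mem_mbelow => JI.
  have [->|fJ0] := eqVneq (f J) 0; first by left; rewrite mul0r.
  have [->|gJ0] := eqVneq (g (msub I J)) 0; first by left; rewrite mulr0.
  case: (lef J) => [/eqP|hf]; first by rewrite (negPf fJ0).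
  case: (leg (msub I J)) => [/eqP|hg]; first by rewrite (negPf gJ0).
  right; rewrite wM // -{1}(msubK JI) mdegD natrD.
  apply: le_trans (lerD hf hg).
  rewrite mulrDr opprD addrACA lerD // lerD2r ler_wpM2r //.
    by rewrite ge_min lexx.
  by rewrite ge_min lexx orbT.
Qed.

HB.instance Definition _ :=
  GRing.isSubringClosed.Build (mseries n O) ocd_pred ocd_subring_closed.

(* O<t_1, .., t_n>^dagger *)
Record ocd_series :=
  OcdSeries { ocd_val :> mseries n O; _ : ocd_val \in ocd_pred }.

HB.instance Definition _ := [isSub for ocd_val].
HB.instance Definition _ := [Choice of ocd_series by <:].
HB.instance Definition _ := [SubChoice_isSubComNzRing of ocd_series by <:].

End OverconvergentSeriesDVR.

Section Modules.
Variables (A : comNzRingType) (P : lmodType A).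

Definition finite_module : Prop :=
  exists (m : nat) (e : 'I_m -> P), forall x : P,
    exists c : 'I_m -> A, x = \sum_(i < m) c i *: e i.

Definition projective_module : Prop :=
  forall (M N : lmodType A) (g : {linear M -> N}) (f : {linear P -> N}),
    (forall y : N, exists x : M, g x = y) ->
    exists h : {linear P -> M}, forall x : P, g (h x) = f x.

Definition free_module : Prop :=
  exists (T : choiceType) (e : T -> P),
    (forall x : P, exists (s : seq T) (c : T -> A),
       x = \sum_(t <- s) c t *: e t) /\
    (forall (s : seq T) (c : T -> A), uniq s ->
       \sum_(t <- s) c t *: e t = 0 -> forall t, t \in s -> c t = 0).

End Modules.

(* Main.v *)
Require Import Defs.
From HB Require Import structures.
From mathcomp Require Import all_boot all_order all_algebra all_fingroup.
From mathcomp Require Import fraction generic_quotient ring_quotient.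
From mathcomp Require Import boolp classical_sets functions reals ereal.
From mathcomp Require Import topology normedtype sequences ring lra zify.
Set Implicit Arguments.
Unset Strict Implicit.
Unset Printing Implicit Defensive.
Import Order.TTheory GRing.Theory Num.Theory.
Import numFieldNormedType.Exports.
Local Open Scope ring_scope.

(** A finite projective module is a direct summand of a free module, that is,
    the image of an idempotent matrix E, and it is free as soon as E = X Y with
    Y X = 1. So the claim is that the rings of overconvergent series are
    projective-free: all their idempotent matrices factor in this way.

    The core is an abstract version of the Quillen-Suslin theorem,
    [projective_free_weierstrass]. Let A and B be domains and ev a morphism
    from A[X] to B such that every nonzero element of B becomes, after an
    automorphism of B and multiplication by a unit, the image of a monic
    polynomial g for which division with remainder of degree less than deg g is
    possible, and unique, in B. If A is projective-free, then so is B. There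
    are two steps.

    The kernel of a unimodular row over B is free. Indeed one entry may be
    taken to be a monic g; dividing the others by g makes the row polynomial;
    by Suslin's theorem [suslin] this row is equivalent to its value at 0,
    which is a row over A.

    Every projective module P over B is stably free. Indeed P is free over the
    field of fractions, hence contains a free module F with gP inside F, where
    g may again be taken to be monic. Division by g makes P / F a direct summand
    of a free A-module of finite rank, so P / F is free over A; if T is the
    matrix of multiplication by t = ev X on it, the relations given by t - T
    present P as the cokernel of a split injection of free modules of finite
    rank. Splitting off unimodular rows then shows that P is free
    ([splits_of_factor]).

    For overconvergent series over a complete field one argues by induction on
    the number of variables, A being the series in the preceding variables. The
    hypothesis on B is the Weierstrass preparation theorem. The substitution
    which adds to each other variable a suitable power of t makes a power of t
    strictly dominant for a Gauss norm of radius slightly greater than 1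
    ([normalization], [dominated_near1]), and division is then the fixed point
    problem of a contraction ([division_exists]). The absolute value may be
    trivial: the overconvergent series are then the polynomials, and the result
    is the classical Quillen-Suslin theorem.

    For overconvergent series over a discrete valuation ring, reduction modulo
    the maximal ideal is a surjection onto the polynomial ring over the residue
    field, whose kernel is contained in the Jacobson radical
    ([overconvergent_dvr_inverse]); and factorizations of idempotents lift along
    such a surjection ([projective_free_lift]). *)

(** * Idempotent matrices and projective-free rings *)

(** The image of an idempotent matrix is a free module exactly when the matrix
    factors in this way: the rows of [Y] are then a basis of the row space of
    [E], and [X] gives the coordinates. *)
Definition splits (A : comNzRingType) m (E : 'M[A]_m) : Prop :=
  exists r (X : 'M[A]_(m, r)) (Y : 'M[A]_(r, m)), X *m Y = E /\ Y *m X = 1%:M.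

Definition projective_free (A : comNzRingType) : Prop :=
  forall m (E : 'M[A]_m), E *m E = E -> splits E.

(** The kernel of a unimodular row [rho] (acting on columns) is the image of
    the idempotent [1 - zeta *m rho], for any section [zeta] of [rho]. *)
Definition free_kernel (A : comNzRingType) m (rho : 'rV[A]_m) : Prop :=
  exists zeta : 'cV[A]_m, rho *m zeta = 1%:M /\ splits (1%:M - zeta *m rho).

(** [S] and [W] are inverse isomorphisms between the images of the idempotents
    [E] and [W *m S], which may be of different sizes. *)
Lemma splits_transfer (A : comNzRingType) m n (E : 'M[A]_m)
    (S : 'M[A]_(m, n)) (W : 'M[A]_(n, m)) :
  S *m W = E -> W *m E = W -> splits (W *m S) -> splits E.
Proof.
move=> SW WE [r [X [Y [XY YX]]]].
exists r, (S *m X), (Y *m W); split.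
  by rewrite mulmxA -(mulmxA S) XY mulmxA SW -mulmxA SW -{1}SW -mulmxA WE.
have -> : Y *m W *m (S *m X) = Y *m (W *m S) *m X by rewrite !mulmxA.
by rewrite -XY mulmxA -mulmxA YX mulmx1.
Qed.

Lemma free_kernel_mulr (A : comNzRingType) m (rho : 'rV[A]_m) (V V' : 'M[A]_m) :
  V *m V' = 1%:M -> free_kernel rho -> free_kernel (rho *m V).
Proof.
move=> VV' [z [rz [r [X [Y [XY YX]]]]]]; have V'V := mulmx1C VV'.
exists (V' *m z); split; first by rewrite mulmxA -(mulmxA rho) VV' mulmx1.
exists r, (V' *m X), (Y *m V); split; last first.
  by rewrite mulmxA -(mulmxA Y) VV' mulmx1.
rewrite mulmxA -(mulmxA V') XY mulmxBr mulmxBl mulmx1 V'V.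
by rewrite !mulmxA.
Qed.

Lemma splits_map (A B : comNzRingType) (f : {rmorphism A -> B})
    m (E : 'M[A]_m) :
  splits E -> splits (map_mx f E).
Proof.
move=> [r [X [Y [<- YX]]]]; exists r, (map_mx f X), (map_mx f Y).
by rewrite -!map_mxM YX map_mx1.
Qed.

Lemma free_kernel_map (A B : comNzRingType) (f : {rmorphism A -> B}) m
  (rho : 'rV[A]_m) : free_kernel rho -> free_kernel (map_mx f rho).
Proof.
move=> [z [rz sp]]; exists (map_mx f z); split.
  by rewrite -map_mxM rz map_mx1.
by rewrite -map_mxM -(map_mx1 f) -map_mxB; exact: splits_map.
Qed.

Lemma kernel_basis_annihilated (A : comNzRingType) m r (rho : 'rV[A]_m) z
    (X : 'M[A]_(m, r)) (Y : 'M[A]_(r, m)) :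
  rho *m z = 1%:M -> X *m Y = 1%:M - z *m rho -> Y *m X = 1%:M -> rho *m X = 0.
Proof.
move=> rz XY YX; rewrite -[X]mulmx1 -YX mulmxA mulmxA -(mulmxA rho) XY mulmxBr.
by rewrite mulmx1 mulmxA rz mul1mx subrr mul0mx.
Qed.

(** Two sections of [rho] define two projections onto the same kernel, so a
    basis obtained from the one serves for the other. *)
Lemma free_kernel_section (A : comNzRingType) m (rho : 'rV[A]_m) z :
  rho *m z = 1%:M -> free_kernel rho -> splits (1%:M - z *m rho).
Proof.
move=> rz [z' [rz' [r [X [Y [XY YX]]]]]].
have rX := kernel_basis_annihilated rz' XY YX.
have r0 : rho *m (1%:M - z *m rho) = 0.
  by rewrite mulmxBr mulmx1 mulmxA rz mul1mx subrr.
exists r, X, (Y *m (1%:M - z *m rho)); split.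
  by rewrite mulmxA XY mulmxBl mul1mx -mulmxA r0 mulmx0 subr0.
by rewrite -mulmxA mulmxBl mul1mx -mulmxA rX mulmx0 subr0.
Qed.

(** A module with a free complement is free once kernels of unimodular rows
    are: the rows of [L] are split off one at a time, each being a unimodular
    row on the kernel of the preceding ones. *)
Lemma splits_sub1 (B : comNzRingType) s m
    (L : 'M[B]_(s, m)) (Z : 'M[B]_(m, s)) :
  (forall k (rho : 'rV[B]_k) zeta, rho *m zeta = 1%:M -> free_kernel rho) ->
  L *m Z = 1%:M -> splits (1%:M - Z *m L).
Proof.
move=> KF; elim: s => [|s IHs] in m L Z *.
  move=> _; exists m, 1%:M, 1%:M; rewrite mulmx1; split=> //.
  by rewrite [Z]thinmx0 mul0mx subr0.
rewrite -[s.+1]/(1 + s)%N in L Z *.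
rewrite -[L]vsubmxK -[Z]hsubmxK.
move: (usubmx L) (dsubmx L) => rho L1.
move: (lsubmx Z) (rsubmx Z) => z Z1.
rewrite mul_col_row mul_row_col scalar_mx_block.
move=> /eq_block_mx [rz rZ1 Lz LZ].
have [r [X [Y [XY YX]]]] := free_kernel_section rz (KF _ _ _ rz).
have [|k [X1 [Y1 [XY1 YX1]]]] := IHs r (L1 *m X) (Y *m Z1).
  have -> : L1 *m X *m (Y *m Z1) = L1 *m (X *m Y) *m Z1 by rewrite !mulmxA.
  by rewrite XY mulmxBr mulmx1 mulmxBl mulmxA Lz mul0mx mul0mx subr0.
exists k, (X *m X1), (Y1 *m Y); split; last first.
  have -> : Y1 *m Y *m (X *m X1) = Y1 *m (Y *m X) *m X1 by rewrite !mulmxA.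
  by rewrite YX mulmx1.
have -> : X *m X1 *m (Y1 *m Y) = X *m (X1 *m Y1) *m Y by rewrite !mulmxA.
rewrite XY1 mulmxBr mulmx1 mulmxBl XY.
have -> : X *m (Y *m Z1 *m (L1 *m X)) *m Y = (X *m Y) *m (Z1 *m L1) *m (X *m Y).
  by rewrite !mulmxA.
rewrite XY opprD addrA; congr (_ - _).
rewrite mulmxBl mul1mx -(mulmxA z) (mulmxA rho) rZ1 mul0mx mulmx0 subr0.
by rewrite mulmxBr mulmx1 mulmxA -(mulmxA Z1) Lz mulmx0 mul0mx subr0.
Qed.

(** * Maximal ideals and residue fields *)

Definition ideal_axiom (A : comNzRingType) (J : A -> Prop) : Prop :=
  [/\ J 0, forall x y, J x -> J y -> J (x + y) & forall x y, J x -> J (y * x)].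

(** Maximality is phrased as invertibility modulo [J], which is what turns the
    quotient into a field. *)
Definition maximal_axiom (A : comNzRingType) (J : A -> Prop) : Prop :=
  [/\ ideal_axiom J, ~ J 1 & forall x, ~ J x -> exists y, J (y * x - 1)].

Section MaximalQuotient.
Variables (A : comNzRingType) (J : A -> Prop).
Hypothesis maxJ : maximal_axiom J.

Let I : {pred A} := fun x => `[< J x >].

Fact ideal_pred_closed : idealr_closed I.
Proof.
have [[J0 JD JM] J1 _] := maxJ; split; first exact/asboolP.
  by apply/negP => /asboolP.
by move=> a x y /asboolP Jx /asboolP Jy; apply/asboolP;
  apply: JD (JM _ _ Jx) Jy.
Qed.

HB.instance Definition _ := isIdealr.Build A I ideal_pred_closed.

Local Notation k := {ideal_quot I}.
Let pi (x : A) : k := \pi_k%qT x.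

Let pi_eq0 x : (pi x == 0) = (x \in I).
Proof.
by rewrite -[0 in LHS](rmorph0 (\pi_k%qT : A -> k)) -[x in RHS]subr0
  Quotient.idealrBE.
Qed.

Let ex_inv (x : k) : exists y : k, x != 0 -> y * x = 1.
Proof.
rewrite -[x]reprK; have [e|x0] := eqVneq (pi (repr x)) 0; first by exists 0.
have [_ _ maxx] := maxJ.
have [y Jy] : exists y, J (y * repr x - 1).
  by apply: maxx => Jx; move: x0; rewrite pi_eq0 => /negP; apply; exact/asboolP.
exists (pi y) => _; apply/eqP; rewrite -subr_eq0.
rewrite /pi -rmorphM -(rmorph1 (\pi_k%qT : A -> k)) -rmorphB -/(pi _) pi_eq0.
exact/asboolP.
Qed.

Lemma maximal_quotient : exists (k : fieldType) (pi : {rmorphism A -> k}),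
  (forall x, exists a, pi a = x) /\ (forall a, pi a = 0 <-> J a).
Proof.
have [inv invP] := choice ex_inv.
pose inv' x := if x == 0 then 0 else inv x.
have i1 x : x != 0 -> inv' x * x = 1.
  by rewrite /inv' => x0; rewrite (negPf x0); exact: invP.
have i0 : inv' 0 = 0 by rewrite /inv' eqxx.
pose F : fieldType := HB.pack k (GRing.ComNzRing_isField.Build k i1 i0).
exists F, (\pi_k%qT : {rmorphism A -> k}); split.
  by move=> x; exists (repr (x : k)); exact: reprK.
move=> a; split=> [/eqP|Ja]; last by apply/eqP; rewrite pi_eq0; exact/asboolP.
by rewrite pi_eq0 => /asboolP.
Qed.

End MaximalQuotient.

Section MaximalIdeals.
#[local] Open Scope classical_set_scope.
#[local] Open Scope ring_scope.

(** Zorn's lemma, applied to the proper ideals containing [J] together with the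
    empty set; the latter is there only to bound the empty chain. *)
Lemma maximal_ideal_exists (A : comNzRingType) (J : A -> Prop) :
  ideal_axiom J -> ~ J 1 ->
  exists2 M, maximal_axiom M & forall x, J x -> M x.
Proof.
move=> idJ J1; have [J0 JD JM] := idJ.
pose P (X : set A) := X = set0 \/ [/\ J `<=` X, ideal_axiom X & ~ X 1].
have [F FP Ftot|M [PM maxM]] := @Zorn_bigcup A P.
  have [[X FX [x Xx]]|noX] := pselect (exists2 X, F X & X !=set0); last first.
    left; rewrite -subset0 => x [X FX Xx]; apply: noX.
    by exists X => //; exists x.
  have good Y y : F Y -> Y y -> [/\ J `<=` Y, ideal_axiom Y & ~ Y 1].
    by move=> FY Yy; have [Y0|//] := FP _ FY; rewrite Y0 in Yy.
  right; split.
  - by have [JX _ _] := good _ _ FX Xx => y /JX Xy; exists X.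
  - split.
    + by have [_ [X0 _ _] _] := good _ _ FX Xx; exists X.
    + move=> y z [Y FY Yy] [Z FZ Zz].
      have [YZ|ZY] := Ftot _ _ FY FZ.
        have [_ [_ ZD _] _] := good _ _ FZ Zz; exists Z => //.
        by apply: ZD => //; exact: YZ.
      have [_ [_ YD _] _] := good _ _ FY Yy; exists Y => //.
      by apply: YD => //; exact: ZY.
    + move=> y z [Y FY Yy]; have [_ [_ _ YM] _] := good _ _ FY Yy.
      by exists Y => //; exact: YM.
  - by move=> [Y FY Y1]; have [_ _ /(_ Y1)] := good _ _ FY Y1.
have {PM}[JM' [[M0 MD MM] M1]] : J `<=` M /\ ideal_axiom M /\ ~ M 1.
  have [M0|[? ? ?]] := PM; last by [].
  exfalso; apply: (maxM J); last by right; split.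
  by rewrite M0; split=> [x|/(_ 0 J0)] //.
exists M => //; split=> // x Mx.
(* The ideal generated by M and x contains 1, M being maximal. *)
pose N : set A := [set z | exists y m, M m /\ z = y * x + m].
have [N1|N1] := pselect (N 1).
  have [y [m [Mm e]]] := N1; exists y.
  by rewrite e opprD addrA subrr sub0r -mulN1r; exact: MM.
exfalso; apply: (maxM N); last first.
  right; split=> //.
  - by move=> z /JM' Mz; exists 0, z; rewrite mul0r add0r.
  - split; first by exists 0, 0; rewrite mul0r add0r.
    + move=> _ _ [y [m [Mm ->]]] [z [l [Ml ->]]].
      exists (y + z), (m + l); split; [exact: MD|ring].
    + move=> _ u [y [m [Mm ->]]]; exists (u * y), (u * m).
      by split; [exact: MM|ring].
split; first by move=> z Mz; exists 0, z; rewrite mul0r add0r.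
by move=> NM; apply: Mx; apply: NM; exists 1, 0; rewrite mul1r addr0.
Qed.

End MaximalIdeals.

Lemma residue_field_exists (A : comNzRingType) (J : A -> Prop) :
  ideal_axiom J -> ~ J 1 ->
  exists (k : fieldType) (pi : {rmorphism A -> k}),
    (forall x, exists a, pi a = x) /\ (forall a, J a -> pi a = 0).
Proof.
move=> idJ J1; have [M maxM JM] := maximal_ideal_exists idJ J1.
have [k [pi [surj ker]]] := maximal_quotient maxM.
by exists k, pi; split=> // a /JM /ker.
Qed.

(** * Unimodular rows over a polynomial ring: Suslin's theorem *)

Definition row_equiv (A : comNzRingType) m (f g : 'rV[A]_m) : Prop :=
  exists V V', V *m V' = 1%:M /\ f *m V = g.

Section RowEquiv.
Variables (A : comNzRingType) (m : nat).
Implicit Types f g h : 'rV[A]_m.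

Lemma row_equiv_refl f : row_equiv f f.
Proof. by exists 1%:M, 1%:M; rewrite !mulmx1. Qed.

Lemma row_equiv_sym f g : row_equiv f g -> row_equiv g f.
Proof.
move=> [V [V' [VV' <-]]]; exists V', V; rewrite -mulmxA VV' mulmx1.
by split=> //; exact: mulmx1C.
Qed.

Lemma row_equiv_trans f g h : row_equiv f g -> row_equiv g h -> row_equiv f h.
Proof.
move=> [V [V' [VV' <-]]] [U [U' [UU' <-]]]; exists (V *m U), (U' *m V').
by rewrite -!mulmxA (mulmxA U) UU' mul1mx VV'.
Qed.

Lemma free_kernel_equiv f g : row_equiv f g -> free_kernel f -> free_kernel g.
Proof. by move=> [V [V' [VV' <-]]]; exact: free_kernel_mulr VV'. Qed.

Lemma row_equiv_transvection f (y : 'cV[A]_m) (w : 'rV[A]_m) :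
  w *m y = 0 -> row_equiv f (f + f *m y *m w).
Proof.
move=> wy; exists (1%:M + y *m w), (1%:M - y *m w); split; last first.
  by rewrite mulmxDr mulmx1 mulmxA.
rewrite mulmxDl !mul1mx mulmxBr mulmx1 -(mulmxA y w) (mulmxA w) wy.
by rewrite mul0mx mulmx0 subr0 subrK.
Qed.

End RowEquiv.

Lemma row_equiv_map (A B : comNzRingType) (f : {rmorphism A -> B}) m
  (u v : 'rV[A]_m) : row_equiv u v -> row_equiv (map_mx f u) (map_mx f v).
Proof.
move=> [V [V' [VV' <-]]]; exists (map_mx f V), (map_mx f V').
by rewrite -!map_mxM VV' map_mx1.
Qed.

Section Swap.
Variables (C : idomainType) (k : nat) (c : C).
Hypothesis c0 : c != 0.

(** The heart of Suslin's argument. If [N] and [N'] have the same determinant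
    [c] and are congruent modulo [c], then [N^-1 *m N'] has entries in the ring,
    namely [1 + \adj N *m D], and so carries the first row of [N] to that of
    [N']. The remaining entries, being congruent modulo [c], are corrected by
    multiples of the first two, whose ideal contains [c]. *)
Lemma row_equiv_congr (N N' D : 'M[C]_2) (r r' S : 'rV[C]_k) :
  \det N = c -> \det N' = c -> N' = N + c *: D -> r' = r + c *: S ->
  row_equiv (row_mx (row 0 N) r) (row_mx (row 0 N') r').
Proof.
move=> dN dN' defN' defr'.
pose G := 1%:M + \adj N *m D; pose G' := 1%:M - \adj N' *m D.
have NG : N *m G = N'.
  by rewrite mulmxDr mulmx1 mulmxA mul_mx_adj dN mul_scalar_mx.
have N'G : N' *m G' = N.
  by rewrite mulmxBr mulmx1 mulmxA mul_mx_adj dN' mul_scalar_mx defN' addrK.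
have GG' : G *m G' = 1%:M.
  have : c *: (G *m G') = c *: 1%:M.
    rewrite -mul_scalar_mx -dN -mul_adj_mx -mulmxA (mulmxA N) NG N'G.
    by rewrite mul_adj_mx scalemx1.
  move=> /matrixP e; apply/matrixP => i j.
  by have := e i j; rewrite [LHS]mxE [RHS]mxE => /(mulfI c0).
pose H := col 0 (\adj N) *m S.
exists (block_mx G H 0 1%:M), (block_mx G' (- (G' *m H)) 0 1%:M); split.
  rewrite mulmx_block !mulmx0 !mul0mx !mulmx1 !addr0 GG' add0r mulmxN mulmxA.
  by rewrite GG' mul1mx addNr -scalar_mx_block.
rewrite mul_row_block mulmx0 addr0 mulmx1 -row_mul NG; congr row_mx.
rewrite mulmxA defr' addrC; congr (_ + _).
have -> : row 0 N *m col 0 (\adj N) = c%:M.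
  apply/matrixP => i j; rewrite !ord1 colE mulmxA -row_mul mul_mx_adj dN -colE.
  by rewrite !mxE.
by rewrite mul_scalar_mx.
Qed.

End Swap.

Lemma comp_polyD_dvd (A : comNzRingType) (p b z : {poly A}) :
  exists w, p \Po (b + z) = p \Po b + z * w.
Proof.
elim/poly_ind: p => [|p c [w IH]]; first by exists 0;
  rewrite !comp_poly0 mulr0 addr0.
exists (p \Po b + w * (b + z)).
rewrite !comp_polyD !comp_polyM !comp_polyX !comp_polyC IH; ring.
Qed.

Lemma map_comp_polyD_dvd (A : comNzRingType) m n (M : 'M[{poly A}]_(m, n)) b z :
  exists W, map_mx (comp_poly (b + z)) M = map_mx (comp_poly b) M + z *: W.
Proof.
have /choice [w wP] : forall ij : 'I_m * 'I_n, exists w,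
    M ij.1 ij.2 \Po (b + z) = M ij.1 ij.2 \Po b + z * w.
  by move=> ij; exact: comp_polyD_dvd.
exists (\matrix_(i, j) w (i, j)); apply/matrixP => i j; rewrite !mxE.
exact: (wP (i, j)).
Qed.

Section Suslin.
Variables (A : idomainType).
Local Notation "f @[ b ]" := (map_mx (comp_poly b) f) (at level 8).

(** A scalar [c] is movable for the row [f] when values of [f] at points
    congruent modulo [c] are equivalent. *)
Definition movable m (f : 'rV[{poly A}]_m) (c : A) : Prop :=
  forall b z : {poly A}, row_equiv f@[b] f@[b + c%:P * z].

Lemma movable0 m (f : 'rV_m) : movable f 0.
Proof. by move=> b z; rewrite polyC0 mul0r addr0; exact: row_equiv_refl. Qed.

Lemma movableD m (f : 'rV_m) c d :
  movable f c -> movable f d -> movable f (c + d).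
Proof.
move=> mc md b z; rewrite polyCD mulrDl addrA.
exact: row_equiv_trans (mc _ _) (md _ _).
Qed.

Lemma movableM m (f : 'rV_m) c d : movable f c -> movable f (d * c).
Proof. by move=> mc b z; rewrite polyCM mulrAC mulrC; exact: mc. Qed.

Lemma movable_equiv m (f g : 'rV_m) c :
  row_equiv f g -> movable g c -> movable f c.
Proof.
move=> fg mg b z.
apply: row_equiv_trans (row_equiv_map (comp_poly b) fg) _.
apply: row_equiv_trans (mg b z) _; apply: row_equiv_sym.
exact: (row_equiv_map (comp_poly _) fg).
Qed.

Lemma movable_det k (f : 'rV_(2 + k)) (N : 'M_2) c :
  row 0 N = lsubmx f -> \det N = c%:P -> movable f c.
Proof.
move=> Nf dN b z.
have [->|c0] := eqVneq c 0; first exact: movable0.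
have dNb b' : \det N@[b'] = c%:P by rewrite det_map_mx /= dN comp_polyC.
have [W WE] := map_comp_polyD_dvd N b (c%:P * z).
have [S SE] := map_comp_polyD_dvd (rsubmx f) b (c%:P * z).
rewrite -!scalerA in WE SE.
have cP0 : c%:P != 0 by rewrite polyC_eq0.
have := row_equiv_congr cP0 (dNb _) (dNb _) WE SE.
by rewrite -!map_row Nf -!map_row_mx hsubmxK.
Qed.

(** [- v] and [u] complete the first two entries of [f] to a matrix of
    determinant [c]. *)
Lemma movable_span k (f : 'rV_(2 + k)) (u v : {poly A}) c :
  u * f 0 0 + v * f 0 1 = c%:P -> movable f c.
Proof.
move=> e.
pose N : 'M[{poly A}]_2 := \matrix_(i, j)
  if i == 0 then f 0 (lshift k j) else if j == 0 then - v else u.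
apply: (@movable_det _ _ N); first by apply/rowP => j; rewrite !mxE.
rewrite (expand_det_row _ 0) !big_ord_recl big_ord0 /cofactor !det_mx11 !mxE /=.
rewrite -e; have -> : lshift k 0 = 0 :> 'I_(2 + k) by exact: val_inj.
have -> : lshift k (lift ord0 ord0) = 1 :> 'I_(2 + k) by exact: val_inj.
by rewrite expr0 mul1r expr1 addr0; ring.
Qed.

(** A polynomial ring over a field modulo [a != 0] is semilocal, hence has
    stable range one; the multiplier [gdcop b a] is divisible by the prime
    factors of [a] which do not divide [b], and by no other. *)
Lemma coprimep_gdcop_shift (F : fieldType) (a b s x y : {poly F}) :
  a != 0 -> a * x + b * y + s = 1 -> coprimep a (b + gdcop b a * s).
Proof.
move=> a0 e; apply/coprimepP => d da db.
have cu : coprimep (gdcop b a) b by exact: coprimep_gdco.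
have cdu : coprimep d (gdcop b a).
  apply/coprimepP => d1 d1d d1u; move/coprimepP: cu; apply=> //.
  have : d1 %| b + gdcop b a * s by exact: dvdp_trans db.
  by rewrite dvdp_addl // dvdp_mulr.
have cdb : coprimep d b.
  apply/coprimepP => d1 d1d d1b.
  have d1s : d1 %| s.
    have : d1 %| b + gdcop b a * s by exact: dvdp_trans db.
    rewrite dvdp_addr // Gauss_dvdpr //; exact: coprimep_dvdr cdu.
  rewrite -size_poly_eq1 -dvdp1 -e !dvdp_add // dvdp_mulr //;
    exact: dvdp_trans da.
have du : d %| gdcop b a by case: gdcopP => r _ _; apply.
by move/coprimepP: cdu; apply.
Qed.

Lemma resultant_map (k : fieldType) (pi : {rmorphism A -> k}) (p q : {poly A}) :
  p \is monic -> q \is monic ->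
  pi (resultant p q) = resultant (map_poly pi p) (map_poly pi q).
Proof.
move=> /monicP mp /monicP mq.
rewrite /resultant /Sylvester_mx !size_map_poly_id0 ?mp ?mq ?rmorph1
  ?oner_neq0 //.
rewrite -det_map_mx /= map_col_mx; congr (\det (col_mx _ _));
  by apply: map_lin1_mx => v; rewrite map_poly_rV rmorphM /= map_rVpoly.
Qed.

(** Modulo the kernel of [pi], a combination of the other entries makes the
    second entry coprime to the first. So the resultant of these two polynomials
    does not vanish in [k]; it is movable since it lies in the ideal which they
    generate. *)
Lemma movable_local (k : fieldType) (pi : {rmorphism A -> k}) m
    (f : 'rV[{poly A}]_(2 + m)) (h : 'cV[{poly A}]_(2 + m)) :
  (forall x : k, exists a, pi a = x) ->
  f *m h = 1%:M -> f 0 0 \is monic -> exists2 c, movable f c & pi c != 0.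
Proof.
move=> surj fh mf.
have [/eqP/size_poly1P[c c0 e]|sf] := eqVneq (size (f 0 0)) 1%N.
  have c1 : c = 1 by move: mf; rewrite e monicE lead_coefC => /eqP.
  exists 1; last by rewrite rmorph1 oner_neq0.
  by apply: (@movable_span _ _ 1 0); rewrite mul0r addr0 mul1r e c1.
have sf1 : (1 < size (f 0 0)%R)%N.
  by rewrite ltn_neqAle eq_sym sf size_poly_gt0 monic_neq0.
pose s := 1 - f 0 0 * h 0 0 - f 0 1 * h 1 0.
pose pp := map_poly pi.
have [u uE] : exists u, pp u = gdcop (pp (f 0 1)) (pp (f 0 0)).
  have [g gK] := choice surj.
  set q := gdcop _ _; exists (\poly_(i < size q) g q`_i).
  apply/polyP => i; rewrite coef_map coef_poly /=; case: ltnP => [_|le].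
    by rewrite gK.
  by rewrite rmorph0 nth_default.
pose n := (size (f 0 1 + u * s)).+1.
(* The multiple of the first entry makes q monic, so that the resultant
   commutes with the reduction. *)
pose q := f 0 0 * 'X^n + (f 0 1 + u * s).
have sX : size (f 0 0 * 'X^n) = (n + size (f 0 0)%R)%N
  by rewrite size_mulXn ?monic_neq0.
have small : (size (f 0 1 + u * s)%R < size (f 0 0 * 'X^n)%R)%N.
  by rewrite sX (leq_trans (ltnSn _)) // leq_addr.
have mq : q \is monic.
  by rewrite monicE lead_coefDl // lead_coefM lead_coefXn mulr1 -monicE.
have sq : (1 < size q)%N.
  by rewrite size_polyDl // sX; rewrite (leq_trans sf1) ?leq_addl.
pose y : 'cV[{poly A}]_(2 + m) := \col_i
  if i == 0 then 'X^n else if i == 1 then 0 else u * h i 0.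
pose w : 'rV[{poly A}]_(2 + m) := delta_mx 0 1.
have wy : w *m y = 0.
  by apply/matrixP => i j; rewrite !ord1 -rowE !mxE.
have fy : f *m y = (f 0 0 * 'X^n + u * s)%:M.
  apply/matrixP => i j; rewrite !ord1 !mxE eqxx mulr1n.
  have := congr1 (fun M : 'M_1 => M 0 0) fh; rewrite !mxE eqxx mulr1n.
  rewrite !big_ord_recl /= !mxE /= => eh; rewrite mulr0 add0r; congr (_ + _).
  rewrite /s -eh.
  have -> : lift ord0 ord0 = 1 :> 'I_(2 + m) by exact: val_inj.
  set T := \sum_(i < m) _ * h _ 0.
  rewrite [X in u * X](_ : _ = T); last by ring.
  rewrite mulr_sumr.
  by apply: eq_bigr => l _; rewrite !mxE /= mulrCA.
have [uv _ resE] := resultant_in_ideal sf1 sq.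
exists (resultant (f 0 0) q); last first.
  rewrite resultant_map // resultant_eq0 -leqNgt leq_eqVlt.
  rewrite -coprimep_def; apply/orP; left.
  rewrite rmorphD rmorphM /= mulrC coprimep_addl_mul rmorphD rmorphM /= -/pp uE.
  apply: (@coprimep_gdcop_shift _ _ _ _ (pp (h 0 0)) (pp (h 1 0))).
    by rewrite map_poly_eq0_id0 ?monic_neq0 // (monicP mf) rmorph1 oner_neq0.
  rewrite -!rmorphM -!rmorphD -(rmorph1 pp); congr (pp _).
  by rewrite /s; ring.
apply: movable_equiv (row_equiv_transvection f wy) _.
apply: (@movable_span _ _ uv.1 uv.2).
rewrite resE fy mul_scalar_mx !mxE /=.
rewrite mulr0 addr0 mulr1 /q; ring.
Qed.

(** The movable scalars form an ideal, which is not contained in any maximal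
    ideal; so 1 is movable, and any two values of [f] are equivalent. *)
Lemma suslin m (f : 'rV[{poly A}]_(2 + m)) (h : 'cV[{poly A}]_(2 + m)) :
  f *m h = 1%:M -> f 0 0 \is monic -> row_equiv f f@[0].
Proof.
move=> fh mf; suff m1 : movable f 1.
  have := m1 0 'X; rewrite mul1r add0r => /row_equiv_sym.
  rewrite [X in row_equiv X](_ : _ = f) //.
  by apply/matrixP => i j; rewrite mxE /= comp_polyXr.
have idf : ideal_axiom (movable f).
  by split=> [|c d|c d]; [exact: movable0|exact: movableD|exact: movableM].
apply: contrapT => /(residue_field_exists idf)[k [pi [surj J0]]].
have [c mc /eqP] := movable_local surj fh mf; apply; exact: J0.
Qed.

End Suslin.

(** * Weierstrass rings: unimodular rows *)

(** Division by the image of a monic polynomial, with a unique quotient and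
    remainder: it identifies [B / ev g] with [{poly A} / g], which is free of
    finite rank over [A]. *)
Definition weierstrass_divisor (A B : comNzRingType)
    (ev : {rmorphism {poly A} -> B}) (g : {poly A}) : Prop :=
  [/\ g \is monic,
      forall x, exists q (r : {poly A}),
        (size r < size g)%N /\ x = ev g * q + ev r &
      forall q (r : {poly A}),
        (size r < size g)%N -> ev g * q + ev r = 0 -> q = 0 /\ r = 0].

(** The preparation theorem, up to a change of coordinates [phi]. *)
Definition weierstrass_ring (A B : comNzRingType)
    (ev : {rmorphism {poly A} -> B}) : Prop :=
  forall b, b != 0 -> exists (phi psi : {rmorphism B -> B}) u v g,
    [/\ cancel phi psi, u * v = 1, phi b = u * ev g & weierstrass_divisor ev g].

Lemma projective_free_kernel (A : comNzRingType) m (rho : 'rV[A]_m) zeta :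
  projective_free A -> rho *m zeta = 1%:M -> free_kernel rho.
Proof.
move=> pf rz; exists zeta; split=> //; apply: pf.
rewrite mulmxBr mulmx1 mulmxBl mul1mx mulmxA -(mulmxA zeta) rz mulmx1.
by rewrite subrr subr0.
Qed.

(** A row of length one is a unit, and its kernel is zero. *)
Lemma free_kernel1 (A : comNzRingType) (rho : 'rV[A]_1) zeta :
  rho *m zeta = 1%:M -> free_kernel rho.
Proof.
move=> rz; exists zeta; split=> //; exists 0%N, 0, 0; split; last first.
  by rewrite !flatmx0.
rewrite mul0mx -rz; apply/esym/eqP; rewrite subr_eq0; apply/eqP/matrixP => i j.
by rewrite !ord1 !mxE !big_ord1 mulrC.
Qed.

(** By Suslin's theorem the row is equivalent to its value at 0, which is a
    unimodular row over [A]. *)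
Lemma free_kernel_monic (A : idomainType) m (f h : 'I_(2 + m) -> {poly A}) :
  projective_free A ->
  \sum_i f i * h i = 1 -> f 0 \is monic -> free_kernel (\row_i f i).
Proof.
move=> pf fh mf.
have fh1 : (\row_i f i) *m (\col_i h i) = 1%:M.
  apply/matrixP => i j; rewrite !ord1 !mxE eqxx -fh.
  by apply: eq_bigr => l _; rewrite !mxE.
have : row_equiv (\row_i f i) (map_mx (comp_poly 0) (\row_i f i)).
  by apply: suslin fh1 _; rewrite mxE.
have -> : map_mx (comp_poly 0) (\row_i f i)
          = map_mx polyC (map_mx (horner_eval 0) (\row_i f i)).
  by apply/rowP => i; rewrite !mxE /= comp_poly0r /horner_eval horner_coef0.
move=> /row_equiv_sym eqf; apply: free_kernel_equiv eqf _.
apply: (free_kernel_map (polyC : {rmorphism A -> {poly A}})).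
apply: (projective_free_kernel (zeta := map_mx (horner_eval 0) (\col_i h i))) =>
  //.
by rewrite -map_mxM fh1 map_mx1.
Qed.

Section UnimodularRows.
Variables (A : idomainType) (B : comNzRingType).
Variable ev : {rmorphism {poly A} -> B}.
Hypothesis pfA : projective_free A.
Hypothesis wB : weierstrass_ring ev.

(** The other entries are replaced by their remainders modulo [ev g]. The new
    row is polynomial, and it is unimodular over [{poly A}] because
    [{poly A} / g] and [B / ev g] are the same ring. *)
Let monic_entry m (rho : 'rV[B]_(2 + m)) zeta g :
  weierstrass_divisor ev g -> rho 0 0 = ev g -> rho *m zeta = 1%:M ->
  free_kernel rho.
Proof.
move=> [mg divg uniqg] rho0 rz.
have {}divg x : exists qr : B * {poly A},
    (size qr.2 < size g)%N /\ x = ev g * qr.1 + ev qr.2.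
  by have [q [r ?]] := divg x; exists (q, r).
have [dv dvP] := choice divg.
pose f i := if i == 0 then g else (dv (rho 0 i)).2.
have eqf : row_equiv rho (\row_i ev (f i)).
  pose w : 'rV[B]_(2 + m) := \row_i if i == 0 then 0 else - (dv (rho 0 i)).1.
  have wy : w *m delta_mx 0 0 = 0 :> 'M_1.
    by apply/matrixP => i j; rewrite !ord1 -colE !mxE.
  have := row_equiv_transvection rho wy.
  rewrite -colE [X in row_equiv _ X](_ : _ = \row_i ev (f i)) //.
  apply/rowP => i; rewrite !mxE big_ord1 !mxE rho0 /f.
  case: eqVneq => [->|_]; first by rewrite mulr0 addr0 rho0.
  by have [_ {1}->] := dvP (rho 0 i); rewrite mulrN addrAC subrr add0r.
have [V [V' [VV' eV]]] := eqf.
have : (\row_i ev (f i)) *m (V' *m zeta) = 1%:M.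
  by rewrite -eV mulmxA -(mulmxA rho) VV' mulmx1.
move: (V' *m zeta) => {eV VV' V V' rz rho0}z fz.
pose hr i := (dv (z i 0)).2.
(* Reducing the section modulo ev g too, s is divisible by ev g in B, hence by
   g in {poly A}. *)
pose s := 1 - \sum_(i | i != 0) f i * hr i.
have s_dvd : s = g * (s %/ g).
  have es : s = g * (s %/ g) + s %% g.
    by rewrite [LHS](Pdiv.IdomainMonic.divp_eq mg) mulrC.
  have lt : (size (s %% g)%R < size g)%N by rewrite ltn_modpN0 ?monic_neq0.
  pose b := z 0 0 + \sum_(i | i != 0) ev (f i) * (dv (z i 0)).1.
  have esb : ev s = ev g * b.
    have := congr1 (fun M : 'M_1 => M 0 0) fz; rewrite !mxE eqxx mulr1n.
    rewrite (bigD1 0) //= mxE => e1.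
    rewrite /s rmorphB rmorph1 -e1 rmorph_sum /= /b mulrDr -addrA.
    congr (_ + _); rewrite -sumrB mulr_sumr; apply: eq_bigr => i _.
    have [_ {1}->] := dvP (z i 0); rewrite mxE rmorphM /hr; ring.
  have := uniqg (ev (s %/ g) - b) (s %% g) lt.
  rewrite mulrBr -esb -addrAC -rmorphM -rmorphD -es subrr => /(_ erefl) [_ r0].
  by rewrite {1}es r0 addr0.
pose h i := if i == 0 then s %/ g else hr i.
have fh : \sum_i f i * h i = 1.
  rewrite (bigD1 0) //= {1}/f {1}/h eqxx -s_dvd /s 
    -[RHS](subrK (\sum_(i | i != 0) f i * hr i)).
  by congr (_ + _); apply: eq_bigr => i /negPf i0; rewrite /h i0.
apply: free_kernel_equiv (row_equiv_sym eqf) _.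
have -> : \row_i ev (f i) = map_mx ev (\row_i f i).
  by apply/rowP => i; rewrite !mxE.
apply: free_kernel_map; exact: free_kernel_monic fh mg.
Qed.

Lemma free_kernel_weierstrass m (rho : 'rV[B]_m) zeta :
  rho *m zeta = 1%:M -> free_kernel rho.
Proof.
case: m => [|[|m]] in rho zeta *; last 2 first.
- exact: free_kernel1.
- move=> rz.
  have [i rho0] : exists i, rho 0 i != 0.
    apply: contrapT => no; have : (1%:M : 'M[B]_1) 0 0 = 0.
      rewrite -rz !mxE big1 // => i _; suff -> : rho 0 i = 0 by rewrite mul0r.
      by apply/eqP/negPn/negP => ri; apply: no; exists i.
    by rewrite mxE eqxx; apply/eqP; rewrite oner_eq0.
  have [phi [psi [u [v [g [phiK uv phig wg]]]]]] := wB rho0.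
  suff : free_kernel (map_mx phi rho).
    move=> /(free_kernel_map psi); rewrite -map_mx_comp.
    by rewrite map_mx_id // => x /=; rewrite phiK.
  have {rz} rz : map_mx phi rho *m map_mx phi zeta = 1%:M.
    by rewrite -map_mxM rz map_mx1.
  have {phig} : map_mx phi rho 0 i = u * ev g by rewrite mxE.
  move: (map_mx phi rho) (map_mx phi zeta) rz => {rho0 phiK}r z rz ri.
  pose d : 'rV[B]_(2 + m) := \row_j if j == 0 then v else 1.
  pose d' : 'rV[B]_(2 + m) := \row_j if j == 0 then u else 1.
  have VV' : (tperm_mx 0 i *m diag_mx d) *m (diag_mx d' *m tperm_mx 0 i) = 1%:M.
    rewrite mulmxA -(mulmxA (tperm_mx 0 i)) mulmx_diag.
    rewrite (_ : \row_j _ = const_mx 1); last first.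
      by apply/rowP => j; rewrite !mxE; case: ifP; rewrite ?mulr1 // mulrC.
    by rewrite diag_const_mx mulmx1 -perm_mxM tperm2 perm_mx1.
  have eqr : row_equiv r (xcol 0 i r *m diag_mx d).
    by exists (tperm_mx 0 i *m diag_mx d), (diag_mx d' *m tperm_mx 0 i);
      split=> //; rewrite xcolE mulmxA.
  apply: free_kernel_equiv (row_equiv_sym eqr) _.
  apply: (monic_entry (g := g) (zeta := diag_mx d' *m tperm_mx 0 i *m z)) => //.
    by rewrite mul_mx_diag !mxE tpermL ri mulrC mulrA [v * u]mulrC uv mul1r.
  by rewrite xcolE mulmxA -(mulmxA r) -[r *m _ *m _]mulmxA VV' mulmx1.
move=> rz; have : (1%:M : 'M[B]_1) 0 0 = 0 by rewrite -rz mxE big_ord0.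
by rewrite mxE eqxx => /eqP; rewrite oner_eq0.
Qed.

End UnimodularRows.

(** * Weierstrass rings: projective modules are stably free *)

Section Remainders.
Variables (A B : comNzRingType) (ev : {rmorphism {poly A} -> B}) (g : {poly A}).
Hypothesis wg : weierstrass_divisor ev g.
Local Notation G := (ev g).
Local Notation iota := (ev \o polyC).
Local Notation "C ^io" := (map_mx iota C) (at level 8).

Lemma wdiv_exists : exists qr : B -> B * {poly A}, forall x,
  (size (qr x).2 < size g)%N /\ x = G * (qr x).1 + ev (qr x).2.
Proof.
have [_ divg _] := wg.
have /choice [qr ?] : forall x, exists qr : B * {poly A},
    (size qr.2 < size g)%N /\ x = G * qr.1 + ev qr.2.
  by move=> x; have [q [r ?]] := divg x; exists (q, r).
by exists qr.
Qed.

Definition wquo x := (projT1 (cid wdiv_exists) x).1.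
Definition wrem x := (projT1 (cid wdiv_exists) x).2.

Lemma wdivE x : x = G * wquo x + ev (wrem x).
Proof. by rewrite /wquo /wrem; case: cid => qr /= /(_ x)[]. Qed.

Lemma size_wrem x : (size (wrem x) < size g)%N.
Proof. by rewrite /wrem; case: cid => qr /= /(_ x)[]. Qed.

Lemma wdiv_unique x q (r : {poly A}) :
  (size r < size g)%N -> x = G * q + ev r -> wquo x = q /\ wrem x = r.
Proof.
move=> sr e; have [_ _ uniqg] := wg.
have lt : (size (wrem x - r)%R < size g)%N.
  by rewrite (leq_ltn_trans (size_polyD _ _)) // size_polyN gtn_max size_wrem.
have := uniqg (wquo x - q) _ lt;
  rewrite mulrBr rmorphB addrACA -opprD -wdivE -e.
by rewrite subrr => /(_ erefl) [/eqP + /eqP];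
  rewrite !subr_eq0 => /eqP-> /eqP->.
Qed.

Lemma wdivD x y :
  wquo (x + y) = wquo x + wquo y /\ wrem (x + y) = wrem x + wrem y.
Proof.
apply: wdiv_unique.
  by rewrite (leq_ltn_trans (size_polyD _ _)) // gtn_max !size_wrem.
by rewrite {1}[x]wdivE {1}[y]wdivE rmorphD; ring.
Qed.

Lemma wdivZ a x :
  wquo (iota a * x) = iota a * wquo x /\ wrem (iota a * x) = a *: wrem x.
Proof.
apply: wdiv_unique.
  exact: leq_ltn_trans (size_scale_leq _ _) (size_wrem x).
by rewrite {1}[x]wdivE -mul_polyC rmorphM /=; ring.
Qed.

Lemma wdivG x : wquo (G * x) = x /\ wrem (G * x) = 0.
Proof.
have [mg _ _] := wg.
by apply: wdiv_unique; rewrite ?size_poly0 ?size_poly_gt0 ?monic_neq0 //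
  rmorph0 addr0.
Qed.

Lemma wdiv0 : wquo 0 = 0 /\ wrem 0 = 0.
Proof. by have := wdivG 0; rewrite mulr0. Qed.

Lemma map_wquoD m n (M M' : 'M[B]_(m, n)) :
  map_mx wquo (M + M') = map_mx wquo M + map_mx wquo M'.
Proof. by apply/matrixP => i j; rewrite !mxE (wdivD _ _).1. Qed.

Lemma wquo_sum I (s : seq I) (F : I -> B) :
  wquo (\sum_(i <- s) F i) = \sum_(i <- s) wquo (F i).
Proof.
elim: s => [|i s IH]; first by rewrite !big_nil wdiv0.1.
by rewrite !big_cons (wdivD _ _).1 IH.
Qed.

Lemma wrem_sum I (s : seq I) (F : I -> B) :
  wrem (\sum_(i <- s) F i) = \sum_(i <- s) wrem (F i).
Proof.
elim: s => [|i s IH]; first by rewrite !big_nil wdiv0.2.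
by rewrite !big_cons (wdivD _ _).2 IH.
Qed.

Lemma map_wquoM k m n (C : 'M[A]_(k, m)) (M : 'M[B]_(m, n)) :
  map_mx wquo (C^io *m M) = C^io *m map_mx wquo M.
Proof.
apply/matrixP => i j; rewrite !mxE wquo_sum; apply: eq_bigr => l _.
by rewrite !mxE (wdivZ _ _).1.
Qed.

Lemma map_wquoG m n (M : 'M[B]_(m, n)) : map_mx wquo (G *: M) = M.
Proof. by apply/matrixP => i j; rewrite !mxE (wdivG _).1. Qed.

Local Notation d := (size g).-1.

(** The rows of [wbasis n] are the monomials of degree less than that of [g] in
    each of the [n] entries, and [wcoord M] collects the coefficients of the
    remainders of the entries of [M]: modulo [g], these are a basis over [A] and
    the coordinates in it. *)
Definition wbasis n : 'M[B]_(n * d, n) :=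
  \matrix_(t, j) ev (rVpoly (row j (vec_mx (delta_mx 0 t) : 'M[A]_(n, d)))).

Definition wcoord m n (M : 'M[B]_(m, n)) : 'M[A]_(m, n * d) :=
  \matrix_i mxvec (\matrix_(j < n) poly_rV (wrem (M i j))).

Lemma wcoordM k m n (C : 'M[A]_(k, m)) (M : 'M[B]_(m, n)) :
  wcoord (C^io *m M) = C *m wcoord M.
Proof.
apply/matrixP => i t; case/mxvec_indexP: t => j l.
rewrite mxE mxvecE !mxE wrem_sum coef_sum; apply: eq_bigr => e _.
by rewrite mxE (wdivZ _ _).2 coefZ !mxE mxvecE !mxE.
Qed.

Lemma wcoordK m n (M : 'M[B]_(m, n)) :
  (wcoord M)^io *m wbasis n = M - G *: map_mx wquo M.
Proof.
apply/matrixP => i j.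
have -> : (M - G *: map_mx wquo M) i j = ev (wrem (M i j)).
  by rewrite !mxE {1}[M i j]wdivE addrAC subrr add0r.
have -> : wrem (M i j) = rVpoly (row j (vec_mx (row i (wcoord M)))).
  by rewrite rowK mxvecK rowK poly_rV_K // -ltnS prednK ?size_wrem //
     (leq_ltn_trans _ (size_wrem 0)).
rewrite [row i (wcoord M)]row_sum_delta !linear_sum rmorph_sum mxE /=.
apply: eq_bigr => t _; rewrite !mxE !linearZ /= -mul_polyC rmorphM /=.
by congr (_ * _).
Qed.

End Remainders.

(** The module P is the row space of [E], and that of [X] is a free submodule F
    which contains gP. Division by [g] provides the projection [Pi] of P
    along F, which is linear over [A] only. *)
Section StablyFree.
Variables (A : comNzRingType) (B : idomainType).
Variables (ev : {rmorphism {poly A} -> B}) (g : {poly A}).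
Hypothesis pfA : projective_free A.
Hypothesis wg : weierstrass_divisor ev g.
Hypothesis kfB : forall m (rho : 'rV[B]_m) zeta,
  rho *m zeta = 1%:M -> free_kernel rho.

Variables (n r : nat) (E : 'M[B]_n) (X : 'M[B]_(r, n)) (Y : 'M[B]_(n, r)).
Hypotheses (XY : X *m Y = (ev g)%:M) (YX : Y *m X = ev g *: E).
Hypotheses (XE : X *m E = X) (EY : E *m Y = Y) (EE : E *m E = E).

Local Notation G := (ev g).
Local Notation iota := (ev \o polyC).
Local Notation "C ^io" := (map_mx iota C) (at level 8).
Local Notation quo := (map_mx (wquo wg)).
Local Notation coord := (wcoord wg).
Local Notation Bs := (wbasis ev g n).

(** An element v of P is congruent modulo F to the element [Pi v] for which
    [Pi v *m Y] is reduced modulo [g]. *)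
Let Pi m (M : 'M[B]_(m, n)) : 'M[B]_(m, n) := M *m E - quo (M *m Y) *m X.

Let PiD m (M M' : 'M[B]_(m, n)) : Pi (M + M') = Pi M + Pi M'.
Proof. by rewrite /Pi !mulmxDl map_wquoD mulmxDl opprD addrACA. Qed.

Let PiM k m (C : 'M[A]_(k, m)) (M : 'M[B]_(m, n)) :
  Pi (C^io *m M) = C^io *m Pi M.
Proof. by rewrite /Pi mulmxBr -!mulmxA map_wquoM !mulmxA. Qed.

Let PiX m (M : 'M[B]_(m, r)) : Pi (M *m X) = 0.
Proof.
by rewrite /Pi -!mulmxA XE XY mul_mx_scalar map_wquoG subrr.
Qed.

Let PiG m (M : 'M[B]_(m, n)) : Pi (G *: M) = 0.
Proof. by rewrite /Pi -!scalemxAl map_wquoG -mulmxA YX -scalemxAr subrr. Qed.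

Let PiE m (M : 'M[B]_(m, n)) : Pi M *m E = Pi M.
Proof. by rewrite /Pi mulmxBl -!mulmxA EE XE. Qed.

Let Pi_quo m (M : 'M[B]_(m, n)) : M *m E = quo (M *m Y) *m X + Pi M.
Proof. by rewrite /Pi addrC subrK. Qed.

Let PiPi m (M : 'M[B]_(m, n)) : Pi (Pi M) = Pi M.
Proof.
have : Pi (M *m E) = Pi (Pi M) by rewrite Pi_quo PiD PiX add0r.
by move=> <-; rewrite /Pi -!mulmxA EE EY.
Qed.

Let Pi_coord m (M : 'M[B]_(m, n)) : (coord M)^io *m Pi Bs = Pi M.
Proof.
by rewrite -PiM wcoordK; have := PiD (M - G *: quo M) (G *: quo M);
  rewrite subrK PiG addr0.
Qed.

(** The image M of [Pi] is isomorphic to P / F. As [Pi] vanishes on gP it is a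
    direct summand of the free [A]-module of remainders, so M has a finite basis
    [Mm] over [A]. Let [T] be the matrix of multiplication by the variable t on
    M = P / F. Over [B] the module P is then generated by the rows of [X] and
    [Mm], and every relation is a combination of the relations
    [(t - T) *m Mm = Q *m X]. These are independent, so P is stably free, and it
    is free because kernels of unimodular rows are. *)
Lemma splits_of_factor : splits E.
Proof.
have [|s [X' [Y' [XY' YX']]]] := pfA (E := coord (Pi Bs)).
  by rewrite -wcoordM Pi_coord PiPi.
pose Mm := Y'^io *m Pi Bs.
have PiMm : Pi Mm = Mm by rewrite PiM PiPi.
pose lam m (M : 'M[B]_(m, n)) := coord (Pi M) *m X'.
have lamK m (M : 'M[B]_(m, n)) : (lam m M)^io *m Mm = Pi M.
  rewrite mulmxA -map_mxM -mulmxA XY' map_mxM -mulmxA.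
  by rewrite Pi_coord PiPi Pi_coord PiPi.
have lam_inj m (C : 'M[A]_(m, s)) : C^io *m Mm = 0 -> C = 0.
  move=> CM0.
  have -> : C = coord (C^io *m Mm) *m X'.
    rewrite !wcoordM -XY' -!mulmxA (mulmxA Y') YX' mul1mx.
    by rewrite mulmx1.
  by rewrite CM0 -[0](mulmx0 _ ((0 : 'M[A]_m)^io)) wcoordM !mul0mx.
pose t := ev 'X.
pose T := lam s (t *: Mm); pose Q := quo (t *: Mm *m Y).
pose Th := t%:M - T^io.
have ThMm : Th *m Mm = Q *m X.
  rewrite mulmxBl mul_scalar_mx lamK; apply/eqP; rewrite subr_eq; apply/eqP.
  by rewrite -Pi_quo -scalemxAl -PiMm PiE.
(* Every row is congruent to a constant one modulo the rows of t - T. *)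
pose S m (c : 'M[B]_(m, s)) := exists c' (k : 'M[A]_(m, s)),
  c = c' *m Th + k^io.
have S0 m : S m 0 by exists 0, 0; rewrite mul0mx map_mx0 addr0.
have SD m c d : S m c -> S m d -> S m (c + d).
  move=> [c' [k ->]] [d' [l ->]]; exists (c' + d'), (k + l).
  by rewrite mulmxDl map_mxD addrACA.
have St m c : S m c -> S m (t *: c).
  move=> [c' [k ->]]; exists (t *: c' + k^io), (k *m T).
  rewrite scalerDr mulmxDl scalemxAl -addrA; congr (_ + _).
  by rewrite /Th mulmxBr mul_mx_scalar (map_mxM _ k T) subrK.
have Sp m (p : 'M[{poly A}]_(m, s)) : S m (map_mx ev p).
  pose N := \max_(ij : 'I_m * 'I_s) size (p ij.1 ij.2).
  have -> : map_mx ev p = \sum_(l < N) t ^+ l *: (map_mx (coefp l) p)^io.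
    apply/matrixP => i j; rewrite summxE !mxE.
    have sp : (size (p i j) <= N)%N by exact: (leq_bigmax (i, j)).
    have {1}-> : p i j = \poly_(l < N) (p i j)`_l.
      apply/polyP => l; rewrite coef_poly; case: ltnP => // le.
      by rewrite nth_default // (leq_trans sp).
    rewrite poly_def rmorph_sum; apply: eq_bigr => l _.
    by rewrite !mxE -mul_polyC rmorphM rmorphXn mulrC.
  elim/big_ind: _ => [||l _]; [exact: S0|exact: SD|].
  elim: {l}(nat_of_ord l) (map_mx _ p) => [|l IHl] C.
    by rewrite expr0 scale1r; exists 0, C; rewrite mul0mx add0r.
  by rewrite exprS -scalerA; exact/St/IHl.
(* As g kills P / F, the constant part of g is a relation between the elements
   of a basis, hence zero; so g is a left multiple of t - T. *)
have [U [k UE]] := Sp s g%:M.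
have {k} UE : U *m Th = G%:M.
  have : Pi (map_mx ev g%:M *m Mm) = k^io *m Mm.
    by rewrite UE mulmxDl -mulmxA ThMm mulmxA PiD PiX add0r PiM PiMm.
  rewrite map_scalar_mx mul_scalar_mx PiG => /esym /lam_inj k0.
  by rewrite -[RHS]map_scalar_mx UE k0 map_mx0 addr0.
have G0 : G != 0.
  apply/eqP => G0; have [mg _ uniqg] := wg.
  have : (1 : B) = 0 /\ (0 : {poly A}) = 0.
    apply: uniqg; last by rewrite G0 mul0r rmorph0 addr0.
    by rewrite size_poly0 size_poly_gt0 monic_neq0.
  by case=> /eqP; rewrite oner_eq0.
have detTh : \det Th != 0.
  apply: contra_neq (expf_neq0 s G0) => d0.
  by rewrite -det_scalar -UE det_mulmx d0 mulr0.
have Th_inj m (c : 'M[B]_(m, s)) : c *m Th = 0 -> c = 0.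
  move=> c0; have : c *m (Th *m \adj Th) = 0 by rewrite mulmxA c0 mul0mx.
  rewrite mul_mx_adj mul_mx_scalar => /matrixP e; apply/matrixP => i j.
  by have /eqP := e i j; rewrite !mxE mulf_eq0 (negPf detTh) => /eqP.
have Sall m (c : 'M[B]_(m, s)) : S m c.
  have -> : c = quo c *m (U *m Th) + map_mx ev (map_mx (wrem wg) c).
    rewrite UE mul_mx_scalar; apply/matrixP => i j; rewrite !mxE.
    exact: (wdivE wg).
  apply: SD; last exact: Sp.
  by exists (quo c *m U), 0; rewrite map_mx0 addr0 mulmxA.
have X_inj m (c : 'M[B]_(m, r)) : c *m X = 0 -> c = 0.
  move=> c0; have : c *m (X *m Y) = 0 by rewrite mulmxA c0 mul0mx.
  rewrite XY mul_mx_scalar => /matrixP e; apply/matrixP => i j.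
  by have /eqP := e i j; rewrite !mxE mulf_eq0 (negPf G0) => /eqP.
pose W := col_mx X Mm; pose L := row_mx (- Q) Th.
pose W' := row_mx (quo (E *m Y)) (lam n E)^io.
have LW : L *m W = 0 by rewrite mul_row_col mulNmx ThMm addNr.
have W'W : W' *m W = E.
  by rewrite mul_row_col lamK -[RHS]EE Pi_quo.
have WE : W *m E = W by rewrite mul_col_mx XE; congr col_mx; rewrite -PiMm PiE.
have kerW m (c : 'M[B]_(m, r + s)) : c *m W = 0 -> exists c', c = c' *m L.
  rewrite -[c]hsubmxK; move: (lsubmx c) (rsubmx c) => w {}c.
  have [c' [k ->]] := Sall m c.
  rewrite mul_row_col mulmxDl -mulmxA ThMm => w0.
  have k0 : k = 0.
    apply: lam_inj; move: (congr1 (@Pi _) w0);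
      rewrite !PiD PiX mulmxA PiX !add0r.
    by rewrite PiM PiMm -[in RHS](mul0mx _ X) PiX.
  rewrite k0 map_mx0 mul0mx addr0 mulmxA -mulmxDl in w0.
  exists c'; rewrite k0 map_mx0 addr0 mul_mx_row; congr row_mx.
  by rewrite mulmxN; apply/eqP; rewrite -addr_eq0; apply/eqP; exact: X_inj w0.
have [|Z ZL] := kerW _ (1%:M - W *m W').
  by rewrite mulmxBl mul1mx -mulmxA W'W WE subrr.
have LZ : L *m Z = 1%:M.
  apply/eqP; rewrite -subr_eq0; apply/eqP/Th_inj.
  have : (L *m Z - 1%:M) *m L = 0.
    rewrite mulmxBl mul1mx -mulmxA -ZL mulmxBr mulmx1 mulmxA LW mul0mx subr0.
    by rewrite subrr.
  by rewrite mul_mx_row -row_mx0 => /eq_row_mx[].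
apply: (splits_transfer W'W WE).
have -> : W *m W' = 1%:M - Z *m L by rewrite -ZL subKr.
exact: splits_sub1.
Qed.

End StablyFree.

(** * The Quillen-Suslin theorem for Weierstrass rings *)

Lemma projective_free_field (F : fieldType) : projective_free F.
Proof.
move=> m E EE; exists (\rank E), (col_base E), (row_base E).
split; first exact: mulmx_base.
apply: (row_full_inj (col_base_full E));
  apply: (row_free_inj (row_base_free E)).
move: (mulmx_base E) => /=; move: (col_base E) (row_base E) => C R CR.
by rewrite !mulmxA CR mulmx1 CR -mulmxA CR EE.
Qed.

Section Fractions.
Variable B : idomainType.
Local Notation frac := (@FracField.tofrac B).

Lemma frac_denom (x : {fraction B}) : exists n d, d != 0 /\ frac d * x = frac n.
Proof.
elim/quotW: x => r; exists (val r).1, (val r).2; split;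
  first exact: denom_ratioP.
unlock FracField.tofrac; rewrite -[LHS]FracField.pi_mul.
apply/eqmodP; rewrite /= FracField.equivfE /FracField.mulf.
by rewrite !numden_Ratio ?(oner_neq0, mul1r,
  mulr1) ?mulf_neq0 ?denom_ratioP // mulrC.
Qed.

Lemma frac_mx_denom m n (M : 'M[{fraction B}]_(m, n)) :
  exists d (N : 'M[B]_(m, n)), d != 0 /\ frac d *: M = map_mx frac N.
Proof.
have /choice [nd ndP] : forall ij : 'I_m * 'I_n, exists nd : B * B,
    nd.2 != 0 /\ frac nd.2 * M ij.1 ij.2 = frac nd.1.
  by move=> ij; have [u [d ?]] := frac_denom (M ij.1 ij.2); exists (u, d).
exists (\prod_ij (nd ij).2).
exists (\matrix_(i, j) ((\prod_(kl | kl != (i, j)) (nd kl).2) * (nd (i, j)).1)).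
split; first by apply/prodf_neq0 => ij _; case: (ndP ij).
apply/matrixP => i j; rewrite !mxE (bigD1 (i, j)) //= rmorphM mulrAC.
by have [_ ->] := ndP (i, j); rewrite -rmorphM mulrC.
Qed.

(** Over the field of fractions the row space of [E] is free; a common
    denominator [b] is cleared from the factorization of [E]. *)
Lemma idempotent_factor n (E : 'M[B]_n) : E *m E = E ->
  exists r b (X : 'M[B]_(r, n)) (Y : 'M[B]_(n, r)),
  [/\ b != 0, X *m Y = b%:M, Y *m X = b *: E, X *m E = X & E *m Y = Y].
Proof.
move=> EE.
have inj_mx p q : injective (map_mx frac : 'M_(p, q) -> _).
  move=> M N /matrixP e; apply/matrixP => i j.
  by have /eqP := e i j; rewrite !mxE tofrac_eq => /eqP.
have [|r [C [R [CR RC]]]] := @projective_free_field _ n (map_mx frac E).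
  by rewrite -map_mxM EE.
have [x [X [x0 XE]]] := frac_mx_denom R.
have [y [Y [y0 YE]]] := frac_mx_denom C.
exists r, (x * y), X, Y; split; first by rewrite mulf_neq0.
- apply: inj_mx; rewrite map_mxM -XE -YE -scalemxAl -scalemxAr RC.
  by rewrite map_scalar_mx rmorphM scalerA scalemx1.
- apply: inj_mx; rewrite map_mxM -XE -YE -scalemxAl -scalemxAr CR.
  by rewrite map_mxZ rmorphM scalerA mulrC.
- apply: inj_mx; rewrite map_mxM -XE -CR -scalemxAl mulmxA RC mul1mx //.
- by apply: inj_mx; rewrite map_mxM -YE -CR -scalemxAr -mulmxA RC mulmx1.
Qed.

End Fractions.

(** The change of coordinates [phi] and a unit turn the denominator [b] into a
    monic polynomial by which one can divide. *)
Theorem projective_free_weierstrass (A B : idomainType)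
    (ev : {rmorphism {poly A} -> B}) :
  projective_free A -> weierstrass_ring ev -> projective_free B.
Proof.
move=> pfA wB n E EE.
have [r [b [X [Y [b0 XY YX XE EY]]]]] := idempotent_factor EE.
have [phi [psi [u [v [g [phiK uv phib wg]]]]]] := wB _ b0.
suff : splits (map_mx phi E).
  move=> /(splits_map psi); rewrite -map_mx_comp.
  by rewrite map_mx_id // => x /=; rewrite phiK.
have vb : v * phi b = ev g by rewrite phib mulrA [v * u]mulrC uv mul1r.
have kf m rho zeta : _ := @free_kernel_weierstrass _ _ ev pfA wB m rho zeta.
apply: (splits_of_factor pfA wg kf 
  (X := v *: map_mx phi X) (Y := map_mx phi Y)).
- by rewrite -scalemxAl -map_mxM XY map_scalar_mx scale_scalar_mx vb.
- by rewrite -scalemxAr -map_mxM YX map_mxZ scalerA vb.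
- by rewrite -scalemxAl -map_mxM XE.
- by rewrite -map_mxM EY.
- by rewrite -map_mxM EE.
Qed.

(** * From idempotent matrices to modules *)

(** A finite projective module is a direct summand of a module of row vectors,
    hence isomorphic to the row space of an idempotent matrix. *)
Lemma projective_free_module (A : comNzRingType) (P : lmodType A) :
  projective_free A -> finite_module P -> projective_module P -> free_module P.
Proof.
move=> pfA [m [e eP]] projP.
pose gf (v : 'rV[A]_m) : P := \sum_i v 0 i *: e i.
have g_lin : linear gf.
  move=> c u v; rewrite /gf scaler_sumr -big_split; apply: eq_bigr => i _ /=.
  by rewrite !mxE scalerDl scalerA.
pose g : {linear 'rV[A]_m -> P} := 
  HB.pack gf (GRing.isLinear.Build _ _ _ _ gf g_lin).
have [|h hP] := projP _ _ g idfun.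
  by move=> y; have [c ->] := eP y; exists (\row_i c i);
    apply: eq_bigr => i _; rewrite mxE.
have gZ c v : g (c *: v) = c *: g v by exact: linearZ.
pose E : 'M[A]_m := lin1_mx (h \o g).
have EP v : v *m E = h (g v) by rewrite mul_rV_lin1.
have hE x : h x *m E = h x by rewrite EP hP.
have [|r [X [Y [XY YX]]]] := pfA _ E.
  by apply/row_matrixP => i; rewrite row_mul !rowE (EP (delta_mx 0 i)) hE.
exists 'I_r, (fun i => g (row i Y)); split.
  move=> x; exists (enum 'I_r), (fun i => (h x *m X) 0 i).
  have xE : h x = h x *m X *m Y by rewrite -mulmxA XY hE.
  rewrite -{1}[x]hP {1}xE mulmx_sum_row linear_sum /= big_enum /=.
  by apply: eq_bigr => i _; exact: gZ.
move=> s c us cs0 i si.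
pose w : 'rV[A]_r := \row_j if j \in s then c j else 0.
have gw : g (w *m Y) = 0.
  apply: etrans cs0; rewrite mulmx_sum_row linear_sum (big_uniq _ us) /=.
  rewrite [in RHS]big_mkcond.
  apply: eq_bigr => j _; apply: etrans (gZ _ _) _; rewrite mxE.
  by case: ifP => // _; exact: scale0r.
have : w *m Y *m E *m X = 0 by rewrite EP gw linear0 mul0mx.
rewrite -XY !mulmxA -(mulmxA w) YX mulmx1 -mulmxA YX mulmx1.
by move=> /rowP/(_ i); rewrite !mxE si.
Qed.

(** * Substitutions in formal power series *)

Section Monomials.
Variables (n : nat) (A : comNzRingType).
Implicit Types (f g h : mseries n A) (I J M : midx n) (c : A).

Definition mX M : mseries n A := fun I => (I == M)%:R.
Definition mC c : mseries n A := fun I => c * (I == 0)%:R.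

Lemma mseriesDE f g I : (f + g) I = f I + g I. Proof. by []. Qed.
Lemma mseriesNE f I : (- f) I = - f I. Proof. by []. Qed.
Lemma mseriesBE f g I : (f - g) I = f I - g I. Proof. by []. Qed.
Lemma mseries0E I : (0 : mseries n A) I = 0. Proof. by []. Qed.

Lemma mseries_sumE (T : Type) (s : seq T) (P : pred T)
    (F : T -> mseries n A) I :
  (\sum_(i <- s | P i) F i) I = \sum_(i <- s | P i) F i I.
Proof. by elim/big_rec2: _ => [//|i x y _ <-]; rewrite mseriesDE. Qed.

Lemma msub0 I : msub I 0 = I.
Proof. by apply/ffunP => i; rewrite !ffunE subn0. Qed.

Lemma mle0 I : mle 0 I. Proof. by apply/forallP => i; rewrite ffunE. Qed.

Lemma mdeg0 : mdeg (0 : midx n) = 0%N.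
Proof. by rewrite /mdeg big1 // => i _; rewrite ffunE. Qed.

Lemma mdeg_eq0 I : (mdeg I == 0%N) = (I == 0).
Proof.
apply/eqP/eqP => [I0|->]; last exact: mdeg0.
apply/ffunP => i; have := mdeg_ge I i; rewrite I0 leqn0 => /eqP ->.
by rewrite ffunE.
Qed.

Lemma mle_mdeg J I : mle J I -> (mdeg J <= mdeg I)%N.
Proof. by move=> /msubK <-; rewrite mdegD leq_addr. Qed.

Lemma mCM c f I : (mC c * f) I = c * f I.
Proof.
rewrite mseries_mulE (bigD1_seq 0) ?mbelow_uniq ?mem_mbelow ?mle0 //=.
rewrite big1 => [|J /negPf J0]; last by rewrite /mC J0 mulr0 mul0r.
by rewrite /mC eqxx mulr1 msub0 addr0.
Qed.

Lemma mXM M f I : (mX M * f) I = if mle M I then f (msub I M) else 0.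
Proof.
rewrite mseries_mulE; case: ifP => MI.
  rewrite (bigD1_seq M) ?mbelow_uniq ?mem_mbelow //=.
  rewrite big1 => [|J /negPf JM]; last by rewrite /mX JM mul0r.
  by rewrite /mX eqxx mul1r addr0.
rewrite big_seq big1 // => J; rewrite mem_mbelow => JI.
by rewrite /mX; case: eqVneq => [JM|_]; [rewrite -JM JI in MI|rewrite mul0r].
Qed.

Lemma mXD M J : mX (M + J) = mX M * mX J.
Proof.
apply/funext => I; rewrite mXM /mX; case: ifP => MI; last first.
  by case: eqP => // e; rewrite e mle_addr in MI.
congr (_%:R); congr nat_of_bool; apply/eqP/eqP => [->|<-].
  by rewrite maddK.
by rewrite msubK.
Qed.

Lemma mX0 : mX 0 = 1. Proof. by []. Qed.

Lemma mX_exp M k : mX M ^+ k = mX (M *+ k).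
Proof. by elim: k => [//|k IHk]; rewrite exprS IHk -mXD mulrS. Qed.

Lemma mulmnE M k i : (M *+ k) i = (M i * k)%N.
Proof.
elim: k => [|k IHk]; first by rewrite mulr0n ffunE muln0.
by rewrite mulrS maddE IHk mulnS.
Qed.

Fact mC_is_zmod_morphism : zmod_morphism mC.
Proof. by move=> c d; apply/funext => I; rewrite mseriesBE /mC mulrBl. Qed.
Fact mC_is_monoid_morphism : monoid_morphism mC.
Proof.
split=> [|c d]; first by apply/funext => I; rewrite /mC mul1r.
by apply/funext => I; rewrite mCM /mC mulrA.
Qed.
HB.instance Definition _ := GRing.isZmodMorphism.Build A (mseries n A) mC
  mC_is_zmod_morphism.
HB.instance Definition _ := GRing.isMonoidMorphism.Build A (mseries n A) mC
  mC_is_monoid_morphism.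

(** Congruence modulo the terms of degree greater than [N]; identities between
    series are checked modulo each of these, for truncated series. *)
Definition eqm N f g := forall J, (mdeg J <= N)%N -> f J = g J.

Lemma eqm_sym N f g : eqm N f g -> eqm N g f.
Proof. by move=> fg J JN; rewrite fg. Qed.

Lemma eqm_trans N f g h : eqm N f g -> eqm N g h -> eqm N f h.
Proof. by move=> fg gh J JN; rewrite fg // gh. Qed.

Lemma eqmM N f f' g g' : eqm N f f' -> eqm N g g' -> eqm N (f * g) (f' * g').
Proof.
move=> ff gg J JN; rewrite !mseries_mulE big_seq [RHS]big_seq.
apply: eq_bigr => I; rewrite mem_mbelow => IJ.
rewrite ff ?gg // (leq_trans _ JN) //; last exact: mle_mdeg.
by rewrite -(msubK IJ) maddK mdegD leq_addl.
Qed.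

Lemma eqmP f g : (forall N, eqm N f g) -> f = g.
Proof. by move=> e; apply/funext => J; exact: (e (mdeg J)). Qed.

Definition mbox N : seq (midx n) :=
  [seq [ffun i => (J i : nat)] | J : {ffun 'I_n -> 'I_N.+1}].

Lemma mbox_uniq N : uniq (mbox N).
Proof.
rewrite map_inj_uniq ?enum_uniq // => J1 J2 /ffunP eqJ.
by apply/ffunP => i; apply/val_inj; have := eqJ i; rewrite !ffunE.
Qed.

Lemma mem_mbox N I : (mdeg I <= N)%N -> I \in mbox N.
Proof.
move=> IN; have lt i : (I i < N.+1)%N by rewrite ltnS (leq_trans (mdeg_ge I i)).
apply/mapP; exists [ffun i => Ordinal (lt i)]; first by rewrite mem_enum.
by apply/ffunP => i; rewrite !ffunE.
Qed.

Definition mtrunc N f : mseries n A := \sum_(I <- mbox N) mC (f I) * mX I.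

Lemma eqm_trunc N f : eqm N f (mtrunc N f).
Proof.
move=> J JN; rewrite /mtrunc mseries_sumE (bigD1_seq J) ?mbox_uniq ?mem_mbox
  //=.
rewrite big1 => [|I /negPf IJ]; first by rewrite mCM /mX eqxx mulr1 addr0.
by rewrite mCM /mX eq_sym IJ mulr0.
Qed.

Definition mord k f := forall J, (mdeg J < k)%N -> f J = 0.

Lemma mordM k l f g : mord k f -> mord l g -> mord (k + l) (f * g).
Proof.
move=> fk gl J Jkl; rewrite mseries_mulE big_seq big1 // => I.
rewrite mem_mbelow => IJ; have [lt|ge] := ltnP (mdeg I) k.
  by rewrite fk // mul0r.
rewrite gl ?mulr0 // -(ltn_add2l (mdeg I)) -mdegD msubK //.
by rewrite (leq_trans Jkl) // leq_add2r.
Qed.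

End Monomials.
Arguments mX {n A} M.
Arguments mC {n A} c.
Arguments mbox {n} N.

Section Substitution.
Variables (n : nat) (A : comNzRingType).
Implicit Types (f g h : mseries n A) (I J M : midx n) (c : A).

(** The series substituted for the variables have no constant term, so that each
    coefficient of the composition is a finite sum. *)
Record msubst := MSubst {
  msubst_fun :> 'I_n -> mseries n A;
  msubst0 : forall i, msubst_fun i 0 = 0 }.

Implicit Types y z : msubst.

Definition mpow y M : mseries n A := \prod_i y i ^+ M i.

Lemma mpowD y M J : mpow y (M + J) = mpow y M * mpow y J.
Proof. by rewrite /mpow -big_split; apply: eq_bigr => i _;
  rewrite maddE exprD. Qed.

Lemma mord_mpow y M : mord (mdeg M) (mpow y M).
Proof.
rewrite /mpow /mdeg; elim/big_rec2: _ => [//|i k f _ fk].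
apply: mordM => //; elim: (M i) => [//|l IHl].
rewrite exprS -add1n; apply: mordM => // J.
by rewrite ltnS leqn0 mdeg_eq0 => /eqP->; exact: msubst0.
Qed.

(** Only the monomials of degree at most [mdeg J] contribute to the coefficient
    at [J]. *)
Definition mcomp y f : mseries n A :=
  fun J => (\sum_(I <- mbox (mdeg J)) mC (f I) * mpow y I) J.

Lemma mcompE y f N J : (mdeg J <= N)%N ->
  mcomp y f J = \sum_(I <- mbox N) f I * mpow y I J.
Proof.
move=> JN; rewrite /mcomp mseries_sumE.
under eq_bigr do rewrite mCM.
have low L : \sum_(I <- mbox L) f I * mpow y I J =
    \sum_(I <- [seq I <- mbox L | (mdeg I <= mdeg J)%N]) f I * mpow y I J.
  rewrite big_filter [RHS]big_mkcond /=; apply: eq_bigr => I _.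
  by case: leqP => // lt; rewrite (mord_mpow y lt) mulr0.
rewrite (low (mdeg J)) (low N); apply: perm_big; apply: uniq_perm;
  rewrite ?filter_uniq ?mbox_uniq //.
move=> I; rewrite !mem_filter; case: leqP => //= le.
by rewrite !mem_mbox // (leq_trans le).
Qed.

Fact mcomp_is_zmod_morphism y : zmod_morphism (mcomp y).
Proof.
move=> f g; apply/funext => J; rewrite mseriesBE !(mcompE _ _ (leqnn _)) -sumrB.
by apply: eq_bigr => I _; rewrite mseriesBE mulrBl.
Qed.
HB.instance Definition _ y := GRing.isZmodMorphism.Build _ _ (mcomp y)
  (mcomp_is_zmod_morphism y).

Lemma mcompZ y c f : mcomp y (mC c * f) = mC c * mcomp y f.
Proof.
apply/funext => J; rewrite mCM !(mcompE _ _ (leqnn _)) mulr_sumr.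
by apply: eq_bigr => I _; rewrite mCM mulrA.
Qed.

Lemma mcomp_mX y M : mcomp y (mX M) = mpow y M.
Proof.
apply/funext => J; rewrite (mcompE _ _ (leqnn _)).
have [MJ|JM] := boolP (M \in mbox (mdeg J)).
  rewrite (bigD1_seq M) ?mbox_uniq //= big1 => [|I /negPf IM].
    by rewrite /mX eqxx mul1r addr0.
  by rewrite /mX IM mul0r.
rewrite big_seq big1 => [|I IJ].
  apply/esym/mord_mpow; rewrite ltnNge; apply: contra JM; exact: mem_mbox.
by rewrite /mX; case: eqVneq => [IM|_]; [rewrite -IM IJ in JM|rewrite mul0r].
Qed.

Lemma eqm_mcomp y N f g : eqm N f g -> eqm N (mcomp y f) (mcomp y g).
Proof.
move=> fg J JN; rewrite !(mcompE _ _ (leqnn _)).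
apply: eq_bigr => I _; have [le|lt] := leqP (mdeg I) N; first by rewrite fg.
by rewrite (mord_mpow y (leq_ltn_trans JN lt)) !mulr0.
Qed.

Lemma mcomp_trunc y N f :
  mcomp y (mtrunc N f) = \sum_(I <- mbox N) mC (f I) * mpow y I.
Proof.
by rewrite /mtrunc raddf_sum; apply: eq_bigr => I _; rewrite /= mcompZ mcomp_mX.
Qed.

(** Modulo terms of high degree the two factors are combinations of monomials,
    for which the identity is [mpowD]. *)
Fact mcomp_is_monoid_morphism y : monoid_morphism (mcomp y).
Proof.
split=> [|f g].
  by rewrite -[1](mX0 n A) mcomp_mX /mpow big1 // => i _; rewrite ffunE expr0.
apply: eqmP => N.
apply: eqm_trans (_ : eqm N (mcomp y (mtrunc N f * mtrunc N g)) _).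
  by apply: eqm_mcomp; apply: eqmM; exact: eqm_trunc.
apply: eqm_trans (_ : eqm N (mcomp y (mtrunc N f) * mcomp y (mtrunc N g)) _).
  rewrite !mcomp_trunc /mtrunc !mulr_suml raddf_sum => J _ /=.
  rewrite !mseries_sumE; apply: eq_bigr => I _.
  rewrite !mulr_sumr raddf_sum !mseries_sumE /=; apply: eq_bigr => I' _.
  by rewrite mulrACA -(rmorphM (@mC n A)) -mXD mcompZ mcomp_mX mpowD rmorphM
    mulrACA.
by apply: eqmM; apply: eqm_mcomp; apply: eqm_sym; exact: eqm_trunc.
Qed.
HB.instance Definition _ y := GRing.isMonoidMorphism.Build _ _ (mcomp y)
  (mcomp_is_monoid_morphism y).

Definition mvar (i : 'I_n) : midx n := [ffun j => (j == i : nat)].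

Lemma mpow_mX M : \prod_i mX (mvar i) ^+ M i = mX M :> mseries n A.
Proof.
under eq_bigr do rewrite mX_exp.
have eM : \sum_i mvar i *+ M i = M.
  apply/ffunP => j; rewrite sum_ffunE (bigD1 j) //= big1 => [|i /negPf ij].
    by rewrite mulmnE ffunE eqxx mul1n addr0.
  by rewrite mulmnE ffunE eq_sym ij mul0n.
by rewrite -[in RHS]eM (big_morph (@mX n A) (@mXD n A) (mX0 n A)).
Qed.

(** It is enough that the compositions agree on the variables. *)
Lemma mcomp_id y z : (forall i, mcomp y (z i) = mX (mvar i)) ->
  cancel (mcomp z) (mcomp y).
Proof.
move=> yz f; apply: eqmP => N.
apply: eqm_trans (_ : eqm N (mcomp y (mcomp z (mtrunc N f))) _).
  by do 2!apply: eqm_mcomp; exact: eqm_trunc.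
rewrite [X in eqm _ X](_ : _ = mtrunc N f); first exact/eqm_sym/eqm_trunc.
rewrite mcomp_trunc raddf_sum /=; apply: eq_bigr => I _.
rewrite mcompZ /mpow rmorph_prod -mpow_mX; congr (_ * _).
by apply: eq_bigr => i _; rewrite rmorphXn /= yz.
Qed.

Lemma mcomp_var y i : mcomp y (mX (mvar i)) = y i.
Proof.
rewrite mcomp_mX /mpow (bigD1 i) //= ffunE eqxx expr1 big1 ?mulr1 // => j ji.
by rewrite ffunE (negPf ji) expr0.
Qed.

End Substitution.

(** * Weighted Gauss norms and Weierstrass division *)

Lemma small_radius (R : realFieldType) (c : R) m :
  1 < c -> exists2 rho, 1 < rho & rho ^+ m <= c.
Proof.
elim: m c => [|m IHm] c c1; first by exists 2; rewrite ?expr0 ?ltW //; lra.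
have [|rho rho1 le] := IHm ((1 + c) / 2); first lra.
have e1 : 1 < c / ((1 + c) / 2) by rewrite ltr_pdivlMr; lra.
exists (Num.min rho (c / ((1 + c) / 2))); first by rewrite lt_min rho1.
have min0 : 0 <= Num.min rho (c / ((1 + c) / 2)) by rewrite le_min !ltW //; lra.
have cE : c = (c / ((1 + c) / 2)) * ((1 + c) / 2)
  by rewrite divfK // gt_eqF //; lra.
rewrite [leRHS]cE exprS ler_pM ?exprn_ge0 //; first by rewrite ge_min lexx orbT.
apply: le_trans le; rewrite lerXn2r ?nnegrE //; first by lra.
by rewrite ge_min lexx.
Qed.

Lemma geometric_small (R : realType) (theta C e : R) :
  0 <= theta < 1 -> 0 < e ->
  exists N : nat, forall i, (N <= i)%N -> C * theta ^+ i < e.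
Proof.
move=> /andP[t0 t1] e0.
have q1 : `|theta| < 1 by rewrite ger0_norm.
have /cvgrPdist_lt /(_ e e0) [N _ hN] := @cvg_geometric R C _ q1.
exists N => i Ni; have := hN i Ni; rewrite /= sub0r normrN.
by apply: le_lt_trans; exact: ler_norm.
Qed.

Section Completeness.
Variables (R : realType) (K : fieldType) (a : nonarch_absval R K).
Hypothesis complete_a : complete_absval a.

Lemma absvB x y : a (x - y) <= Num.max (a x) (a y).
Proof. by rewrite -[a y]absvN; exact: absvD. Qed.

Lemma absv_geometric_eq0 x C theta :
  0 <= theta < 1 -> (forall m, a x <= C * theta ^+ m) -> x = 0.
Proof.
move=> th le; apply/(absv_eq0 a)/eqP; rewrite eq_le absv_ge0 andbT leNgt.
apply/negP => ax0; have [N hN] := geometric_small C th ax0.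
by have := le_lt_trans (le N) (hN N (leqnn N)); rewrite ltxx.
Qed.

Lemma limit_geometric (u : nat -> K) C theta : 0 <= theta < 1 ->
  (forall m, a (u m.+1 - u m) <= C * theta ^+ m) ->
  exists l, forall m, a (l - u m) <= C * theta ^+ m.
Proof.
move=> th le; have /andP[t0 t1] := th.
have C0 : 0 <= C.
  by apply: le_trans (absv_ge0 a _) _; have := le 0; rewrite expr0 mulr1; exact.
have far m k : a (u (m + k)%N - u m) <= C * theta ^+ m.
  elim: k => [|k IHk]; first by rewrite addn0 subrr absv0 mulr_ge0 ?exprn_ge0.
  rewrite addnS -(subrK (u (m + k)%N) (u _)) -addrA (le_trans (absvD a _ _)) //.
  rewrite ge_max IHk andbT (le_trans (le _)) // ler_wpM2l // exprD ler_piMr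
    ?exprn_ge0 //.
  by rewrite exprn_ile1 // ltW.
have [|l lP] := complete_a (u := u).
  move=> e e0; have [N hN] := geometric_small C th e0.
  exists N => i j Ni Nj.
  have -> : u i - u j = (u i - u N) - (u j - u N) by ring.
  rewrite (le_lt_trans (absvB _ _)) // gt_max.
  by rewrite -(subnKC Ni) -(subnKC Nj) !(le_lt_trans (far _ _)) // hN.
exists l => m; rewrite leNgt; apply/negP => lt.
have e0 : 0 < a (l - u m) by apply: le_lt_trans lt; rewrite mulr_ge0 ?exprn_ge0.
have [N hN] := lP _ e0.
have := absvB (u (m + N)%N - u m) (u (m + N)%N - l).
have -> : u (m + N)%N - u m - (u (m + N)%N - l) = l - u m by ring.
by rewrite le_max !leNgt (le_lt_trans (far _ _) lt) hN ?leq_addl.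
Qed.

End Completeness.

Section Norms.
Variables (R : realType) (n : nat) (K : fieldType) (a : nonarch_absval R K).
Variable t : 'I_n.
Implicit Types (f g h : mseries n K) (I J : midx n).

(** The variable [t] has weight two and the others weight one. A change of
    coordinates will bound the terms with coefficient of maximal absolute value
    by [D] in a degree at least equal to [mdeg]; with this weight the [D]-th
    power of [t] then has the largest norm for every radius above 1. *)
Definition wt I := (mdeg I + I t)%N.

Lemma wtD I J : wt (I + J) = (wt I + wt J)%N.
Proof. by rewrite /wt mdegD maddE addnACA. Qed.

Lemma mdeg_wt I : (mdeg I <= wt I)%N. Proof. exact: leq_addr. Qed.

Lemma wt_mdeg I : (wt I <= 2 * mdeg I)%N.
Proof. by rewrite mul2n -addnn leq_add2l mdeg_ge. Qed.

(** The Gauss norm of radius [rho ^+ 2] in [t] and [rho] in the other variables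
    is at most [B]. *)
Definition bounded_by (rho B : R) f := forall I, a (f I) * rho ^+ wt I <= B.

Lemma bounded_by_ge0 rho B f : 0 <= rho -> bounded_by rho B f -> 0 <= B.
Proof.
by move=> r0 /(_ 0); apply: le_trans; rewrite mulr_ge0 ?absv_ge0 ?exprn_ge0.
Qed.

Lemma bounded_byD rho B f g : 0 <= rho ->
  bounded_by rho B f -> bounded_by rho B g -> bounded_by rho B (f + g).
Proof.
move=> r0 bf bg I; have := absvD a (f I) (g I); rewrite le_max => /orP[] le.
  by apply: le_trans (bf I); rewrite ler_wpM2r ?exprn_ge0.
by apply: le_trans (bg I); rewrite ler_wpM2r ?exprn_ge0.
Qed.

Lemma bounded_byN rho B f : bounded_by rho B f -> bounded_by rho B (- f).
Proof. by move=> bf I; rewrite mseriesNE absvN. Qed.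

Lemma bounded_byM rho B C f g : 0 < rho ->
  bounded_by rho B f -> bounded_by rho C g -> bounded_by rho (B * C) (f * g).
Proof.
move=> r0 bf bg I.
have B0 := bounded_by_ge0 (ltW r0) bf; have C0 := bounded_by_ge0 (ltW r0) bg.
rewrite -ler_pdivlMr ?exprn_gt0 //; apply: absv_sum => [|J].
  by rewrite divr_ge0 ?mulr_ge0 ?exprn_ge0 ?(ltW r0).
rewrite mem_mbelow => JI; rewrite ler_pdivlMr ?exprn_gt0 //.
rewrite -{2}(msubK JI) wtD exprD absvM mulrACA.
by apply: ler_pM (bf _) (bg _); rewrite mulr_ge0 ?absv_ge0 ?exprn_ge0 ?ltW.
Qed.

Lemma bounded_by_radius rho rho' B f : 0 <= rho' <= rho ->
  bounded_by rho B f -> bounded_by rho' B f.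
Proof.
move=> /andP[r0 le] bf I; apply: le_trans (bf I).
rewrite ler_wpM2l ?absv_ge0 // lerXn2r ?nnegrE //; exact: le_trans le.
Qed.

Lemma bounded_overconvergent rho B f :
  1 < rho -> bounded_by rho B f -> overconvergent a f.
Proof.
move=> r1 bf; apply/overconvergentP; exists rho, B; split=> // I.
apply: le_trans (bf I); rewrite ler_wpM2l ?absv_ge0 //; apply: ler_weXn2l;
  [exact: ltW|exact: mdeg_wt].
Qed.

Lemma overconvergent_bounded f : overconvergent a f ->
  exists rho B, 1 < rho /\ bounded_by rho B f.
Proof.
move=> /overconvergentP[r [B [r1 bf]]].
have [rho rho1 le] := small_radius 2 r1.
exists rho, B; split=> // I; apply: le_trans (bf I).
rewrite ler_wpM2l ?absv_ge0 //.
apply: (@le_trans _ _ (rho ^+ (2 * mdeg I))).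
  by rewrite ler_weXn2l ?wt_mdeg // ltW.
rewrite exprM lerXn2r // nnegrE ?exprn_ge0 //; lra.
Qed.

Lemma bounded_by_eq0 rho C theta f : 0 < rho -> 0 <= theta < 1 ->
  (forall m, bounded_by rho (C * theta ^+ m) f) -> f = 0.
Proof.
move=> r0 th bf; apply/funext => I.
apply: (@absv_geometric_eq0 _ _ a _ (C / rho ^+ wt I) theta) => // m.
rewrite mulrAC ler_pdivlMr ?exprn_gt0 //; exact: bf.
Qed.

End Norms.

Section Shift.
Variables (n : nat) (A : comNzRingType) (t : 'I_n).
Implicit Types (f g h : mseries n A) (I J : midx n) (D : nat).

Definition tpow D : midx n := mvar t *+ D.

Lemma tpowE D i : tpow D i = if i == t then D else 0%N.
Proof. by rewrite /tpow mulmnE ffunE; case: eqP; rewrite ?mul1n. Qed.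

(** The quotient of [f] by the [D]-th power of [t], dropping the terms in which
    [t] has exponent less than [D]. *)
Definition mshift D f : mseries n A := fun J => f (J + tpow D).

Definition tlow D f := forall J, (D <= J t)%N -> f J = 0.

Lemma mle_tpow D J : mle (tpow D) J = (D <= J t)%N.
Proof.
apply/forallP/idP => [/(_ t)|le i]; first by rewrite tpowE eqxx.
by rewrite tpowE; case: eqP => [->|].
Qed.

Lemma mshift_mX D f : mshift D (mX (tpow D) * f) = f.
Proof.
apply/funext => J; rewrite /mshift mXM addrC mle_addr.
by rewrite maddK.
Qed.

Lemma mshiftB D f g : mshift D (f - g) = mshift D f - mshift D g.
Proof. by []. Qed.

Lemma mshift_tlow D f : mshift D f = 0 <-> tlow D f.
Proof.
split=> [f0 J le|f0]; last first.
  by apply/funext => J; apply: f0; rewrite maddE tpowE eqxx leq_addl.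
have := congr1 (fun h : mseries n A => h (msub J (tpow D))) f0.
by rewrite /mshift addrC msubK // mle_tpow.
Qed.

(** Series in the first [j] variables. *)
Definition msupp (j : nat) f :=
  forall I, f I != 0 -> forall i : 'I_n, (j <= i)%N -> I i = 0%N.

Lemma msuppB j f g : msupp j f -> msupp j g -> msupp j (f - g).
Proof.
move=> sf sg I fgI; have [f0|] := eqVneq (f I) 0; last exact: sf.
by apply: sg; apply: contraNneq fgI => g0; rewrite mseriesBE f0 g0 subrr.
Qed.

Lemma msuppM j f g : msupp j f -> msupp j g -> msupp j (f * g).
Proof.
move=> sf sg I; rewrite mseries_mulE => nz i ji.
apply: contraNeq nz => Ii; rewrite big_seq big1 // => J;
  rewrite mem_mbelow => JI.
have [->|fJ] := eqVneq (f J) 0; first by rewrite mul0r.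
have [->|gJ] := eqVneq (g (msub I J)) 0; first by rewrite mulr0.
by move: Ii; rewrite -(msubK JI) maddE (sf _ fJ) ?(sg _ gJ).
Qed.

Lemma msupp_mC j c : msupp j (mC c : mseries n A).
Proof.
move=> I; rewrite /mC; case: (I =P 0) => [-> _ i _|_]; first by rewrite ffunE.
by rewrite mulr0 eqxx.
Qed.

Lemma msupp_mX j (M : midx n) :
  (forall i : 'I_n, (j <= i)%N -> M i = 0%N) -> msupp j (mX M : mseries n A).
Proof. by move=> M0 I; rewrite /mX; case: (I =P M) => [->//|_];
  rewrite eqxx. Qed.

Lemma msupp_tpow j D : (t < j)%N -> msupp j (mX (tpow D) : mseries n A).
Proof.
move=> tj; apply: msupp_mX => i ji; rewrite tpowE; case: eqP => // it.
by move: ji; rewrite it leqNgt tj.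
Qed.

Lemma msupp_shift j D f : msupp j f -> msupp j (mshift D f).
Proof.
by move=> sf J /sf s i /s; rewrite maddE => /eqP;
  rewrite addn_eq0 => /andP[/eqP].
Qed.

Lemma msupp_all f : msupp n f.
Proof. by move=> I _ i; rewrite leqNgt ltn_ord. Qed.

End Shift.

(** In the divisor [mX (tpow t D) + h] the power of [t] strictly dominates the
    series [h], so that Weierstrass division is the fixed point problem for a
    contraction, namely q = mshift (x - h q). *)
Section Division.
Variables (R : realType) (n : nat) (K : fieldType) (a : nonarch_absval R K).
Hypothesis complete_a : complete_absval a.
Variables (t : 'I_n) (D : nat) (rho theta : R) (h : mseries n K).
Hypotheses (rho1 : 1 < rho) (th : 0 <= theta < 1).
Local Notation bnd := (bounded_by a t rho).
Hypothesis bh : bnd (theta * rho ^+ (2 * D)) h.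
Implicit Types (f g x q r : mseries n K) (I J : midx n).

Let rho0 : 0 < rho. Proof. by apply: lt_trans rho1. Qed.
Let r2D : 0 < rho ^+ (2 * D). Proof. by rewrite exprn_gt0. Qed.

Lemma wt_tpow : wt t (tpow t D) = (2 * D)%N.
Proof.
rewrite /wt tpowE eqxx /mdeg (bigD1 t) //= tpowE eqxx big1 => [|i /negPf it].
  by rewrite addn0 mul2n addnn.
by rewrite tpowE it.
Qed.

Lemma bounded_by_shift B f : bnd B f -> bnd (B / rho ^+ (2 * D)) (mshift t D f).
Proof.
move=> bf I; rewrite ler_pdivlMr // -mulrA -exprD -wt_tpow -wtD.
exact: bf.
Qed.

Lemma shift_contraction B q : bnd B q -> bnd (theta * B) (mshift t D (h * q)).
Proof.
move=> bq; have := bounded_by_shift (bounded_byM rho0 bh bq).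
by rewrite [theta * _ * B]mulrAC mulfK ?gt_eqF.
Qed.

(** If the remainder [r] is the opposite of a multiple of the divisor, then
    [q = - mshift t D (h * q)], and the norm of [q] is at most [theta] times
    itself. *)
Lemma division_unique B q r : bnd B q -> tlow t D r ->
  (mX (tpow t D) + h) * q + r = 0 -> q = 0.
Proof.
move=> bq /mshift_tlow r0 e.
have qE : q = - mshift t D (h * q).
  have := congr1 (mshift t D) e; rewrite mulrDl -addrA.
  have shiftD f g : mshift t D (f + g) = mshift t D f + mshift t D g by [].
  rewrite !shiftD mshift_mX r0 addr0 => /eqP; rewrite addr_eq0 => /eqP {1}->.
  by [].
apply: (@bounded_by_eq0 _ _ _ a t rho B theta) => //.
elim=> [|m IHm]; first by rewrite expr0 mulr1.
rewrite exprSr mulrA mulrC qE; apply: bounded_byN.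
exact: shift_contraction.
Qed.

Lemma division_exists x B : bnd B x ->
  exists q, [/\ bnd (B / rho ^+ (2 * D)) q,
    tlow t D (x - (mX (tpow t D) + h) * q) &
    forall j, msupp j x -> msupp j h -> msupp j q].
Proof.
move=> bx; pose C := B / rho ^+ (2 * D).
have /andP[th0 th1] := th.
have C0 : 0 <= C.
  by rewrite divr_ge0 ?(ltW r2D) // (bounded_by_ge0 _ bx) // ltW.
pose u := fix u m : mseries n K := if m is m'.+1 then mshift t D (x - h * u
  m') else 0.
have shift_diff f g : mshift t D (x - h * f) - mshift t D (x - h * g)
    = - mshift t D (h * (f - g)).
  by apply/funext => J; rewrite mulrBr /mshift !(mseriesBE, mseriesNE); ring.
have bdiff m : bnd (C * theta ^+ m) (u m.+1 - u m).
  elim: m => [|m IHm].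
    by rewrite /= mulr0 !subr0 expr0 mulr1; exact: bounded_by_shift.
  rewrite [X in bounded_by _ _ _ _ X](shift_diff (u m.+1) (u m)).
  rewrite exprSr mulrA mulrC; apply: bounded_byN; exact: shift_contraction.
(* The iterates converge coefficientwise, at a geometric rate. *)
have /choice [q qP] : forall J, exists l, forall m,
    a (l - u m J) <= C / rho ^+ wt t J * theta ^+ m.
  move=> J; apply: (limit_geometric complete_a th) => m.
  by rewrite mulrAC ler_pdivlMr ?exprn_gt0 //; exact: bdiff.
have bq m : bnd (C * theta ^+ m) ((q : mseries n K) - u m).
  by move=> J; rewrite -ler_pdivlMr ?exprn_gt0 // mulrAC; exact: qP.
have fixq : (q : mseries n K) = mshift t D (x - h * q).
  apply/eqP; rewrite -subr_eq0; apply/eqP.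
  apply: (@bounded_by_eq0 _ _ _ a t rho C theta) => // m.
  rewrite (_ : _ - _ = (q - u m.+1) - mshift t D (h * (u m - q))).
    apply: bounded_byD; first exact: ltW.
      move=> J; apply: le_trans (bq m.+1 J) _.
      by rewrite ler_wpM2l // exprS ler_piMl ?exprn_ge0 // ltW.
    apply: bounded_byN => J.
    have bq' : bnd (C * theta ^+ m) (u m - q).
      by rewrite -opprB; apply: bounded_byN.
    apply: le_trans (shift_contraction bq' J) _.
    by apply: ler_piMl; [exact: mulr_ge0 C0 (exprn_ge0 _ th0)|exact: ltW].
  have := shift_diff (u m) q; rewrite -[mshift t D (x - h * u m)]/(u m.+1).
  by move=> e; rewrite -e addrA subrK.
exists q; split.
- by have := bq 0; rewrite subr0 expr0 mulr1.
- apply/mshift_tlow; rewrite mulrDl opprD addrA addrAC mshiftB mshift_mX.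
  by rewrite -fixq subrr.
- move=> j sx sh J qJ i ji.
  have su m : msupp j (u m).
    elim: m => [|m IHm]; first by move=> I; rewrite /= mseries0E eqxx.
    by apply: msupp_shift; apply: msuppB => //; exact: msuppM.
  apply: contraNeq qJ => Ji;
    apply/eqP/(@absv_geometric_eq0 _ _ a _ _ _ th) => m.
  have := qP J m; have -> : u m J = 0; last by rewrite subr0; exact.
  by apply/eqP; apply: contraNT Ji => /su -> //.
Qed.

End Division.

(** * Change of coordinates making a power of one variable dominant *)

Lemma seq_argmax (R : realDomainType) (T : eqType) (s : seq T) x (F : T -> R) :
  exists2 m, m \in x :: s & forall y, y \in x :: s -> F y <= F m.
Proof.
elim: s x => [|z s IHs] x; first by exists x; rewrite ?mem_head // => y;
  rewrite inE => /eqP->.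
have [m ms mP] := IHs z; have [le|/ltW le] := leP (F x) (F m).
  exists m; first by rewrite inE ms orbT.
  by move=> y; rewrite inE => /orP[/eqP->|/mP].
exists x; first by rewrite mem_head.
by move=> y; rewrite inE => /orP[/eqP->//|/mP/le_trans->].
Qed.

Lemma seq_lt1 (R : realFieldType) (T : eqType) (s : seq T) (F : T -> R) :
  (forall x, x \in s -> F x < 1) ->
  exists2 eta, 0 <= eta < 1 & forall x, x \in s -> F x <= eta.
Proof.
move=> lt1; case: s => [|z s] in lt1 *; first by exists 0; rewrite ?lexx ?ltr01.
have [m ms mP] := seq_argmax s z F.
exists (Num.max 0 (F m)); first by rewrite le_max lexx gt_max ltr01 lt1.
by move=> x /mP; rewrite le_max => ->; rewrite orbT.
Qed.

Section Dominance.
Variables (R : realType) (n : nat) (K : fieldType) (a : nonarch_absval R K).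
Variables (t : 'I_n) (D : nat) (h : mseries n K).
Hypothesis och : overconvergent a h.
Hypothesis h1 : forall J, a (h J) <= 1.
Hypothesis hlt : forall J, (2 * D <= wt t J)%N -> a (h J) < 1.

(** For weights below [2 * D] the factor [rho^-1] is gained. For weights above
    some [W] the terms are small by overconvergence, and the finitely many
    remaining coefficients have absolute values bounded away from 1, which a
    radius close enough to 1 does not spoil. *)
Lemma dominated_near1 : exists2 rhog : R, 1 < rhog &
  forall rho, 1 < rho <= rhog ->
    exists2 theta, 0 <= theta < 1 & bounded_by a t rho (theta * rho ^+ (2 *
      D)) h.
Proof.
have [rho0 [B [rho01 bB]]] := overconvergent_bounded t och.
have [rho1 rho11 le1] := small_radius 2 rho01.
have rho1_0 : 0 < rho1 by lra.
have i1 : 0 <= rho1^-1 < 1 by rewrite invr_ge0 ltW //= invf_lt1.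
have [W hW] := @geometric_small R rho1^-1 B (1 / 2) i1 ltac:(lra).
have [|eta /andP[eta0 eta1] etaP] := @seq_lt1 R _ [seq J <- mbox W | (2 * D
  <= wt t J)%N]
    (fun J => a (h J)).
  by move=> J; rewrite mem_filter => /andP[/hlt].
(* The radius rho2 is such that eta * rho2 ^+ W < 1. *)
have c1 : 1 < 2 / (1 + eta) by rewrite ltr_pdivlMr; lra.
have [rho2 rho21 le2] := small_radius W c1.
exists (Num.min rho1 rho2); first by rewrite lt_min rho11.
move=> rho /andP[r1]; rewrite le_min => /andP[rr1 rr2].
have r0 : 0 < rho by lra.
exists (Num.max rho^-1 (Num.max (1 / 2) (eta * (2 / (1 + eta))))).
  rewrite !le_max invr_ge0 (ltW r0) /= !gt_max invf_lt1 // r1 /=.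
  by apply/andP; split; [lra|rewrite mulrA ltr_pdivrMr; lra].
set theta := Num.max _ _; move=> J.
have th1 : rho^-1 <= theta by rewrite /theta le_max lexx.
have th2 : 1 / 2 <= theta by rewrite /theta !le_max lexx orbT.
have th3 : eta * (2 / (1 + eta)) <= theta by rewrite /theta !le_max lexx !orbT.
have [lt|ge] := ltnP (wt t J) (2 * D).
  apply: (@le_trans _ _ (rho^-1 * rho ^+ (2 * D))); last first.
    by rewrite ler_wpM2r // exprn_ge0 // ltW.
  apply: (@le_trans _ _ (1 * rho ^+ wt t J)).
    by rewrite ler_wpM2r // exprn_ge0 // ltW.
  rewrite mul1r; move: lt; case: (2 * D)%N => // k.
  rewrite ltnS exprS mulKf ?gt_eqF // => le.
  by apply: ler_weXn2l => //; exact: ltW.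
apply: (@le_trans _ _ theta); last first.
  rewrite ler_peMr //; first by apply: le_trans th2; lra.
  by rewrite exprn_ege1 // ltW.
have [WJ|JW] := leqP W (wt t J).
  apply: le_trans th2; apply: le_trans (ltW (hW _ WJ)).
  rewrite exprVn ler_pdivlMr ?exprn_gt0 // -mulrA -exprMn.
  apply: le_trans (bB J); rewrite ler_wpM2l ?absv_ge0 //.
  rewrite lerXn2r ?nnegrE //; [by rewrite mulr_ge0 ?ltW|lra|].
  by apply: le_trans le1; rewrite expr2 ler_wpM2r // ltW.
apply: le_trans th3; apply: ler_pM;
  rewrite ?absv_ge0 ?exprn_ge0 // ?(ltW r0) //.
  apply: etaP; rewrite mem_filter ge /= mem_mbox //.
  by rewrite (leq_trans (mdeg_wt t J)) // ltnW.
apply: le_trans le2; apply: (@le_trans _ _ (rho ^+ W)).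
  by apply: ler_weXn2l; [exact: ltW|exact: ltnW].
by rewrite lerXn2r ?nnegrE //; lra.
Qed.

End Dominance.

Section Shear.
Variables (n : nat) (A : comNzRingType) (t : 'I_n) (e : 'I_n -> nat).
Hypothesis e_gt0 : forall i, (0 < e i)%N.
Hypothesis et1 : e t = 1%N.
Implicit Types (f g h : mseries n A) (I J M : midx n) (s : A).

(** The substitution X_i := X_i + s X_t ^ (e i) for i distinct from [t]; its
    inverse is given by [- s]. *)
Definition shear_fun s i : mseries n A :=
  if i == t then mX (mvar t) else mX (mvar i) + mC s * mX (tpow t (e i)).

Fact shear_fun0 s i : shear_fun s i 0 = 0.
Proof.
have X0 (M : midx n) j : (0 < M j)%N -> (mX M : mseries n A) 0 = 0.
  by move=> Mj; rewrite /mX; case: eqP => // M0; rewrite -M0 ffunE in Mj.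
rewrite /shear_fun; case: eqP => _; first by rewrite (X0 _ t) // ffunE eqxx.
rewrite mseriesDE mCM (X0 _ i) ?ffunE ?eqxx // (X0 _ t) ?mulr0 ?addr0 //.
by rewrite tpowE eqxx.
Qed.

Definition shear s := MSubst (shear_fun0 s).

Lemma shearK s : cancel (mcomp (shear (- s))) (mcomp (shear s)).
Proof.
apply: mcomp_id => i; rewrite /shear /= /shear_fun; case: eqP => [->|/eqP it].
  by rewrite mcomp_var /= /shear_fun eqxx.
rewrite rmorphD /= mcompZ mcomp_var /= /shear_fun (negPf it).
have -> : mcomp (shear s) (mX (tpow t (e i))) = mX (tpow t (e i)).
  by rewrite /tpow -mX_exp rmorphXn /= mcomp_var /= /shear_fun eqxx.
by rewrite rmorphN mulNr addrK.
Qed.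

(** The degree for which the shears are homogeneous. *)
Definition sdeg J : nat := (\sum_i J i * e i)%N.

Lemma sdegD I J : sdeg (I + J) = (sdeg I + sdeg J)%N.
Proof.
by rewrite /sdeg -big_split; apply: eq_bigr => i _; rewrite maddE mulnDl.
Qed.

Lemma sdeg_tpow k : sdeg (tpow t k) = k.
Proof.
rewrite /sdeg (bigD1 t) //= tpowE eqxx et1 muln1 big1 ?addn0 // => i /negPf it.
by rewrite tpowE it.
Qed.

Lemma sdeg_var i : sdeg (mvar i) = e i.
Proof.
rewrite /sdeg (bigD1 i) //= ffunE eqxx mul1n big1 ?addn0 // => j /negPf ji.
by rewrite ffunE ji.
Qed.

Lemma mdeg_sdeg J : (mdeg J <= sdeg J)%N.
Proof. by apply: leq_sum => i _; rewrite leq_pmulr. Qed.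

Lemma sdeg_mdeg J : (sdeg J <= (\sum_i e i) * mdeg J)%N.
Proof.
rewrite /mdeg big_distrr /=; apply: leq_sum => i _; rewrite mulnC leq_mul2r.
by rewrite (bigD1 i) //= leq_addr orbT.
Qed.

Definition homogeneous k f := forall J, f J != 0 -> sdeg J = k.

Lemma homogeneousM k l f g :
  homogeneous k f -> homogeneous l g -> homogeneous (k + l) (f * g).
Proof.
move=> fk gl J; rewrite mseries_mulE => nz; apply: contraNeq nz => Jkl.
rewrite big_seq big1 // => I; rewrite mem_mbelow => IJ.
have [->|fI] := eqVneq (f I) 0; first by rewrite mul0r.
have [->|gI] := eqVneq (g (msub J I)) 0; first by rewrite mulr0.
by move: Jkl; rewrite -(msubK IJ) sdegD (fk _ fI) (gl _ gI) eqxx.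
Qed.

Lemma homogeneous_mX M : homogeneous (sdeg M) (mX M).
Proof. by move=> J; rewrite /mX; case: (J =P M) => [->//|_]; rewrite eqxx. Qed.

Lemma homogeneous_shear s i : homogeneous (e i) (shear s i).
Proof.
rewrite /= /shear_fun; case: eqP => [->|_].
  by rewrite -[e t]sdeg_var; exact: homogeneous_mX.
move=> J; rewrite mseriesDE mCM.
have [X0|/homogeneous_mX -> _] := eqVneq ((mX (mvar i) : mseries n A) J) 0.
  rewrite X0 add0r; have [->|/homogeneous_mX -> _] := eqVneq ((mX (tpow t (e
    i)) : mseries n A) J) 0.
    by rewrite mulr0 eqxx.
  exact: sdeg_tpow.
exact: sdeg_var.
Qed.

Lemma homogeneous_mpow s M : homogeneous (sdeg M) (mpow (shear s) M).
Proof.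
rewrite /mpow /sdeg; elim/big_rec2: _ => [|i k f _ fk].
  move=> J; rewrite mseries_oneE; case: (J =P 0) => [-> _|_];
    last by rewrite eqxx.
  by rewrite /sdeg big1 // => i _; rewrite ffunE.
apply: homogeneousM => //; elim: (M i) => [|l IHl].
  move=> J; rewrite expr0 mseries_oneE; case: (J =P 0) => [-> _|_];
    last by rewrite eqxx.
  by rewrite /sdeg big1 // => j _; rewrite ffunE.
by rewrite exprS mulSn; apply: homogeneousM => //; exact: homogeneous_shear.
Qed.

(** The restriction of the series to the [t]-axis is the [k]-th power of [t]. *)
Definition axis_coef k f := forall l, f (tpow t l) = (l == k)%:R.

Lemma axis_coefM k l f g :
  axis_coef k f -> axis_coef l g -> axis_coef (k + l) (f * g).
Proof.
move=> fk gl m; rewrite mseries_mulE.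
have below J : J \in mbelow (tpow t m) -> J = tpow t (J t) /\ (J t <= m)%N.
  rewrite mem_mbelow => /forallP le; split; last by have := le t;
    rewrite tpowE eqxx.
  apply/ffunP => i; rewrite tpowE; case: eqP => [->//|/eqP it].
  by have := le i; rewrite tpowE (negPf it) leqn0 => /eqP.
have [km|mk] := leqP k m; last first.
  rewrite big_seq big1 => [|J /below[JE Jm]].
    by rewrite (_ : m == _ = false) //; apply/eqP; lia.
  by rewrite JE fk (_ : _ == k = false) ?mul0r //; apply/eqP; lia.
rewrite (bigD1_seq (tpow t k)) ?mbelow_uniq ?mem_mbelow ?mle_tpow ?tpowE
  ?eqxx //=.
rewrite big_seq_cond big1 => [|J /andP[/below[JE Jm] Jk]].
  rewrite fk eqxx mul1r addr0.
  have -> : msub (tpow t m) (tpow t k) = tpow t (m - k).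
    by apply/ffunP => i; rewrite ffunE !tpowE; case: eqP.
  by rewrite gl; congr (_%:R); congr nat_of_bool; apply/eqP/eqP; lia.
rewrite JE fk (_ : _ == k = false) ?mul0r //; apply/eqP => Jtk.
by rewrite JE Jtk eqxx in Jk.
Qed.

Lemma axis_coef1 : axis_coef 0 1.
Proof.
move=> l; rewrite mseries_oneE; congr (_%:R); congr nat_of_bool.
apply/eqP/eqP => [/ffunP/(_ t)|->]; first by rewrite tpowE eqxx => ->;
  rewrite ffunE.
by rewrite /tpow mulr0n.
Qed.

Lemma axis_coef_shear i : axis_coef (e i) (shear 1 i).
Proof.
have tp k l : (tpow t l == tpow t k) = (l == k).
  by apply/eqP/eqP => [/ffunP/(_ t)|->//]; rewrite !tpowE eqxx.
move=> l; rewrite /= /shear_fun; case: eqP => [->|/eqP it].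
  by rewrite et1 /mX -(tp 1%N l).
rewrite mseriesDE mCM mul1r /mX tp (_ : tpow t l == mvar i = false) ?add0r //.
apply/eqP => /ffunP/(_ i); rewrite tpowE ffunE eqxx (negPf it) //.
Qed.

Lemma axis_coef_mpow M : axis_coef (sdeg M) (mpow (shear 1) M).
Proof.
rewrite /mpow /sdeg; elim/big_rec2: _ => [|i k f _ fk]; first exact: axis_coef1.
apply: axis_coefM => //; elim: (M i) => [|l IHl].
  by rewrite expr0; exact: axis_coef1.
by rewrite exprS mulSn; apply: axis_coefM => //; exact: axis_coef_shear.
Qed.

Lemma msupp1 j : msupp j (1 : mseries n A).
Proof. by rewrite -(rmorph1 mC); exact: msupp_mC. Qed.

Lemma msuppD j f g : msupp j f -> msupp j g -> msupp j (f + g).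
Proof.
move=> sf sg; rewrite -[g]opprK -[- g]sub0r; apply: msuppB => //.
by apply: msuppB => // I; rewrite mseries0E eqxx.
Qed.

Lemma msupp_mcomp j s f : (t < j)%N -> msupp j f -> msupp j (mcomp (shear s) f).
Proof.
move=> tj sf J; rewrite (mcompE _ _ (leqnn _)) => nz i ji.
apply: contraNeq nz => Ji; rewrite big1 // => I _.
have [->|fI] := eqVneq (f I) 0; first by rewrite mul0r.
suff sI : msupp j (mpow (shear s) I).
  have [->|nz] := eqVneq (mpow (shear s) I J) 0; first by rewrite mulr0.
  by rewrite (sI _ nz i ji) eqxx in Ji.
rewrite /mpow; elim/big_rec: _ => [|k g _ sg]; first exact: msupp1.
apply: msuppM => //; have [kj|jk] := ltnP k j; last first.
  by rewrite (sf _ fI) //; exact: msupp1.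
have sk : msupp j (shear s k).
  rewrite /= /shear_fun; case: eqP => _;
    first exact: (@msupp_tpow n A t j 1 tj).
  apply: msuppD; last by apply: msuppM; [exact: msupp_mC|exact: msupp_tpow].
  by apply: msupp_mX => m jm; rewrite ffunE; case: eqP => // mk; move: jm;
    rewrite mk leqNgt kj.
elim: (I k) => [|l IHl]; first by rewrite expr0; exact: msupp1.
by rewrite exprS; exact: msuppM.
Qed.

End Shear.

Lemma digits_inj N n (u v : 'I_n -> nat) :
  (forall i, (u i < N)%N) -> (forall i, (v i < N)%N) ->
  (\sum_i u i * N ^ i = \sum_i v i * N ^ i)%N -> u =1 v.
Proof.
elim: n u v => [|n IHn] u v uN vN; first by move=> _ [].
rewrite !big_ord_recl /= !expn0 !muln1.
have tl (w : 'I_n.+1 -> nat) : (\sum_(i < n) w (lift ord0 i) * N ^ bump 0 i =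
    N * \sum_(i < n) w (lift ord0 i) * N ^ i)%N.
  by rewrite big_distrr; apply: eq_bigr => i _ /=; rewrite expnS mulnCA.
rewrite !tl => e.
have u0 : u ord0 = v ord0.
  have := congr1 (modn^~ N) e;
    rewrite /= ![(_ + N * _)%N]addnC ![(N * _)%N]mulnC.
  by rewrite !modnMDl !modn_small.
move: e; rewrite u0 => /addnI /eqP; rewrite eqn_mul2l => /orP[/eqP N0|/eqP e i].
  by have := uN ord0; rewrite N0.
have [j ->|->//] := unliftP ord0 i.
by apply: (IHn (fun j => u (lift ord0 j)) (fun j => v (lift ord0 j))).
Qed.

Section ShearNorm.
Variables (R : realType) (n : nat) (K : fieldType) (a : nonarch_absval R K).
Variables (t : 'I_n) (e : 'I_n -> nat).
Hypothesis e_gt0 : forall i, (0 < e i)%N.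
Hypothesis et1 : e t = 1%N.
Implicit Types (f g h : mseries n K) (I J M : midx n) (s : K).
Local Notation shr := (shear t e_gt0).
Local Notation sdeg := (sdeg e).

Definition integral_series f := forall J, a (f J) <= 1.

Lemma integral_seriesM f g :
  integral_series f -> integral_series g -> integral_series (f * g).
Proof.
move=> f1 g1 J; rewrite mseries_mulE; apply: absv_sum => // I _.
by rewrite absvM mulr_ile1 ?absv_ge0.
Qed.

Lemma absv_nat_of_bool (b : bool) : a b%:R <= 1.
Proof. by case: b; rewrite ?absv1 ?absv0. Qed.

Lemma integral_mpow s M : a s <= 1 -> integral_series (mpow (shr s) M).
Proof.
move=> s1; have i1 : integral_series 1 by move=> J; exact: absv_nat_of_bool.
rewrite /mpow; elim/big_rec: _ => [|i f _ f1]; first exact: i1.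
apply: integral_seriesM => //; elim: (M i) => [|l IHl]; first by rewrite expr0.
rewrite exprS; apply: integral_seriesM => // J.
rewrite /= /shear_fun; case: eqP => _; first exact: absv_nat_of_bool.
rewrite mseriesDE mCM (le_trans (absvD a _ _)) // ge_max absv_nat_of_bool.
by rewrite absvM mulr_ile1 ?absv_ge0 ?absv_nat_of_bool.
Qed.

Lemma mcomp_shear_bound s f J B : a s <= 1 -> 0 <= B ->
  (forall I, sdeg I = sdeg J -> a (f I) <= B) -> a (mcomp (shr s) f J) <= B.
Proof.
move=> s1 B0 fB; rewrite (mcompE _ _ (leqnn _)); apply: absv_sum => // I _.
have [->|nz] := eqVneq (mpow (shr s) I J) 0; first by rewrite mulr0 absv0.
rewrite absvM -[B]mulr1 ler_pM ?absv_ge0 ?integral_mpow // fB //.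
by rewrite (homogeneous_mpow et1 nz).
Qed.

Lemma absv_sum_lt (T : eqType) (s : seq T) (F : T -> K) (B : R) : 0 < B ->
  {in s, forall t, a (F t) < B} -> a (\sum_(t <- s) F t) < B.
Proof.
move=> B0 ltF; rewrite big_seq; elim/big_ind: _ => [|x y ltx lty|i].
- by rewrite absv0.
- by rewrite (le_lt_trans (absvD a x y)) // gt_max ltx.
- exact: ltF.
Qed.

Lemma mcomp_shear_lt s f J B : a s <= 1 -> 0 < B ->
  (forall I, sdeg I = sdeg J -> a (f I) < B) -> a (mcomp (shr s) f J) < B.
Proof.
move=> s1 B0 fB; rewrite (mcompE _ _ (leqnn _)); apply: absv_sum_lt => // I _.
have [->|nz] := eqVneq (mpow (shr s) I J) 0; first by rewrite mulr0 absv0.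
rewrite absvM -[B]mulr1; apply: (@le_lt_trans _ _ (a (f I) * 1)).
  by rewrite ler_wpM2l ?absv_ge0 ?integral_mpow.
by rewrite !mulr1 fB // (homogeneous_mpow et1 nz).
Qed.

Lemma overconvergent_shear s f : a s <= 1 ->
  overconvergent a f -> overconvergent a (mcomp (shr s) f).
Proof.
move=> s1 /overconvergentP[rho [B [rho1 fB]]].
have rho0 : 0 <= rho by lra.
have B0 : 0 <= B by apply: le_trans (fB 0);
  rewrite mulr_ge0 ?absv_ge0 ?exprn_ge0.
have [sig sig1 le] := small_radius (\sum_i e i) rho1.
apply/overconvergentP; exists sig, B; split=> // J.
have sig0 : 0 < sig by lra.
rewrite -ler_pdivlMr ?exprn_gt0 //; apply: mcomp_shear_bound => // [|I IJ].
  by rewrite divr_ge0 // exprn_ge0 // ltW.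
rewrite ler_pdivlMr ?exprn_gt0 //; apply: le_trans (fB I).
rewrite ler_wpM2l ?absv_ge0 //.
apply: (@le_trans _ _ (sig ^+ ((\sum_i e i) * mdeg I))).
  apply: ler_weXn2l; first exact: ltW.
  by rewrite (leq_trans (mdeg_sdeg e_gt0 J)) // -IJ sdeg_mdeg.
by rewrite exprM lerXn2r ?nnegrE ?exprn_ge0 ?(ltW sig0).
Qed.

End ShearNorm.

(** With weight 1 for [t] and [N ^ i.+1] for the i-th of the other variables,
    the last digit of [sdeg e I] in base [N] is [I t], and the other exponents
    are the remaining digits. *)
Lemma shear_weights n (t : 'I_n) N : (0 < N)%N -> exists e : 'I_n -> nat,
  [/\ forall i, (0 < e i)%N, e t = 1%N &
    forall I J : midx n, (mdeg I < N)%N -> (mdeg J < N)%N ->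
      sdeg e I = sdeg e J -> I = J].
Proof.
move=> N0; exists (fun i => if i == t then 1%N else N ^ i.+1)%N; split.
- by move=> i; case: eqP => // _; rewrite expn_gt0 N0.
- by rewrite eqxx.
move=> I J IN JN.
pose u (L : midx n) i := if i == t then 0%N else L i.
have sE L : sdeg (fun i => if i == t then 1%N else N ^ i.+1)%N L
    = (L t + N * \sum_i u L i * N ^ i)%N.
  rewrite /sdeg (bigD1 t) //= eqxx muln1 [in RHS](bigD1 t) //= {1}/u eqxx
    mul0n add0n.
  congr addn; rewrite big_distrr; apply: eq_bigr => i /negPf it.
  by rewrite /u it expnS mulnCA.
have lt (L : midx n) : (mdeg L < N)%N -> forall i, (L i < N)%N.
  by move=> LN i; exact: leq_ltn_trans (mdeg_ge L i) LN.
have ltu (L : midx n) : (mdeg L < N)%N -> forall i, (u L i < N)%N.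
  by move=> LN i; rewrite /u; case: eqP => // _; exact: lt.
rewrite !sE => e.
have et : I t = J t.
  have := congr1 (modn^~ N) e;
    rewrite /= ![(_ + N * _)%N]addnC ![(N * _)%N]mulnC.
  by rewrite !modnMDl !modn_small ?lt.
move: e; rewrite et => /addnI /eqP; rewrite eqn_mul2l => /orP[/eqP N00|/eqP e].
  by rewrite N00 in N0.
have uE := digits_inj (ltu _ IN) (ltu _ JN) e.
apply/ffunP => i; have := uE i; rewrite /u; case: eqP => [->//|//].
Qed.

Section Normalization.
Variables (R : realType) (n : nat) (K : fieldType) (a : nonarch_absval R K).
Variable t : 'I_n.
Implicit Types (f g h : mseries n K) (I J M : midx n).

Lemma overconvergent_mC c : overconvergent a (mC c : mseries n K).
Proof.
apply/overconvergentP; exists 2, (a c); split=> [|I]; first by lra.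
rewrite /mC; case: (I =P 0) => [->|_]; first by rewrite mulr1 mdeg0 expr0 mulr1.
by rewrite mulr0 absv0 mul0r absv_ge0.
Qed.

Lemma overconvergentM f g : overconvergent a f -> overconvergent a g ->
  overconvergent a (f * g).
Proof.
have [_ _ oM] := oc_subring_closed n a.
by move=> of_ og; apply/asboolP/oM; exact/asboolP.
Qed.

Lemma overconvergentB f g : overconvergent a f -> overconvergent a g ->
  overconvergent a (f - g).
Proof.
have [_ oB _] := oc_subring_closed n a.
by move=> of_ og; apply/asboolP/oB; exact/asboolP.
Qed.

Lemma overconvergent_mX M : overconvergent a (mX M : mseries n K).
Proof.
apply/overconvergentP; exists 2, (2 ^+ mdeg M); split=> [|I]; first by lra.
rewrite /mX; case: (I =P M) => [->|_]; first by rewrite absv1 mul1r.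
by rewrite absv0 mul0r exprn_ge0.
Qed.

(** The coefficients of an overconvergent series tend to zero, so the maximum of
    their absolute values is attained, and only in bounded degree. *)
Lemma gauss_norm_attained f : overconvergent a f -> f != 0 ->
  exists M N, [/\ f M != 0, forall J, a (f J) <= a (f M) &
    forall J, a (f J) = a (f M) -> (mdeg J < N)%N].
Proof.
move=> /overconvergentP[rho [B [rho1 fB]]] f0.
have [I0 fI0] : exists I, f I != 0.
  apply: contrapT => no; case/eqP: f0; apply/funext => I;
    apply: contrapT => /eqP fI.
  by apply: no; exists I.
have rho0 : 0 < rho by lra.
have i1 : 0 <= rho^-1 < 1 by rewrite invr_ge0 ltW //= invf_lt1.
have apos x : x != 0 -> 0 < a x.
  by move=> x0; rewrite lt_def absv_ge0 andbT;
    apply: contraNneq x0 => /absv_eq0 ->.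
have [N hN] := geometric_small B i1 (apos _ fI0).
have far J : (N <= mdeg J)%N -> a (f J) < a (f I0).
  move=> NJ; apply: le_lt_trans (hN _ NJ).
  by rewrite exprVn ler_pdivlMr ?exprn_gt0.
have [M Ms Mmax] := seq_argmax (mbox N) I0 (fun J => a (f J)).
have maxM J : a (f J) <= a (f M).
  have [JN|NJ] := ltnP (mdeg J) N; last first.
    by apply: le_trans (ltW (far _ NJ)) _; apply: Mmax; exact: mem_head.
  by apply: Mmax; rewrite inE mem_mbox ?orbT // ltnW.
exists M, N; split=> // [|J JM].
  have : 0 < a (f M) by apply: lt_le_trans (apos _ fI0) (maxM _).
  by apply: contraTneq => ->; rewrite absv0 ltxx.
rewrite ltnNge; apply/negP => /far; rewrite JM => lt.
by have := lt_le_trans lt (maxM I0); rewrite ltxx.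
Qed.

(** Among the terms of [f] with coefficient of maximal absolute value choose the
    one of maximal [sdeg] [D], which is unique by the choice of the weights. The
    shear turns it into the term in the [D]-th power of [t]. The other
    coefficients stay bounded by the same maximum, and those at exponents of
    [sdeg] greater than [D] are strictly smaller; an exponent other than
    [tpow t D] with [wt t J >= 2 * D] is of this kind. *)
Lemma normalization f : overconvergent a f -> f != 0 ->
  exists e (e_gt0 : forall i, (0 < e i)%N) c D h,
    [/\ e t = 1%N, c != 0, mcomp (shear t e_gt0 1) f = mC c * (mX (tpow t D)
      + h),
        forall J, a (h J) <= 1 &
        forall J, (2 * D <= wt t J)%N -> a (h J) < 1].
Proof.
move=> ocf f0; have [M [N [fM0 maxM MN]]] := gauss_norm_attained ocf f0.
have N0 : (0 < N)%N by exact: leq_ltn_trans (MN _ erefl).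
have [e [e_gt0 et1 e_inj]] := shear_weights t N0.
exists e, e_gt0.
have mu0 : 0 < a (f M).
  by rewrite lt_def absv_ge0 andbT; apply: contraNneq fM0 => /absv_eq0 ->.
pose P k := `[< exists2 I, a (f I) = a (f M) & sdeg e I = k >].
have exP : exists k, P k by exists (sdeg e M); apply/asboolP; exists M.
have ubP k : P k -> (k <= (\sum_i e i) * N)%N.
  move=> /asboolP[I IM <-]; apply: leq_trans (sdeg_mdeg e I) _.
  by rewrite leq_mul2l (ltnW (MN _ IM)) orbT.
case: (ex_maxnP exP ubP) => D /asboolP[I0 I0M I0D] Dmax {exP ubP}.
have a1 : a 1 <= 1 by rewrite absv1.
pose f' := mcomp (shear t e_gt0 1) f.
have f'le J : a (f' J) <= a (f M) by apply: mcomp_shear_bound => //; exact: ltW.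
have f'lt J : (D < sdeg e J)%N -> a (f' J) < a (f M).
  move=> DJ; apply: mcomp_shear_lt => // I IJ.
  rewrite lt_neqAle maxM andbT; apply: contraTneq DJ => IM.
  by rewrite -leqNgt Dmax //; apply/asboolP; exists I.
pose c := f' (tpow t D).
(* I0 is the only exponent of maximal absolute value to contribute to c. *)
have cI0 : a (c - f I0) < a (f M).
  pose L := mdeg (tpow t D); have LI0 : I0 \in mbox L.
    rewrite mem_mbox // (leq_trans (mdeg_sdeg e_gt0 I0)) // I0D.
    by have := mdeg_ge (tpow t D) t; rewrite tpowE eqxx.
  rewrite /c /f' (mcompE _ _ (leqnn _)) -/L (bigD1_seq I0) ?mbox_uniq //=.
  rewrite (axis_coef_mpow K e_gt0 et1) I0D eqxx mulr1 [f I0 + _]addrC addrK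
    -big_filter.
  apply: absv_sum_lt => // I; rewrite mem_filter => /andP[II0 _].
  rewrite (axis_coef_mpow K e_gt0 et1); case: eqP => [DI|_];
    last by rewrite mulr0 absv0.
  rewrite mulr1 lt_neqAle maxM andbT; apply: contraNneq II0 => IM.
  by apply/eqP; apply: e_inj; rewrite ?MN // -DI.
have ac : a c = a (f M).
  apply/eqP; rewrite eq_le f'le /= -I0M leNgt; apply/negP => lt.
  have : a (f I0) < a (f M).
    have -> : f I0 = c - (c - f I0) by ring.
    by rewrite (le_lt_trans (absvB _ _ _)) // gt_max cI0 andbT -I0M.
  by rewrite I0M ltxx.
have c0 : c != 0 by apply: contraTneq mu0 => c0; rewrite -ac c0 absv0 ltxx.
have acV x : a (c^-1 * x) = a x / a (f M).
  apply: (mulfI (x := a (f M))); first by rewrite gt_eqF.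
  by rewrite -{1}ac -absvM mulVKf // mulrC divfK // gt_eqF.
pose h : mseries n K := mC c^-1 * f' - mX (tpow t D).
have hD : h (tpow t D) = 0.
  by rewrite /h mseriesBE mCM -/c mulVf // /mX eqxx subrr.
have hE J : J != tpow t D -> a (h J) = a (f' J) / a (f M).
  by move=> /negPf JD; rewrite /h mseriesBE mCM /mX JD subr0 acV.
exists c, D, h; split=> //.
- rewrite /h addrC subrK mulrA -rmorphM mulfV // rmorph1 mul1r //.
- move=> J; have [->|JD] := eqVneq J (tpow t D); first by rewrite hD absv0.
  by rewrite hE // ler_pdivrMr // mul1r.
- move=> J wJ; have [->|JD] := eqVneq J (tpow t D); first by rewrite hD absv0.
  rewrite hE // ltr_pdivrMr // mul1r; apply: f'lt.
  rewrite ltnNge; apply: contra JD => JD.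
  have mD := leq_trans (mdeg_sdeg e_gt0 J) JD.
  have tm := mdeg_ge J t; have mJt : (mdeg J = J t /\ J t = D)
    by rewrite /wt in wJ; lia.
  apply/eqP/ffunP => i; rewrite tpowE; case: eqP => [->|/eqP it];
    first by case: mJt.
  have [+ _] := mJt; rewrite /mdeg (bigD1 t) //= (bigD1 i) //=; lia.
Qed.

Lemma overconvergent_normalized f e (e_gt0 : forall i, (0 < e i)%N) c D h :
  e t = 1%N -> c != 0 ->
  overconvergent a f -> mcomp (shear t e_gt0 1) f = mC c * (mX (tpow t D) +
    h) ->
  overconvergent a h.
Proof.
move=> et1 c0 ocf fE.
have -> : h = mC c^-1 * mcomp (shear t e_gt0 1) f - mX (tpow t D).
  by rewrite fE mulrA -rmorphM mulVf // rmorph1 mul1r addrC addrA addNr add0r.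
apply: overconvergentB; last exact: overconvergent_mX.
apply: overconvergentM; first exact: overconvergent_mC.
by apply: overconvergent_shear => //; rewrite absv1.
Qed.

Lemma msupp_normalized j f e (e_gt0 : forall i, (0 < e i)%N) c D h :
  (t < j)%N -> c != 0 ->
  msupp j f -> mcomp (shear t e_gt0 1) f = mC c * (mX (tpow t D) + h) ->
  msupp j h.
Proof.
move=> tj c0 sf fE.
have -> : h = mC c^-1 * mcomp (shear t e_gt0 1) f - mX (tpow t D).
  by rewrite fE mulrA -rmorphM mulVf // rmorph1 mul1r addrC addrA addNr add0r.
apply: msuppB.
  by apply: msuppM; [exact: msupp_mC|exact: msupp_mcomp].
exact: msupp_tpow.
Qed.

End Normalization.

(** * Overconvergent series in the first variables *)

(** The induction on the number of variables takes place inside the ring of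
    series in all [n] variables. *)
Section InitialSeries.
Variables (R : realType) (n : nat) (K : fieldType) (a : nonarch_absval R K).

Definition oc_init_pred j : {pred mseries n K} :=
  [pred f | `[< overconvergent a f /\ msupp j f >]].

Fact oc_init_subring_closed j : subring_closed (oc_init_pred j).
Proof.
have [o1 oB oM] := oc_subring_closed n a.
split.
- by apply/asboolP; split; [exact/asboolP|exact: msupp1].
- move=> f g /asboolP[of_ sf] /asboolP[og sg]; apply/asboolP.
  by split; [exact: overconvergentB|exact: msuppB].
- move=> f g /asboolP[of_ sf] /asboolP[og sg]; apply/asboolP.
  by split; [exact: overconvergentM|exact: msuppM].
Qed.

HB.instance Definition _ j :=
  GRing.isSubringClosed.Build (mseries n K) (oc_init_pred j)
    (oc_init_subring_closed j).

Record oc_init j :=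
  OcInit { oc_init_val :> mseries n K; _ : oc_init_val \in oc_init_pred j }.

HB.instance Definition _ j := [isSub for @oc_init_val j].
HB.instance Definition _ j := [Choice of oc_init j by <:].
HB.instance Definition _ j := [SubChoice_isSubComNzRing of oc_init j by <:].

Lemma oc_initP j (x : oc_init j) : overconvergent a x /\ msupp j x.
Proof. by have /asboolP := valP x. Qed.

Lemma oc_init_valD j (x y : oc_init j) : val (x + y) = val x + val y.
Proof. by []. Qed.
Lemma oc_init_valB j (x y : oc_init j) : val (x - y) = val x - val y.
Proof. by []. Qed.
Lemma oc_init_valM j (x y : oc_init j) : val (x * y) = val x * val y.
Proof. by []. Qed.
Lemma oc_init_val1 j : val (1 : oc_init j) = 1.
Proof. by []. Qed.
Lemma oc_init_valX j (x : oc_init j) k : val (x ^+ k) = val x ^+ k.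
Proof. by elim: k => [//|k IHk]; rewrite !exprS oc_init_valM IHk. Qed.

Lemma oc_init_exists j f : overconvergent a f -> msupp j f ->
  exists x : oc_init j, val x = f.
Proof.
by move=> oc sf; have h : f \in oc_init_pred j;
  [exact/asboolP|exists (OcInit h)].
Qed.

Lemma oc_init_rmorph j (F : {rmorphism mseries n K -> mseries n K}) :
  (forall f, overconvergent a f -> overconvergent a (F f)) ->
  (forall f, msupp j f -> msupp j (F f)) ->
  exists phi : {rmorphism oc_init j -> oc_init j}, forall x,
    val (phi x) = F (val x).
Proof.
move=> Foc Fs.
have /choice [phi phiE] : forall x : oc_init j, exists y : oc_init j,
  val y = F (val x).
  by move=> x; have [ocx sx] := oc_initP x; apply: oc_init_exists; auto.
have phiB : zmod_morphism phi.
  by move=> x y; apply: val_inj; rewrite phiE !rmorphB /= !phiE.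
have phiM : monoid_morphism phi.
  by split=> [|x y]; apply: val_inj;
    rewrite !(phiE, rmorph1, rmorphM) //= !phiE.
pose P : {rmorphism oc_init j -> oc_init j} := HB.pack phi
  (GRing.isZmodMorphism.Build _ _ phi phiB)
  (GRing.isMonoidMorphism.Build _ _ phi phiM).
by exists P.
Qed.

Fact oc_init_widen_subproof j (x : oc_init j) : val x \in oc_init_pred j.+1.
Proof.
have [ocx sx] := oc_initP x; apply/asboolP; split=> // I xI i ji.
by apply: (sx I xI); exact: ltnW.
Qed.
Definition oc_init_widen j (x : oc_init j) : oc_init j.+1 :=
  OcInit (oc_init_widen_subproof x).

Fact oc_init_widen_zmod j : zmod_morphism (@oc_init_widen j).
Proof. 
move=> x y; apply: val_inj; rewrite rmorphB.
exact: (rmorphB (val : oc_init j -> mseries n K)).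
Qed.
Fact oc_init_widen_monoid j : monoid_morphism (@oc_init_widen j).
Proof. 
split=> [|x y]; apply: val_inj.
  by rewrite rmorph1; exact: (rmorph1 (val : oc_init j -> mseries n K)).
by rewrite rmorphM; exact: (rmorphM (val : oc_init j -> mseries n K)).
Qed.
HB.instance Definition _ j := GRing.isZmodMorphism.Build _ _ (@oc_init_widen j)
  (@oc_init_widen_zmod j).
HB.instance Definition _ j := GRing.isMonoidMorphism.Build _ _
  (@oc_init_widen j)
  (@oc_init_widen_monoid j).

End InitialSeries.

Section Evaluation.
Variables (R : realType) (n : nat) (K : fieldType) (a : nonarch_absval R K).
Variable t : 'I_n.
Local Notation S := (oc_init n a t).
Local Notation S' := (oc_init n a t.+1).

Fact oc_tvar_subproof : (mX (mvar t) : mseries n K) \in oc_init_pred a t.+1.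
Proof.
apply/asboolP; split; first exact: overconvergent_mX.
apply: msupp_mX => i ti; rewrite ffunE; case: eqP => // it.
by rewrite it ltnn in ti.
Qed.
Definition oc_tvar : S' := OcInit oc_tvar_subproof.

(** A polynomial in the next variable [t], over the series in the preceding
    variables, viewed as a series. *)
Definition oc_eval : {rmorphism {poly S} -> S'} :=
  (horner_eval oc_tvar \o map_poly (@oc_init_widen R n K a t)).

Lemma oc_evalE (p : {poly S}) J :
  val (oc_eval p) J = val p`_(J t) (msub J (tpow t (J t))).
Proof.
have -> : val (oc_eval p) = \sum_(k < size p) val p`_k * mX (tpow t k).
  rewrite /= /horner_eval (horner_coef_wide _ (size_poly _ _)).
  rewrite [LHS](raddf_sum (val : S' -> mseries n K)); apply: eq_bigr => k _.
  rewrite coef_map [LHS](rmorphM (val : S' -> mseries n K)) /=; congr (_ * _).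
  by rewrite [LHS](rmorphXn (val : S' -> mseries n K)) mX_exp.
rewrite mseries_sumE.
have term k : (val p`_k * mX (tpow t k)) J =
    if k == J t then val p`_k (msub J (tpow t k)) else 0.
  rewrite mulrC mXM mle_tpow; case: ltngtP => // kJ.
  have [_ sp] := oc_initP p`_k; apply/eqP;
    apply: contraTT kJ => /sp /(_ t (leqnn _)).
  by rewrite ffunE tpowE eqxx => /eqP; rewrite subn_eq0 -leqNgt.
under eq_bigr do rewrite term.
have [lt|ge] := ltnP (J t) (size p).
  by rewrite -big_mkcond (big_pred1 (Ordinal lt)).
rewrite nth_default // big1 // => k _; case: eqP => // kJ.
by have := ltn_ord k; rewrite kJ ltnNge ge.
Qed.

Lemma oc_eval_inj (p : {poly S}) : oc_eval p = 0 -> p = 0.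
Proof.
move=> p0; apply/polyP => k; rewrite coef0; apply: val_inj;
  apply/funext => I /=.
have [It|It] := eqVneq (I t) 0%N; last first.
  have [_ sp] := oc_initP p`_k; apply/eqP;
    apply: contraNT It => /sp /(_ t (leqnn _)) ->//.
have := oc_evalE p (I + tpow t k); rewrite maddE tpowE eqxx It add0n.
by rewrite addrC maddK p0 => <-.
Qed.

Lemma oc_eval_tlow D (p : {poly S}) : (size p <= D)%N -> tlow t D (val
  (oc_eval p)).
Proof.
by move=> sp J DJ; rewrite oc_evalE nth_default // (leq_trans sp).
Qed.

Lemma oc_eval_surj D (x : S') : tlow t D (val x) ->
  exists2 p : {poly S}, (size p <= D)%N & oc_eval p = x.
Proof.
move=> lx; have [ocx sx] := oc_initP x.
have /choice [c cE] : forall k, exists y : S,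
    val y = fun I => if I t == 0%N then val x (I + tpow t k) else 0.
  move=> k; apply: oc_init_exists.
    move: ocx => /overconvergentP[rho [B [rho1 xB]]].
    have rho0 : 0 <= rho by lra.
    apply/overconvergentP; exists rho, B; split=> // I; case: eqP => _;
      last first.
      by rewrite absv0 mul0r (le_trans _ (xB 0)) // mulr_ge0 ?absv_ge0
        ?exprn_ge0.
    apply: le_trans (xB (I + tpow t k)); rewrite ler_wpM2l ?absv_ge0 //.
    by apply: ler_weXn2l; [exact: ltW|rewrite mdegD leq_addr].
  move=> I; case: (I t =P 0%N) => [It nz i ti|_]; last by rewrite eqxx.
  have [->//|it] := eqVneq i t.
  have ti' : (t < i)%N by rewrite ltn_neqAle ti andbT;
    apply: contraNneq it => /val_inj ->.
  by have := sx _ nz i ti'; rewrite maddE => /eqP;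
    rewrite addn_eq0 => /andP[/eqP].
exists (\poly_(k < D) c k); first exact: size_poly.
apply: val_inj; apply/funext => J; rewrite oc_evalE coef_poly; case: ltnP => JD.
  rewrite cE ffunE tpowE eqxx subnn eqxx addrC msubK // mle_tpow //.
by rewrite lx.
Qed.

End Evaluation.

(** * Weierstrass preparation *)

Section Weierstrass.
Variables (R : realType) (n : nat) (K : fieldType) (a : nonarch_absval R K).
Hypothesis complete_a : complete_absval a.
Variable t : 'I_n.
Local Notation S := (oc_init n a t).
Local Notation S' := (oc_init n a t.+1).
Local Notation ev := (oc_eval a t).

Section Dominated.
Variables (D : nat) (G : S').
Let h : mseries n K := val G - mX (tpow t D).
Hypothesis dominated : exists2 rhog : R, 1 < rhog &
  forall rho, 1 < rho <= rhog ->
  exists2 theta, 0 <= theta < 1 & bounded_by a t rho (theta * rho ^+ (2 * D)) h.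

Let GE : val G = mX (tpow t D) + h.
Proof. by rewrite /h addrC subrK. Qed.

Let sh : msupp t.+1 h.
Proof.
apply: msuppB; first by have [] := oc_initP G.
exact: msupp_tpow.
Qed.

Lemma common_radius (x : S') : exists rho theta B, [/\ 1 < rho, 0 <= theta < 1,
  bounded_by a t rho (theta * rho ^+ (2 * D)) h & bounded_by a t rho B (val x)].
Proof.
have [rhog rg1 dom] := dominated.
have [ocx _] := oc_initP x;
  have [rho [B [r1 bx]]] := overconvergent_bounded t ocx.
have m1 : 1 < Num.min rho rhog by rewrite lt_min r1.
have [theta th bh] := dom (Num.min rho rhog) ltac:(by rewrite m1 ge_min lexx
  orbT).
exists (Num.min rho rhog), theta, B; split=> //; apply: bounded_by_radius bx.
by rewrite ge_min lexx andbT ltW //; lra.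
Qed.

Lemma weierstrass_division_exists (x : S') :
  exists q (p : {poly S}), (size p <= D)%N /\ x = G * q + ev p.
Proof.
have [rho [theta [B [r1 th bh bx]]]] := common_radius x.
have [q [bq lq sq]] := division_exists complete_a r1 th bh bx.
have [ocx sx] := oc_initP x.
have [y yE] := oc_init_exists (bounded_overconvergent r1 bq) (sq _ sx sh).
have /oc_eval_surj [p sp pE] : tlow t D (val (x - G * y)).
  rewrite oc_init_valB oc_init_valM.
  by rewrite yE GE.
by exists y, p; split=> //; rewrite pE addrC subrK.
Qed.

Lemma weierstrass_division_unique (q : S') (p : {poly S}) :
  (size p <= D)%N -> G * q + ev p = 0 -> q = 0 /\ p = 0.
Proof.
move=> sp e; suff q0 : q = 0.
  by split=> //; apply: oc_eval_inj; rewrite -e q0 mulr0 add0r.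
have [rho [theta [B [r1 th bh bq]]]] := common_radius q.
apply: val_inj; apply: (division_unique r1 th bh bq (oc_eval_tlow sp)).
rewrite -GE -oc_init_valM.
by rewrite -oc_init_valD e.
Qed.

(** The power of [t] divided by [G] has a quotient [q] of the form 1 + small,
    which is a unit by division in degree zero; the remainder subtracted from
    the power of [t] is the monic polynomial [G * q]. *)
Lemma weierstrass_preparation : exists (q q' : S') (g : {poly S}),
  [/\ q * q' = 1, g \is monic, size g = D.+1 & ev g = G * q].
Proof.
have [rhog rg1 /(_ rhog) [|theta th bh]] := dominated;
  first by rewrite rg1 lexx.
have bX (k : nat) : bounded_by a t rhog (rhog ^+ (2 * k)) (mX (tpow t k)).
  move=> J; rewrite /mX; case: (J =P tpow t k) => [->|_].
    by rewrite absv1 mul1r wt_tpow.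
  by rewrite absv0 mul0r exprn_ge0 //; lra.
have [q0 [bq lq sq]] := division_exists complete_a rg1 th bh (bX D).
rewrite divff in bq; last by rewrite expf_neq0 // gt_eqF //; lra.
have tS k : msupp t.+1 (mX (tpow t k) : mseries n K).
  exact: msupp_tpow.
have [q qE] := oc_init_exists (bounded_overconvergent rg1 bq) (sq _ (tS D) sh).
have [X XE] := oc_init_exists (@overconvergent_mX _ _ _ a (tpow t D)) (tS D).
have val1 : val (1 : S') = mX (tpow t 0) :> mseries n K.
  by rewrite oc_init_val1 /tpow mulr0n.
(* The series 1 dominates q0 - 1, so that one can divide by q0. *)
have b1 : bounded_by a t rhog (theta * rhog ^+ (2 * 0)) (q0 - mX (tpow t 0)).
  have -> : q0 - mX (tpow t 0) = - mshift t D (h * q0).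
    have /mshift_tlow : tlow t D (mX (tpow t D) - (mX (tpow t D) + h) * q0)
      by [].
    have -> : mX (tpow t D) - (mX (tpow t D) + h) * q0 =
        mX (tpow t D) * (1 - q0) - h * q0 by ring.
    rewrite mshiftB mshift_mX => /eqP; rewrite subr_eq0 => /eqP <-.
    by rewrite opprB /tpow mulr0n.
  rewrite muln0 expr0; apply: bounded_byN; exact: shift_contraction.
have [q1 [bq1 lq1 sq1]] := division_exists complete_a rg1 th b1 (bX 0%N).
have qinv : q0 * q1 = mX (tpow t 0).
  apply/eqP; rewrite eq_sym -subr_eq0; apply/eqP.
  have -> : mX (tpow t 0) - q0 * q1 =
      mX (tpow t 0) - (mX (tpow t 0) + (q0 - mX (tpow t 0))) * q1 by ring.
  by apply/funext => J; apply: lq1.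
have sq0 : msupp t.+1 q0 by apply: sq.
have [|q' q'E] := oc_init_exists (bounded_overconvergent rg1 bq1) (sq1 t.+1
  (tS 0%N) _).
  exact: msuppB.
have /oc_eval_surj [p sp pE] : tlow t D (val (X - G * q)).
  rewrite oc_init_valB oc_init_valM.
  by rewrite XE qE GE.
exists q, q', ('X^D - p); split.
- apply: val_inj; rewrite oc_init_valM qE q'E.
  by rewrite val1.
- by rewrite monicE lead_coefDl ?lead_coefXn // size_polyN size_polyXn ltnS.
- by rewrite size_polyDl size_polyXn // size_polyN ltnS.
rewrite (rmorphB ev) pE.
have -> : ev 'X^D = X.
  rewrite (rmorphXn ev); apply: val_inj.
  rewrite oc_init_valX XE /= /horner_eval map_polyX hornerX.
  by rewrite /= mX_exp.
by rewrite subKr.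
Qed.

End Dominated.

Lemma oc_eval_weierstrass : weierstrass_ring ev.
Proof.
move=> b b0; have [ocb sb] := oc_initP b.
have vb0 : val b != 0 by [].
have [e [e_gt0 [c [D [h [et1 c0 bE h1 hlt]]]]]] := normalization t ocb vb0.
have och := overconvergent_normalized et1 c0 ocb bE.
have sh := msupp_normalized (ltnSn t) c0 sb bE.
have aux s : a s <= 1 -> exists phi : {rmorphism S' -> S'},
    forall x, val (phi x) = mcomp (shear t e_gt0 s) (val x).
  move=> s1; apply: oc_init_rmorph => f; first exact: overconvergent_shear.
  exact: msupp_mcomp.
have [phi phiE] := aux 1 ltac:(by rewrite absv1).
have [psi psiE] := aux (-1) ltac:(by rewrite absvN absv1).
have phiK : cancel phi psi.
  move=> x; apply: val_inj; rewrite psiE phiE.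
  by have := shearK t e_gt0 (-1) (val x); rewrite opprK.
have tS : msupp t.+1 (mX (tpow t D) : mseries n K).
  exact: msupp_tpow.
have [G GE] : exists G : S', val G = mX (tpow t D) + h.
  rewrite -[h]opprK -[- h]sub0r; apply: oc_init_exists.
    apply: overconvergentB; first exact: overconvergent_mX.
    by apply: overconvergentB => //; rewrite -(rmorph0 mC);
      exact: overconvergent_mC.
  by rewrite opprB subr0; exact: msuppD.
have dom : exists2 rhog : R, 1 < rhog & forall rho, 1 < rho <= rhog ->
    exists2 theta, 0 <= theta < 1 &
      bounded_by a t rho (theta * rho ^+ (2 * D)) (val G - mX (tpow t D)).
  by rewrite GE addrC addKr; exact: dominated_near1.
have [q [q' [g [qq' mg sg gE]]]] := weierstrass_preparation dom.
have [C CE] := oc_init_exists (@overconvergent_mC _ n _ a c) (@msupp_mC _ _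
  t.+1 c).
have [C' C'E] := oc_init_exists (@overconvergent_mC _ n _ a c^-1) (@msupp_mC
  _ _ t.+1 c^-1).
have CC' : C * C' = 1.
  apply: val_inj; rewrite oc_init_valM CE C'E -rmorphM.
  by rewrite mulfV // oc_init_val1 rmorph1.
exists phi, psi, (C * q'), (C' * q), g; split=> //.
- by rewrite mulrACA CC' mulrC mulr1 mulrC.
- apply: val_inj; rewrite phiE bE gE -CE -GE -oc_init_valM.
  by congr val; rewrite -mulrA [q' * _]mulrC -mulrA qq' mulr1.
split=> //.
- move=> x; have [y [p [sp xE]]] := weierstrass_division_exists dom x.
  exists (q' * y), p; rewrite sg ltnS; split=> //.
  by rewrite gE -mulrA [q * _]mulrA qq' mul1r.
- move=> y p; rewrite sg ltnS gE -mulrA => sp yp0.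
  have [qy0 p0] := weierstrass_division_unique dom sp yp0.
  by split=> //; rewrite -[y]mul1r -qq' [q * q']mulrC -mulrA qy0 mulr0.
Qed.

End Weierstrass.

(** * The ring of overconvergent series is projective-free *)

Section ClassicalInverse.
Variable A : comNzRingType.

Definition classical_unit : {pred A} := fun x => `[< exists y, y * x = 1 >].

Definition classical_inv (x : A) : A :=
  if pselect (exists y, y * x = 1) is left h then projT1 (cid h) else x.

Lemma classical_mulVr : {in classical_unit, left_inverse 1 classical_inv *%R}.
Proof.
move=> x /asboolP ux; rewrite /classical_inv; case: pselect => // h.
by case: cid.
Qed.

Lemma classical_unitP x y : y * x = 1 -> classical_unit x.
Proof. by move=> yx; apply/asboolP; exists y. Qed.

Lemma classical_inv_out : {in [predC classical_unit], classical_inv =1 id}.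
Proof.
move=> x /negP ux; rewrite /classical_inv; case: pselect => // h.
by case: ux; apply/asboolP.
Qed.

End ClassicalInverse.

Definition no_zero_divisors (A : comNzRingType) : Prop :=
  forall x y : A, x * y = 0 -> (x == 0) || (y == 0).

(** Up to a unit and an automorphism a nonzero element is a divisor with unique
    division, and so cannot divide zero. *)
Lemma weierstrass_domain (A B : comNzRingType) (ev : {rmorphism {poly A} ->
  B}) :
  weierstrass_ring ev -> no_zero_divisors B.
Proof.
move=> wB x y xy; have [//|x0 /=] := eqVneq x 0.
have [phi [psi [u [v [g [phiK uv phix [_ _ uniqg]]]]]]] := wB x x0.
have : ev g * phi y = 0.
  rewrite -[ev g]mul1r -uv [u * v]mulrC -[v * u * _]mulrA -phix -mulrA
    -rmorphM xy.
  by rewrite rmorph0 mulr0.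
move=> gy; have [||y0 _] := uniqg (phi y) 0.
- rewrite size_poly0 lt0n; apply: contraNneq x0 => /eqP;
  rewrite size_poly_eq0 => /eqP g0.
  by rewrite -[x]phiK phix g0 rmorph0 mulr0 rmorph0.
- by rewrite gy rmorph0 addr0.
by rewrite -[y]phiK y0 rmorph0.
Qed.

Lemma projective_free_retract (A B : comNzRingType) (f : {rmorphism A -> B})
    (g : {rmorphism B -> A}) :
  cancel g f -> projective_free A -> projective_free B.
Proof.
move=> gK pfA n E EE.
have : splits (map_mx g E) by apply: pfA; rewrite -map_mxM EE.
by move=> /(splits_map f); rewrite -map_mx_comp map_mx_id // => x /=;
  rewrite gK.
Qed.

Section OverconvergentProjectives.
Variables (R : realType) (n : nat) (K : fieldType) (a : nonarch_absval R K).
Hypothesis complete_a : complete_absval a.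

Lemma oc_init0_const (x : oc_init n a 0) : val x = mC (val x 0).
Proof.
apply/funext => I; rewrite /mC; case: (I =P 0) => [->|/eqP I0];
  first by rewrite mulr1.
have [_ sx] := oc_initP x; rewrite mulr0; apply/eqP;
  apply: contraNT I0 => /sx s.
by apply/eqP/ffunP => i; rewrite s // ffunE.
Qed.

Lemma oc_init_domain j : (j <= n)%N -> no_zero_divisors (oc_init n a j).
Proof.
case: j => [_|j jn]; last first.
  exact: (weierstrass_domain (@oc_eval_weierstrass _ _ _ _ complete_a
    (Ordinal jn))).
move=> x y xy; have := congr1 (fun z => val z 0) xy.
rewrite oc_init_valM oc_init0_const mCM => /eqP; rewrite mulf_eq0.
have z0 (z : oc_init n a 0) : val z 0 == 0 -> z == 0.
  by move=> /eqP e; apply/eqP/val_inj; rewrite oc_init0_const e rmorph0.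
by move=> /orP[/z0->|/z0->]; rewrite ?orbT.
Qed.

Section Domain.
Variables (j : nat) (jn : (j <= n)%N).
Local Notation T := (oc_init n a j).
Let U : comUnitRingType := HB.pack T (GRing.ComNzRing_hasMulInverse.Build T
  (@classical_mulVr T) (@classical_unitP T) (@classical_inv_out T)).
Definition oc_init_idomain : idomainType := HB.pack (GRing.ComUnitRing.sort U)
  (GRing.ComUnitRing_isIntegral.Build U (oc_init_domain jn)).
End Domain.

Lemma oc_init_projective_free j : (j <= n)%N -> projective_free (oc_init n a j).
Proof.
elim: j => [_|j IHj jn].
  have valM : monoid_morphism (fun x : oc_init n a 0 => val x 0).
    split=> [|x y]; first by rewrite oc_init_val1 mseries_oneE eqxx.
    by rewrite oc_init_valM {1}(oc_init0_const x) mCM.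
  pose f0 (x : oc_init n a 0) := val x 0.
  pose f : {rmorphism oc_init n a 0 -> K} := HB.pack f0
    (GRing.isZmodMorphism.Build _ _ f0 (fun x y => erefl))
    (GRing.isMonoidMorphism.Build _ _ f0 valM).
  have /choice [g gE] : forall c : K, exists x : oc_init n a 0, val x = mC c.
    by move=> c; apply: oc_init_exists;
      [exact: overconvergent_mC|exact: msupp_mC].
  have gB : zmod_morphism g by move=> x y; apply: val_inj;
    rewrite oc_init_valB !gE rmorphB.
  have gM : monoid_morphism g.
    by split=> [|x y]; apply: val_inj;
      rewrite ?oc_init_valM !gE ?rmorph1 ?rmorphM.
  pose g' : {rmorphism K -> oc_init n a 0} := HB.pack g
    (GRing.isZmodMorphism.Build _ _ g gB)
    (GRing.isMonoidMorphism.Build _ _ g gM).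
  apply: (@projective_free_retract _ _ g' f); last exact: projective_free_field.
  by move=> x; apply: val_inj; rewrite /= gE -oc_init0_const.
have jn' := ltnW jn.
exact: (@projective_free_weierstrass (oc_init_idomain jn') (oc_init_idomain jn)
  (oc_eval a (Ordinal jn)) (IHj jn')
  (@oc_eval_weierstrass _ _ _ _ complete_a (Ordinal jn))).
Qed.

Lemma oc_series_projective_free : projective_free (oc_series n a).
Proof.
have /choice [f fE] : forall x : oc_init n a n, exists y : oc_series n a,
  val y = val x.
  move=> x; have [ocx _] := oc_initP x.
  have h : val x \in oc_pred a by exact/asboolP.
  by exists (OcSeries h).
have /choice [g gE] : forall y : oc_series n a, exists x : oc_init n a n,
  val x = val y.
  move=> y; have /asboolP ocy := valP y.
  by apply: oc_init_exists => //; exact: msupp_all.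
have fB : zmod_morphism f by move=> x y; apply: val_inj;
  rewrite fE [RHS]rmorphB /= !fE.
have fM : monoid_morphism f.
  by split=> [|x y]; apply: val_inj; rewrite fE // [RHS]rmorphM /= !fE.
have gB : zmod_morphism g by move=> x y; apply: val_inj;
  rewrite gE oc_init_valB !gE.
have gM : monoid_morphism g.
  by split=> [|x y]; apply: val_inj; rewrite gE // oc_init_valM !gE.
pose f' : {rmorphism oc_init n a n -> oc_series n a} := HB.pack f
  (GRing.isZmodMorphism.Build _ _ f fB) (GRing.isMonoidMorphism.Build _ _ f fM).
pose g' : {rmorphism oc_series n a -> oc_init n a n} := HB.pack g
  (GRing.isZmodMorphism.Build _ _ g gB) (GRing.isMonoidMorphism.Build _ _ g gM).
apply: (@projective_free_retract _ _ f' g') (oc_init_projective_free (leqnn n)).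
by move=> x; apply: val_inj; rewrite /= fE gE.
Qed.

End OverconvergentProjectives.

(** * Lifting modulo an ideal contained in the Jacobson radical *)

Section Lifting.
Variables (B C : comNzRingType) (pi : {rmorphism B -> C}).
Hypothesis pi_surj : forall c, exists b, pi b = c.
Hypothesis pi_jacobson : forall b, pi b = 0 -> exists b', (1 + b) * b' = 1.

Lemma mx_lift m n (M : 'M[C]_(m, n)) : exists N : 'M[B]_(m, n), map_mx pi N = M.
Proof.
have [f fK] := choice pi_surj; exists (map_mx f M).
by apply/matrixP => i j; rewrite !mxE fK.
Qed.

Lemma mx_lift_inverse n (M : 'M[B]_n) : map_mx pi M = 1%:M ->
  exists N, N *m M = 1%:M.
Proof.
move=> M1; have [|d' dd'] := @pi_jacobson (\det M - 1).
  by rewrite rmorphB rmorph1 -det_map_mx M1 det1 subrr.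
exists (d' *: \adj M); rewrite addrC subrK in dd'.
by rewrite -scalemxAl mul_adj_mx scale_scalar_mx mulrC dd'.
Qed.

(** A factorization of the reduction of [E] lifts to one of an idempotent
    [X *m Y] below [E]. The difference [D] of the two is an idempotent which
    vanishes in the quotient, so that [1 - D] is invertible and [D] is zero. *)
Lemma projective_free_lift : projective_free C -> projective_free B.
Proof.
move=> pfC n E EE.
have [|r [X0 [Y0 [XY0 YX0]]]] := pfC n (map_mx pi E).
  by rewrite -map_mxM EE.
have [X1 X1E] := mx_lift X0; have [Y1 Y1E] := mx_lift Y0.
have e1 : map_mx pi (Y1 *m E *m X1) = 1%:M.
  by rewrite !map_mxM X1E Y1E -XY0 mulmxA YX0 mul1mx YX0.
have [U UE] := mx_lift_inverse e1.
pose X := E *m X1; pose Y := U *m Y1 *m E.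
have YX : Y *m X = 1%:M.
  by rewrite /Y /X mulmxA -(mulmxA _ E E) EE -UE !mulmxA.
exists r, X, Y; split=> //.
have piU : map_mx pi U = 1%:M.
  by have := congr1 (map_mx pi) UE; rewrite map_mxM e1 mulmx1 map_mx1.
have EX : E *m X = X by rewrite mulmxA EE.
have YE : Y *m E = Y by rewrite /Y -mulmxA EE.
have piXY : map_mx pi (X *m Y) = map_mx pi E.
  rewrite !map_mxM piU mul1mx X1E Y1E -XY0 !mulmxA.
  by rewrite -(mulmxA X0 Y0 X0) YX0 mulmx1 -(mulmxA X0 Y0 X0) YX0 mulmx1.
clearbody X Y; pose D := E - X *m Y.
have DD : D *m D = D.
  rewrite /D mulmxBr !mulmxBl EE (mulmxA E) EX -(mulmxA X Y E) YE.
  by rewrite -(mulmxA X Y (X *m Y)) (mulmxA Y) YX mul1mx subrr subr0.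
have piD : map_mx pi D = 0 by rewrite map_mxB piXY subrr.
have DE : D = E - X *m Y by [].
clearbody D.
have [|V VE] := @mx_lift_inverse _ (1%:M - D).
  by rewrite map_mxB piD map_mx1 subr0.
have D0 : D = 0.
  rewrite -[D]mul1mx -VE -mulmxA mulmxBl mul1mx DD subrr mulmx0 //.
by apply/esym/eqP; rewrite -subr_eq0 -DE D0.
Qed.

End Lifting.

Section TrivialAbsoluteValue.
Variables (R : realType) (k : fieldType).

Fact trivial_absvM (x y : k) : (x * y != 0)%:R = (x != 0)%:R * (y != 0)%:R :> R.
Proof. by rewrite mulf_eq0 negb_or -natrM mulnb. Qed.

Definition trivial_absv : nonarch_absval R k.
Proof.
exists (fun x => (x != 0)%:R).
- by move=> x; rewrite ler0n.
- by move=> x; split=> [/eqP|->];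
  [rewrite pnatr_eq0 eqb0 negbK => /eqP|rewrite eqxx].
- exact: trivial_absvM.
- move=> x y; rewrite le_max !ler_nat.
  have [->|] := eqVneq x 0; first by rewrite add0r leqnn orbT.
  by rewrite leq_b1.
Defined.

Lemma trivial_absv_complete : complete_absval trivial_absv.
Proof.
move=> u uC; have [N hN] := uC 1 ltr01.
exists (u N) => e e0; exists N => i Ni.
have := hN i N Ni (leqnn N); rewrite /= subr_eq0.
by have [_ _|_] := eqVneq (u i) (u N); rewrite ?ltxx.
Qed.

End TrivialAbsoluteValue.

(** A geometric series, each coefficient of which is a finite sum. *)
Lemma mseries_inverse n (A : comNzRingType) (f : mseries n A) (u : A) :
  u * f 0 = 1 -> exists g, f * g = 1.
Proof.
move=> uf; pose h : mseries n A := 1 - mC u * f.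
have h0 : h 0 = 0 by rewrite /h mseriesBE mCM uf mseries_oneE eqxx subrr.
have hk k : mord k (h ^+ k).
  elim: k => [//|k IHk]; rewrite exprS -add1n; apply: mordM => // J.
  by rewrite ltnS leqn0 mdeg_eq0 => /eqP->.
pose g : mseries n A := fun J => (\sum_(k < (mdeg J).+1) h ^+ k) J.
have gN N : eqm N g (\sum_(k < N.+1) h ^+ k).
  move=> J JN; rewrite /g !mseries_sumE -!(big_mkord xpredT (fun k =>
    (h ^+ k) J)).
  rewrite [RHS](big_cat_nat (n := (mdeg J).+1)) //= [X in _ + X]big_nat_cond.
  rewrite [X in _ + X]big1 ?addr0 // => k /andP[/andP[Jk _] _].
  exact: hk.
exists (mC u * g); rewrite mulrCA mulrA.
have -> : mC u * f = 1 - h by rewrite /h subKr.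
apply: eqmP => N; apply: eqm_trans (eqmM (fun _ _ => erefl) (gN N)) _ => J JN.
rewrite -opprB mulNr -subrX1 opprB mseriesBE (hk N.+1) ?ltnS // subr0 //.
Qed.

(** * Overconvergent series over a discrete valuation ring *)

Section Valuation.
Variables (R : realType) (p : nat) (O : mixed_dvr p).
Implicit Types x y : O.

Let ord1 : dvr_ord (1 : O) = 0.
Proof.
by apply: (@addrI _ (dvr_ord (1 : O)));
  rewrite -dvr_ordM ?oner_eq0 // mulr1 addr0.
Qed.

Definition ord_ge (b : R) x : Prop := x = 0 \/ b <= (dvr_ord x)%:~R.

Lemma ord_ge_le b d x : b <= d -> ord_ge d x -> ord_ge b x.
Proof. by move=> bd [->|dx]; [left|right; exact: le_trans dx]. Qed.

Lemma ord_ge0 x : ord_ge 0 x.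
Proof.
by have [->|x0] := eqVneq x 0; [left|right; rewrite ler0z dvr_ord_ge0].
Qed.

Lemma ord_geD b x y : ord_ge b x -> ord_ge b y -> ord_ge b (x + y).
Proof.
have [->|x0] := eqVneq x 0; first by rewrite add0r.
have [->|y0] := eqVneq y 0; first by rewrite addr0.
have [->|xy0] := eqVneq (x + y) 0; first by left.
move=> [/eqP|bx]; first by rewrite (negPf x0).
move=> [/eqP|b_y]; first by rewrite (negPf y0).
right; have : Num.min (dvr_ord x) (dvr_ord y) <= dvr_ord (x + y).
  by rewrite /dvr_ord tofracD dvalD ?tofrac_eq0 // -tofracD tofrac_eq0.
by rewrite ge_min => /orP[] h; [apply: le_trans bx _|apply: le_trans b_y _];
  rewrite ler_int.
Qed.

Lemma ord_geM b d x y : ord_ge b x -> ord_ge d y -> ord_ge (b + d) (x * y).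
Proof.
move=> [->|bx]; first by left; rewrite mul0r.
move=> [->|dy]; first by left; rewrite mulr0.
have [->|x0] := eqVneq x 0; first by left; rewrite mul0r.
have [->|y0] := eqVneq y 0; first by left; rewrite mulr0.
by right; rewrite dvr_ordM // intrD lerD.
Qed.

Lemma ord_geMl b x y : ord_ge b y -> ord_ge b (x * y).
Proof. by move=> /(ord_geM (ord_ge0 x)); rewrite add0r. Qed.

Lemma ord_ge_sum (T : eqType) (s : seq T) (F : T -> O) b :
  {in s, forall i, ord_ge b (F i)} -> ord_ge b (\sum_(i <- s) F i).
Proof.
move=> sF; rewrite big_seq; elim/big_ind: _ => [|x y|i]; first by left.
  exact: ord_geD.
exact: sF.
Qed.

Lemma maxideal_ord x : dvr_maxideal x <-> ord_ge 1 x.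
Proof.
split=> -[->|xx]; [by left| |by left|]; right;
  last by rewrite -(ltr0z R) (lt_le_trans ltr01).
by rewrite ler1z.
Qed.

Lemma dvr_unit x : ~ dvr_maxideal x -> exists y, y * x = 1.
Proof.
move=> mx; have x0 : x != 0 by apply/eqP => x0; apply: mx; left.
have ox : dvr_ord x = 0.
  apply/eqP; rewrite eq_le dvr_ord_ge0 // andbT leNgt; apply/negP => ox.
  by apply: mx; right.
have fx0 : FracField.tofrac (x : O) != 0 by rewrite tofrac_eq0.
have : 0 <= dvr_val O (FracField.tofrac (x : O))^-1.
  have := dvalM (dvr_val O) fx0 (invr_neq0 fx0).
  by rewrite mulfV // -tofrac1 -/(dvr_ord (1 : O)) ord1 -/(dvr_ord x) ox
    add0r => <-.
move=> /(dvr_valP (invr_neq0 fx0)) [y yE]; exists y.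
by apply/eqP; rewrite -tofrac_eq tofracM -yE tofrac1 mulVf.
Qed.

Lemma dvr_maximal : maximal_axiom (@dvr_maxideal O).
Proof.
split; first split.
- by left.
- by move=> x y /maxideal_ord mx /maxideal_ord my; apply/maxideal_ord/ord_geD.
- by move=> x y /maxideal_ord mx; apply/maxideal_ord/ord_geMl.
- by case=> [/eqP|]; rewrite ?oner_eq0 // ord1 ltxx.
by move=> x /dvr_unit[y yx]; exists y; rewrite yx subrr; left.
Qed.

End Valuation.

Section Reduction.
Variables (R : realType) (n p : nat) (O : mixed_dvr p).
Implicit Types (c f g : mseries n O) (I J : midx n).
Local Notation oge := (@ord_ge R p O).

Lemma overconvergent_dvr_ord c : overconvergent_dvr R c <->
  exists eps C : R, [/\ 0 < eps, 0 <= C & forall I,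
    oge (eps * (mdeg I)%:R - C) (c I)].
Proof.
have ep0 : 0 < (dvr_ord (p%:R : O))%:~R :> R by rewrite ltr0z dvr_ordp_gt0.
rewrite overconvergent_dvrP; split=> -[eps [C [eps0 C0 cP]]].
  exists (eps * (dvr_ord (p%:R : O))%:~R), (C * (dvr_ord (p%:R : O))%:~R).
  split=> [||I]; rewrite ?mulr_gt0 ?mulr_ge0 ?(ltW ep0) //.
  case: (cP I) => [->|h]; [by left|right].
  by move: h; rewrite ler_pdivlMr // mulrBl mulrAC.
exists (eps / (dvr_ord (p%:R : O))%:~R), (C / (dvr_ord (p%:R : O))%:~R).
split=> [||I]; rewrite ?divr_gt0 ?divr_ge0 ?(ltW ep0) //.
case: (cP I) => [->|h]; [by left|right].
by rewrite ler_pdivlMr // mulrBl mulrAC !divfK ?gt_eqF.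
Qed.

(** The inverse [g] exists as a formal series, and the constant coefficient of
    [1 + c] is a unit. For J != 0 the order of [c J] is at least 1 and at least
    [eps * mdeg J - C], hence at least [e' * mdeg J] for some [e' > 0]; the
    recursion for the coefficients of [g] propagates this lower bound. *)
Lemma overconvergent_dvr_inverse c : overconvergent_dvr R c ->
  (forall I, dvr_maxideal (c I)) ->
  exists2 g, overconvergent_dvr R g & (1 + c) * g = 1.
Proof.
move=> /overconvergent_dvr_ord[eps [C [eps0 C0 cP]]] cm.
have [u uE] : exists u, u * (1 + c) 0 = 1.
  have [[_ mD mM] m1 _] := dvr_maximal R O; apply: dvr_unit => m0; apply: m1.
  have -> : 1 = (1 + c) 0 + (-1) * c 0
    by rewrite mseriesDE mseries_oneE eqxx mulN1r addrK.
  by apply: mD => //; exact: mM.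
have [g gE] := mseries_inverse uE; exists g => //.
pose e' := Num.min (eps / 2) (eps / (2 * (C + 1))).
have e'0 : 0 < e' by rewrite lt_min !divr_gt0 //; lra.
have cP' J : J != 0 -> oge (e' * (mdeg J)%:R) (c J).
  move=> J0; have [le|lt] := leP (2 * (C + 1)) (eps * (mdeg J)%:R).
    apply: ord_ge_le (cP J).
    have : e' * (mdeg J)%:R <= eps / 2 * (mdeg J)%:R.
      by rewrite ler_wpM2r // ge_min lexx.
    lra.
  apply: ord_ge_le (_ : oge 1 (c J)); last exact/maxideal_ord.
  apply: (@le_trans _ _ (eps / (2 * (C + 1)) * (mdeg J)%:R)).
    by rewrite ler_wpM2r // ge_min lexx orbT.
  by rewrite mulrAC ler_pdivrMr ?mul1r ?ltW //; lra.
apply/overconvergent_dvr_ord; exists e', 0; split=> // I; rewrite subr0.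
have [N] := ubnP (mdeg I); elim: N I => // N IHN I; rewrite ltnS => IN.
have := congr1 (fun f : mseries n O => f I) gE.
rewrite mseries_mulE (bigD1_seq 0) ?mbelow_uniq ?mem_mbelow ?mle0 //= msub0.
set T := \sum_(i <- _ | _) _; move=> e.
have -> : g I = u * ((1 : mseries n O) I - T).
  by rewrite -e addrK mulrA uE mul1r.
apply: ord_geMl; rewrite -[- T]mulN1r; apply: ord_geD.
  rewrite mseries_oneE; case: (I =P 0) => [->|_]; last by left.
  by rewrite mdeg0 mulr0; exact: ord_ge0.
apply: ord_geMl; rewrite /T -big_filter; apply: ord_ge_sum => J.
rewrite mem_filter mem_mbelow => /andP[J0 JI].
rewrite mseriesDE mseries_oneE (negPf J0) add0r -{1}(msubK JI) mdegD natrD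
  mulrDr.
apply: ord_geM; first exact: cP'.
apply: IHN; rewrite (leq_trans _ IN) // -{2}(msubK JI) mdegD.
by rewrite -[X in (X < _)%N]add0n ltn_add2r lt0n mdeg_eq0.
Qed.

End Reduction.

(** For the trivial absolute value the overconvergent series are the
    polynomials. *)
Lemma trivial_overconvergent (R : realType) n (k : fieldType) (f : mseries n
  k) :
  overconvergent (trivial_absv R k) f <->
  exists N, forall I, (N <= mdeg I)%N -> f I = 0.
Proof.
rewrite overconvergentP; split=> [[rho [B [rho1 fB]]]|[N fN]].
  have rho0 : 0 < rho by lra.
  have i1 : 0 <= rho^-1 < 1 by rewrite invr_ge0 ltW //= invf_lt1.
  have [N hN] := geometric_small B i1 ltr01.
  exists N => I /hN; rewrite exprVn ltr_pdivrMr ?exprn_gt0 // mul1r => lt.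
  apply/eqP; apply: contraT => fI0; have := fB I.
  by rewrite /= fI0 mul1r leNgt lt.
exists 2, (2 ^+ N); split=> [|I]; first by lra.
have [IN|/fN ->] := ltnP (mdeg I) N; last first.
  by rewrite /= eqxx mul0r exprn_ge0.
apply: (@le_trans _ _ (1 * 2 ^+ mdeg I)).
  by rewrite ler_wpM2r ?exprn_ge0 //= lern1 leq_b1.
rewrite mul1r; apply: ler_weXn2l; [by lra|exact: ltnW].
Qed.

Section Reduction.
Variables (R : realType) (n p : nat) (O : mixed_dvr p).
Variables (k : fieldType) (pi : {rmorphism O -> k}).
Hypothesis pi_surj : forall x, exists y, pi y = x.
Hypothesis pi_ker : forall y, pi y = 0 <-> dvr_maxideal y.
Local Notation B := (ocd_series R n O).
Local Notation C := (oc_series n (trivial_absv R k)).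

Lemma reduction_polynomial (c : mseries n O) : overconvergent_dvr R c ->
  exists N, forall I, (N <= mdeg I)%N -> pi (c I) = 0.
Proof.
move=> /(overconvergent_dvr_ord R)[eps [D [eps0 D0 cP]]].
exists (Num.truncn ((D + 1) / eps)).+1 => I NI; apply/pi_ker/(maxideal_ord R).
apply: ord_ge_le (cP I); rewrite lerBrDr addrC mulrC -ler_pdivrMr //.
apply: (@le_trans _ _ (Num.truncn ((D + 1) / eps)).+1%:R);
  last by rewrite ler_nat.
by rewrite ltW // real_truncnS_gt // num_real.
Qed.

Lemma reduction_exists : exists red : {rmorphism B -> C},
  forall (x : B) I, val (red x) I = pi (val x I).
Proof.
have /choice [f fE] : forall x : B, exists y : C, val y = fun I => pi (val x I).
  move=> x; have /asboolP/reduction_polynomial ocx := valP x.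
  have h : (fun I => pi (val x I)) \in @oc_pred R n k (trivial_absv R k).
    exact/asboolP/trivial_overconvergent.
  by exists (OcSeries h).
have fB : zmod_morphism f.
  move=> x y; apply: val_inj; rewrite fE [RHS]rmorphB /= !fE.
  by apply/funext => I; exact: (rmorphB pi (val x I) (val y I)).
have fM : monoid_morphism f.
  split=> [|x y]; apply: val_inj; rewrite fE.
    by apply/funext => I; exact: (rmorph_nat pi (I == 0)).
  rewrite [RHS]rmorphM /= !fE; apply/funext => I.
  transitivity (pi ((val x * val y) I)); first by [].
  rewrite !mseries_mulE rmorph_sum.
  by apply: eq_bigr => J _; rewrite rmorphM.
pose red : {rmorphism B -> C} := HB.pack f
  (GRing.isZmodMorphism.Build _ _ f fB) (GRing.isMonoidMorphism.Build _ _ f fM).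
by exists red => x I; rewrite /= fE.
Qed.

(** Reduction modulo the maximal ideal is a morphism onto the polynomial ring
    over the residue field, which is the ring of overconvergent series for the
    trivial absolute value; its kernel is contained in the Jacobson radical. *)
Lemma ocd_series_projective_free : projective_free B.
Proof.
have [red redE] := reduction_exists.
apply: (@projective_free_lift _ _ red).
- move=> y; have /asboolP/trivial_overconvergent[N yN] := valP y.
  have [s sK] := choice pi_surj.
  pose c : mseries n O := fun I => if val y I == 0 then 0 else s (val y I).
  have ocdc : c \in @ocd_pred R n p O.
    apply/asboolP/overconvergent_dvr_ord; exists 1, N%:R; split=> // I.
    rewrite /c; case: eqP => [_|/eqP yI]; first by left.
    apply: ord_ge_le (ord_ge0 R _); rewrite mul1r subr_le0 ler_nat.
    by rewrite leqNgt; apply: contra yI => /ltnW /yN ->.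
  exists (OcdSeries ocdc); apply: val_inj; apply/funext => I;
    rewrite redE /= /c.
  by case: eqP => [->|_]; rewrite ?rmorph0 ?sK.
- move=> x x0; have /asboolP ocx := valP x.
  have [|g ocg gE] := overconvergent_dvr_inverse ocx.
    by move=> I; apply/pi_ker; rewrite -redE x0.
  have h : g \in @ocd_pred R n p O by exact/asboolP.
  by exists (OcdSeries h); apply: val_inj.
exact/oc_series_projective_free/trivial_absv_complete.
Qed.

End Reduction.

Theorem theorem6p7 (R : realType) (n : nat) :
  (forall (K : fieldType) (a : nonarch_absval R K),
     nontrivial_absval a -> complete_absval a ->
     forall P : lmodType (oc_series n a),
       finite_module P -> projective_module P -> free_module P) /\
  (forall (p : nat) (O : mixed_dvr p),
     complete_dvr O ->
     forall P : lmodType (ocd_series R n O),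
       finite_module P -> projective_module P -> free_module P).
Proof.
split=> [K a _ ca P|p O _ P]; apply: projective_free_module.
  exact: oc_series_projective_free.
have [k [pi [surj ker]]] := maximal_quotient (dvr_maximal R O).
exact: ocd_series_projective_free surj ker.
Qed.
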